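(* There exists a function $\varepsilon : \mathbb{Z}_{\geq 1} \to \mathbb{R}$ with $\varepsilon(n) \to 0$ as $n \to \infty$ such that for every $n \geq 1$ and every lattice $\mathcal{L} \subset \mathbb{R}^n$, $$\frac{1}{2} \leq \mu(\mathcal{L})\, \lambda_1(\mathcal{L}^* ) < \big(0.1275 + \varepsilon(n)\big)\cdot n .$$ Equivalently for the upper bound, $T_n < 0.1275 + o(1)$, where $T_n := \frac{1}{n} \cdot \sup_{\mathcal{L} \subset \mathbb{R}^n} \mu(\mathcal{L}) \lambda_1(\mathcal{L}^* )$, the supremum being over all lattices in $\mathbb{R}^n$, and $o(1)$ denotes a function of $n$ only that tends to $0$ as $n \to \infty$.
   Context: A lattice $\mathcal{L} \subset \mathbb{R}^n$ is the set of all integer linear combinations $z_1 \boldsymbol{b}_1 + \cdots + z_n \boldsymbol{b}_n$ ($z_i \in \mathbb{Z}$) of $n$ linearly independent vectors $\boldsymbol{b}_1, \ldots, \boldsymbol{b}_n \in \mathbb{R}^n$ (so lattices are full rank). The dual lattice is $\mathcal{L}^* := \{\boldsymbol{w} \in \mathbb{R}^n : \langle \boldsymbol{w}, \boldsymbol{y}\rangle \in \mathbb{Z} \text{ for all } \boldsymbol{y} \in \mathcal{L}\}$. With $\|\cdot\|$ the Euclidean norm, $\lambda_1(\mathcal{L}) := \min_{\boldsymbol{y} \in \mathcal{L}\setminus\{\boldsymbol{0}\}} \|\boldsymbol{y}\|$ is the length of a shortest non-zero lattice vector, and $\mu(\mathcal{L}) := \max_{\boldsymbol{t} \in \mathbb{R}^n}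 \min_{\boldsymbol{y} \in \mathcal{L}} \|\boldsymbol{y} - \boldsymbol{t}\|$ is the covering radius. *)

(* Defs.v *)
From HB Require Import structures.
From mathcomp Require Import all_boot all_order all_algebra archimedean.
From mathcomp Require Import all_classical all_reals all_analysis.

Set Implicit Arguments.
Unset Strict Implicit.
Unset Printing Implicit Defensive.

Import Order.TTheory GRing.Theory Num.Theory.
Import numFieldNormedType.Exports.

Local Open Scope classical_set_scope.
Local Open Scope ring_scope.

Definition dotp (R : realType) (n : nat) (u v : 'rV[R]_n) : R :=
  \sum_(i < n) u 0 i * v 0 i.

(* The library norm `|v| on 'rV[R]_n is the sup norm, hence this definition. *)
Definition enorm (R : realType) (n : nat) (v : 'rV[R]_n) : R :=
  Num.sqrt (dotp v v).

(* The basis vectors b_1, ..., b_n are the rows of B. *)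
Definition is_lattice (R : realType) (n : nat) (L : set 'rV[R]_n) : Prop :=
  exists B : 'M[R]_n, row_free B /\
    L = [set y | exists z : 'I_n -> int, y = \sum_(i < n) (z i)%:~R *: row i B].

Definition dual_lattice (R : realType) (n : nat) (L : set 'rV[R]_n) :
    set 'rV[R]_n :=
  [set w | forall y, L y -> dotp w y \is a Num.int].

(* For a lattice in dimension n >= 1 this infimum is attained (lattices are
   discrete), so it is the minimum. *)
Definition lambda1 (R : realType) (n : nat) (L : set 'rV[R]_n) : R :=
  inf [set enorm y | y in L `\ 0].

Definition lattice_dist (R : realType) (n : nat) (L : set 'rV[R]_n)
    (t : 'rV[R]_n) : R :=
  inf [set enorm (y - t) | y in L].

(* For a lattice the distance to L is continuous and L-periodic, so both
   extrema are attained and this is the max-min of the usual definition.  The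
   default value of sup on an unbounded set is 0; it is incompatible with a
   positive lower bound on covering_radius L * lambda1 (dual_lattice L). *)
Definition covering_radius (R : realType) (n : nat) (L : set 'rV[R]_n) : R :=
  sup [set lattice_dist L t | t in [set: 'rV[R]_n]].

(* The supremum is taken in the extended reals, so that T_n < +oo is a genuine
   boundedness assertion. *)
Definition transference (R : realType) (n : nat) : \bar R :=
  ((n%:R^-1)%:E *
   ereal_sup [set (covering_radius L * lambda1 (dual_lattice L))%:E |
              L in [set L : set 'rV[R]_n | is_lattice L]])%E.

(* Main.v *)
(* The constant comes from 2^0.401 / (2 pi sqrt e) < 0.1275.  Normalize the dual lattice to have minimum 1
   and put Theta(a) = sum of exp(-a |w|^2) over its non-zero vectors w.  By Poisson summation, if
   Theta(b) <= 1/4 then the Gaussian sums of the primal lattice with parameter pi^2 / b are nearly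
   independent of the centre, which forces a lattice point within about sqrt(n b / (2 pi^2)) of every
   target (Banaszczyk).  With b = n beta / 2 this is n sqrt(beta) / (2 pi), so it remains to show that
   Theta(n beta / 2) -> 0.  The dual vectors in a shell |w|^2 ~ q have mutual distance at least 1, and
   averaging over the position of a ball of squared radius x (Sidelnikov) shows that there are at most
   A (q / x)^(n/2) e^(o(n)) of them, where A bounds the number of such points in that ball.  Since
   q e^(-beta q) <= 1 / (e beta), each shell contributes at most A (e beta x)^(-n/2) e^(o(n)); shells
   with q >= 4 are controlled by Theta itself.  Finally A is a spherical code bound of
   Kabatiansky-Levenshtein type.  Instead of Gegenbauer polynomials on the sphere it uses the kernels
   K_j(x, y) = sum over |al| = j of products of normalized Hermite polynomials: they are positive
   semidefinite, multiplication by <x, y> is tridiagonal on them up to a positive term, so a suitable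
   combination K satisfies <x, y> K >= lam K, and K has few features. *)
Require Import Defs.
From mathcomp Require Import all_boot all_order all_algebra archimedean.
From mathcomp Require Import all_classical all_reals all_analysis.
From mathcomp Require Import ring lra zify.

Import Order.TTheory GRing.Theory Num.Theory.
Import numFieldNormedType.Exports.

Local Open Scope classical_set_scope.
Local Open Scope ring_scope.

Set Implicit Arguments.
Unset Strict Implicit.
Unset Printing Implicit Defensive.

(** * Absolutely convergent sums *)

(** All comparisons are between Gaussian sums at two parameters, so Poisson summation is needed only
    up to a positive factor independent of parameter and translation. This permits an elementary
    proof: the case of the line is the limit of a finite Fourier identity for binomial coefficients,
    and coordinates are then added one at a time. Averages over ball positions are sums over a very
    fine lattice, with Gaussians replacing indicators. The number [2^0.401] is, after rounding, the
    least value over [x] of the code rate divided by [sqrt x]. That function is flat near its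
    minimum, and [x = 17 / 18] makes the ideal parameters rational: cosine [8 / 17], degree rate
    [1 / 15], evaluation point [1 / 16]. The margin is thin, [0.127499] against [0.1275], so [pi]
    and some exponentials must be bounded below to four or five digits. The bounds must also hold
    for every [n >= 1]. A crude covering bound [n + 6] serves small [n]; it also shows that
    distances to a lattice are bounded, without which the covering radius would take the default
    value of [sup] and the lower bound would fail. *)

Section AbsoluteSums.
Variable R : realType.
Implicit Types I J : choiceType.

Definition smb I (f : I -> R) : Prop :=
  (\esum_(i in [set: I]) (`|f i|)%:E < +oo)%E.

Definition nsum I (f : I -> R) : R := fine (\esum_(i in [set: I]) (f i)%:E)%E.

(* For nonnegative summable [f], [esum] already has a rich theory; a signed
   sum is the difference of two such sums. *)
Definition usum I (f : I -> R) : R :=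
  nsum (fun i => f i + `|f i|) - nsum (fun i => `|f i|).

Lemma esum_nsum I (f : I -> R) : (forall i, 0 <= f i) -> smb f ->
  (\esum_(i in [set: I]) (f i)%:E)%E = (nsum f)%:E.
Proof.
move=> f0 sf; rewrite /nsum fineK// ge0_fin_numE; last first.
  by apply: esum_ge0 => i _; rewrite lee_fin.
move: sf; rewrite /smb; under eq_esum do rewrite ger0_norm//.
by [].
Qed.

Lemma smb_le I (f g : I -> R) : (forall i, `|f i| <= g i) -> smb g -> smb f.
Proof.
move=> fg; apply: le_lt_trans; apply: le_esum => i _.
by rewrite lee_fin (le_trans (fg i))// ler_norm.
Qed.

Lemma smbD I (f g : I -> R) : smb f -> smb g -> smb (fun i => f i + g i).
Proof.
move=> sf sg; rewrite /smb.
apply: (@le_lt_trans _ _ (\esum_(i in [set: I]) ((`|f i|)%:E + (`|g i|)%:E))%E).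
  by apply: le_esum => i _; rewrite -EFinD lee_fin ler_normD.
rewrite esumD; first exact: lte_add_pinfty.
  by move=> i _; rewrite lee_fin.
by move=> i _; rewrite lee_fin.
Qed.

Lemma smbN I (f : I -> R) : smb f -> smb (fun i => - f i).
Proof. by rewrite /smb => sf; under eq_esum do rewrite normrN. Qed.

Lemma smb_norm I (f : I -> R) : smb f -> smb (fun i => `|f i|).
Proof. by rewrite /smb => sf; under eq_esum do rewrite normr_id. Qed.

Lemma nsumD I (f g : I -> R) : (forall i, 0 <= f i) -> (forall i, 0 <= g i) ->
  smb f -> smb g -> nsum (fun i => f i + g i) = nsum f + nsum g.
Proof.
move=> f0 g0 sf sg; apply: EFin_inj; rewrite EFinD -!esum_nsum//.
- by rewrite -esumD// => i _; rewrite lee_fin.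
- by move=> i; rewrite addr_ge0.
- exact: smbD.
Qed.

Lemma normDge0 (x y : R) : `|x| <= y -> 0 <= x + y.
Proof. by move=> h; have := ler_norm (- x); rewrite normrN; lra. Qed.

(** Any summable majorant [g] may replace [|f|] in the definition of [usum]: sum both sides of
    [(f + g) + |f| = (f + |f|) + g]. This freedom is what makes additivity easy. *)
Lemma sumE I (f g : I -> R) : (forall i, `|f i| <= g i) -> smb g ->
  usum f = nsum (fun i => f i + g i) - nsum g.
Proof.
move=> fg sg; have sf := smb_le fg sg.
have g0 i : 0 <= g i by apply: le_trans (fg i).
have fg0 i : 0 <= f i + g i by apply: normDge0.
have ff0 i : 0 <= f i + `|f i| by apply: normDge0.
have := nsumD ff0 g0 (smbD sf (smb_norm sf)) sg.
have := nsumD fg0 (fun i => normr_ge0 (f i)) (smbD sf sg) (smb_norm sf).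
have -> : (fun i => f i + g i + `|f i|) = (fun i => f i + `|f i| + g i).
  by apply/funext => i; rewrite addrAC.
by rewrite /usum; lra.
Qed.

Lemma sum_ge0E I (f : I -> R) : (forall i, 0 <= f i) -> smb f -> usum f = nsum f.
Proof.
move=> f0 sf; rewrite (@sumE _ f f) ?nsumD//; first by rewrite addrK.
by move=> i; rewrite ger0_norm.
Qed.

Lemma eq_sum I (f g : I -> R) : f =1 g -> usum f = usum g.
Proof. by move=> /funext ->. Qed.

Lemma sumD I (f g : I -> R) : smb f -> smb g ->
  usum (fun i => f i + g i) = usum f + usum g.
Proof.
move=> sf sg; have [sf' sg'] := (smb_norm sf, smb_norm sg).
rewrite (@sumE _ _ (fun i => `|f i| + `|g i|)); last 2 first.
- by move=> i; apply: ler_normD.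
- exact: smbD.
have e : (fun i => f i + g i + (`|f i| + `|g i|)) =
  (fun i => (f i + `|f i|) + (g i + `|g i|)) by apply/funext => i; rewrite addrACA.
rewrite e [X in X - _]nsumD; last 4 first.
- by move=> i; apply: normDge0.
- by move=> i; apply: normDge0.
- exact: smbD.
- exact: smbD.
rewrite [X in _ - X]nsumD// /usum; ring.
Qed.

Lemma sumN I (f : I -> R) : smb f -> usum (fun i => - f i) = - usum f.
Proof.
move=> sf; apply/eqP; rewrite -addr_eq0 -sumD//; last exact: smbN.
under eq_sum do rewrite addNr.
rewrite /usum; under [X in nsum X]eq_fun do rewrite add0r.
by rewrite subrr.
Qed.

Lemma nsumZ I (f : I -> R) (c : R) : 0 < c -> (forall i, 0 <= f i) -> smb f ->
  nsum (fun i => c * f i) = c * nsum f.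
Proof.
move=> c0 f0 sf.
(* Only one inequality is proved directly; the reverse one is the same statement for [c^-1] and the
   family [c * f]. *)
have key (d : R) (g : I -> R) : 0 < d -> (forall i, 0 <= g i) -> smb g ->
  (\esum_(i in [set: I]) (d * g i)%:E <= (d * nsum g)%:E)%E.
  move=> d0 g0 sg; apply: ge_ereal_sup => _ [A [fA _] <-].
  rewrite fsbig_finite//= sumEFin lee_fin -mulr_sumr ler_pM2l//.
  rewrite -lee_fin -esum_nsum// -sumEFin; apply: esum_ge; exists A => //.
  by rewrite fsbig_finite.
have scf : smb (fun i => c * f i).
  rewrite /smb; under eq_esum do rewrite ger0_norm ?mulr_ge0 ?(ltW c0)//.
  by apply: le_lt_trans (key _ _ c0 f0 sf) _; rewrite ltry.
have cf0 i : 0 <= c * f i by rewrite mulr_ge0// ltW.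
apply/eqP; rewrite eq_le; apply/andP; split.
  by rewrite -lee_fin -esum_nsum// key.
have ci0 : 0 < c^-1 by rewrite invr_gt0.
have := key _ _ ci0 cf0 scf.
under eq_esum do rewrite mulKf ?gt_eqF//.
by rewrite esum_nsum// lee_fin ler_pdivlMl.
Qed.

Lemma smbZ I (f : I -> R) (c : R) : smb f -> smb (fun i => c * f i).
Proof.
move=> sf; rewrite /smb; apply: (@le_lt_trans _ _ ((`|c| + 1) * nsum (fun i => `|f i|))%:E);
  last by rewrite ltry.
have c1 : 0 < `|c| + 1 by rewrite ltr_wpDl.
apply: ge_ereal_sup => _ [A [fA _] <-].
rewrite fsbig_finite//= sumEFin lee_fin.
under eq_bigr do rewrite normrM.
rewrite -mulr_sumr; apply: ler_pM => //.
- by apply: sumr_ge0.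
- by rewrite lerDl.
rewrite -lee_fin -esum_nsum//; last exact: smb_norm.
rewrite -sumEFin; apply: esum_ge; exists A => //.
by rewrite fsbig_finite.
Qed.

Lemma sumZ I (f : I -> R) (c : R) : smb f -> usum (fun i => c * f i) = c * usum f.
Proof.
move=> sf; wlog c0 : c / 0 <= c => [th|].
  have [/th//|c0] := leP 0 c.
  have := th (- c); rewrite oppr_ge0 (ltW c0) mulNr => /(_ isT).
  under eq_sum do rewrite mulNr.
  by rewrite sumN; [move/oppr_inj|exact: smbZ].
have := c0; rewrite le_eqVlt => /predU1P[<-|c1].
  rewrite mul0r; under eq_sum do rewrite mul0r.
  rewrite /usum; under [X in nsum X]eq_fun do rewrite add0r.
  by rewrite subrr.
rewrite (@sumE _ _ (fun i => c * `|f i|)); last 2 first.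
- by move=> i; rewrite normrM ger0_norm.
- exact/smbZ/smb_norm.
rewrite [X in _ - X]nsumZ//; last exact: smb_norm.
under [X in nsum X - _]eq_fun do rewrite -mulrDr.
rewrite nsumZ//; first by rewrite /usum; ring.
- by move=> i; apply: normDge0.
- by apply/smbD/smb_norm.
Qed.

Lemma nsum_ge0 I (f : I -> R) : (forall i, 0 <= f i) -> 0 <= nsum f.
Proof. by move=> f0; apply/fine_ge0/esum_ge0 => i _; rewrite lee_fin. Qed.

Lemma sum_ge0 I (f : I -> R) : (forall i, 0 <= f i) -> smb f -> 0 <= usum f.
Proof. by move=> f0 sf; rewrite sum_ge0E// nsum_ge0. Qed.

Lemma sum_le I (f g : I -> R) : smb f -> smb g -> (forall i, f i <= g i) ->
  usum f <= usum g.
Proof.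
move=> sf sg fg; rewrite -subr_ge0 -sumN// -sumD//; last exact: smbN.
by apply: sum_ge0 => [i|]; [rewrite subr_ge0|exact/smbD/smbN].
Qed.

Lemma sum_norm_le I (f g : I -> R) : smb g -> (forall i, `|f i| <= g i) ->
  `|usum f| <= usum g.
Proof.
move=> sg fg; have sf := smb_le fg sg; rewrite ler_norml; apply/andP; split.
  rewrite -sumN//; apply: sum_le => //; first exact: smbN.
  by move=> i; have := fg i; rewrite ler_norml => /andP[].
by apply: sum_le => // i; apply: le_trans (fg i); rewrite ler_norm.
Qed.

Lemma le_seq_sum I (f : I -> R) (s : seq I) : (forall i, 0 <= f i) -> smb f ->
  uniq s -> \sum_(i <- s) f i <= usum f.
Proof.
move=> f0 sf us; rewrite sum_ge0E// -lee_fin -esum_nsum// -sumEFin.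
apply: esum_ge; exists [set` s]; first by split.
by rewrite fsbig_seq.
Qed.

Lemma sum_le_seq I (f : I -> R) (C : R) : (forall i, 0 <= f i) ->
  (forall s : seq I, uniq s -> \sum_(i <- s) f i <= C) -> smb f /\ usum f <= C.
Proof.
move=> f0 fC.
have key : (\esum_(i in [set: I]) (f i)%:E <= C%:E)%E.
  apply: ge_ereal_sup => _ [A [fA _] <-].
  by rewrite fsbig_finite//= sumEFin lee_fin fC// fset_uniq.
have sf : smb f.
  rewrite /smb; under eq_esum do rewrite ger0_norm//.
  by apply: le_lt_trans key _; rewrite ltry.
by split=> //; rewrite sum_ge0E// -lee_fin -esum_nsum.
Qed.

Lemma sum_reindex I J (e : I -> J) (f : J -> R) : bijective e ->
  usum (fun i => f (e i)) = usum f.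
Proof.
move=> be; have eT : set_bij [set: I] [set: J] e.
  case: be => g eg ge; split=> //; first by move=> x y _ _ /(congr1 g); rewrite !eg.
  by move=> y _; exists (g y).
by rewrite /usum /nsum !(reindex_esum _ _ _ _ eT).
Qed.

Lemma smb_reindex I J (e : I -> J) (f : J -> R) : bijective e ->
  smb (fun i => f (e i)) <-> smb f.
Proof.
move=> be; have eT : set_bij [set: I] [set: J] e.
  case: be => g eg ge; split=> //; first by move=> x y _ _ /(congr1 g); rewrite !eg.
  by move=> y _; exists (g y).
by rewrite /smb !(reindex_esum _ _ _ _ eT).
Qed.

Lemma esum_pair I J (f : I * J -> R) : (forall p, 0 <= f p) ->
  (\esum_(p in [set: I * J]) (f p)%:E)%E =
  (\esum_(i in [set: I]) \esum_(j in [set: J]) (f (i, j))%:E)%E.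
Proof.
move=> f0; rewrite esum_esum; last by move=> i j _ _; rewrite lee_fin.
have -> : [set: I] `*`` (fun=> [set: J]) = [set: I * J] by apply/seteqP; split.
by apply: eq_esum => -[].
Qed.

Lemma smb_pair I J (f : I * J -> R) : (forall i, smb (fun j => f (i, j))) ->
  smb (fun i => usum (fun j => `|f (i, j)|)) -> smb f.
Proof.
move=> s1 s2; rewrite /smb esum_pair; last by move=> p.
have h i : (\esum_(j in [set: J]) (`|f (i, j)|)%:E)%E = (usum (fun j => `|f (i, j)|))%:E.
  by rewrite sum_ge0E//; [rewrite esum_nsum//|]; apply: smb_norm.
under eq_esum do rewrite h.
by apply: le_lt_trans s2; apply: le_esum => i _; rewrite lee_fin ler_norm.
Qed.

Lemma smb_slice I J (f : I * J -> R) (i : I) : smb f -> smb (fun j => f (i, j)).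
Proof.
move=> sf.
suff [] : smb (fun j => `|f (i, j)|) /\ usum (fun j => `|f (i, j)|) <= usum (fun p => `|f p|).
  by move=> h _; apply: smb_le h => j.
apply: sum_le_seq => // s us.
have -> : \sum_(j <- s) `|f (i, j)| = \sum_(p <- [seq (i, j) | j <- s]) `|f p|.
  by rewrite big_map.
apply: le_seq_sum => //; first exact: smb_norm.
by rewrite map_inj_uniq// => x y [].
Qed.

Lemma nsum_pair I J (f : I * J -> R) : (forall p, 0 <= f p) -> smb f ->
  smb (fun i => nsum (fun j => f (i, j))) /\
  nsum f = nsum (fun i => nsum (fun j => f (i, j))).
Proof.
move=> f0 sf; have h i : (\esum_(j in [set: J]) (f (i, j))%:E)%E = (nsum (fun j => f (i, j)))%:E.
  by rewrite esum_nsum//; apply: smb_slice.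
have e : (\esum_(p in [set: I * J]) (f p)%:E)%E =
  (\esum_(i in [set: I]) (nsum (fun j => f (i, j)))%:E)%E.
  by rewrite esum_pair//; apply: eq_esum => i _; rewrite h.
split; last by rewrite {1}/nsum e.
rewrite /smb; under eq_esum do rewrite ger0_norm ?nsum_ge0//.
by rewrite -e esum_nsum// ltry.
Qed.

Lemma smb_sum_slice I J (f : I * J -> R) : smb f ->
  smb (fun i => usum (fun j => `|f (i, j)|)).
Proof.
move=> sf; have sf' := smb_norm sf.
have [+ _] := nsum_pair (fun p => normr_ge0 (f p)) sf'.
apply: smb_le => i; rewrite ger0_norm ?sum_ge0//; last exact/smb_norm/smb_slice.
by rewrite sum_ge0E//; exact/smb_norm/smb_slice.
Qed.

Lemma sum_pair I J (f : I * J -> R) : smb f ->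
  usum f = usum (fun i => usum (fun j => f (i, j))).
Proof.
move=> sf; have sf' := smb_norm sf.
have [s1 e1] := nsum_pair (fun p => normr_ge0 (f p)) sf'.
have f0 p : 0 <= f p + `|f p| by apply: normDge0.
have [s2 e2] := nsum_pair f0 (smbD sf sf').
rewrite [LHS]/usum e1 e2 -!sum_ge0E//; first last.
- by move=> i; apply: nsum_ge0 => j.
- by move=> i; apply: nsum_ge0 => j.
by rewrite -sumN// -sumD//; exact: smbN.
Qed.

Lemma sum_swap I J (f : I -> J -> R) : smb (fun p => f p.1 p.2) ->
  usum (fun i => usum (f i)) = usum (fun j => usum (f ^~ j)).
Proof.
move=> sf; rewrite -(sum_pair sf).
have b : bijective (fun p : J * I => (p.2, p.1)).
  by exists (fun p => (p.2, p.1)) => -[].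
rewrite -(sum_reindex _ b) sum_pair//.
by move: (@smb_reindex _ _ (fun p : J * I => (p.2, p.1)) (fun p => f p.1 p.2) b) => -[_]; apply.
Qed.

Lemma sum_bigr I (K : Type) (s : seq K) (f : K -> I -> R) :
  (forall k, smb (f k)) ->
  smb (fun i => \sum_(k <- s) f k i) /\
  usum (fun i => \sum_(k <- s) f k i) = \sum_(k <- s) usum (f k).
Proof.
move=> sf; elim: s => [|k s [IH1 IH2]].
  have e : (fun i : I => \sum_(k <- [::]) f k i) = (fun=> 0).
    by apply/funext => i; rewrite big_nil.
  rewrite e big_nil; have [] := @sum_le_seq I (fun=> 0) 0 => // [s _|h1 h2].
    by rewrite big1.
  by split=> //; apply/eqP; rewrite eq_le h2 sum_ge0.
have e : (fun i : I => \sum_(j <- k :: s) f j i) = (fun i => f k i + \sum_(j <- s) f j i).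
  by apply/funext => i; rewrite big_cons.
by rewrite e big_cons sumD// IH2; split=> //; apply: smbD.
Qed.

Lemma sum_cond_seq I (f : I -> R) (s : seq I) : uniq s ->
  smb (fun i => if i \in s then f i else 0) /\
  usum (fun i => if i \in s then f i else 0) = \sum_(i <- s) f i.
Proof.
move=> us.
pose d (k i : I) := if i == k then f k else 0.
have sd k : smb (d k).
  suff [] : smb (fun i => `|d k i|) /\ usum (fun i => `|d k i|) <= `|f k|.
    by move=> + _; apply: smb_le => i.
  apply: sum_le_seq => // t ut; rewrite /d.
  have [kt|kt] := boolP (k \in t).
    rewrite (bigD1_seq k)//= eqxx big1 ?addr0// => i /negPf ->.
    by rewrite normr0.
  rewrite big1_seq// => i /= it; rewrite ifF ?normr0//.
  by apply/negbTE; apply: contraNneq kt => <-.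
have S1 (k : I) : usum (fun i => (i == k)%:R) = 1 :> R.
  have s1 : smb (fun i => (i == k)%:R : R).
    have [||//] := @sum_le_seq _ (fun i => (i == k)%:R : R) 1 => // t ut.
    rewrite -natr_sum lern1 -big_mkcond/= sum1_count.
    by rewrite (@count_uniq_mem _ t k)// leq_b1.
  rewrite sum_ge0E// /nsum (_ : esum _ _ = 1%E)//.
  rewrite (_ : (fun i => _) = (fun i => if i \in [set k] then 1%E else 0%E)).
    by rewrite -esum_mkcond esum_set1.
  apply/funext => i; case: eqP => [->|ik]; first by rewrite mem_set.
  by rewrite memNset.
have Sd k : usum (d k) = f k.
  have s1 : smb (fun i => (i == k)%:R : R).
    have [||//] := @sum_le_seq _ (fun i => (i == k)%:R : R) 1 => // t ut.
    rewrite -natr_sum lern1 -big_mkcond/= sum1_count.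
    by rewrite (@count_uniq_mem _ t k)// leq_b1.
  rewrite -[RHS]mulr1 -(S1 k) -sumZ//; apply: eq_sum => i; rewrite /d.
  by case: eqP; rewrite (mulr1, mulr0).
have [h1 h2] := sum_bigr s sd.
have e : (fun i => \sum_(k <- s) d k i) = (fun i => if i \in s then f i else 0).
  apply/funext => i; rewrite /d; case: ifPn => si.
    rewrite (bigD1_seq i)//= eqxx big1 ?addr0// => j ij.
    by rewrite ifF//; apply/negbTE; rewrite eq_sym.
  rewrite big1_seq// => j /= js; rewrite ifF//; apply/negbTE.
  by apply: contraNneq si => ->.
by rewrite -e; split=> //; rewrite h2; apply: eq_bigr => k _; rewrite Sd.
Qed.

Lemma sum_tail I (g : I -> R) (e : R) : (forall i, 0 <= g i) -> smb g -> 0 < e ->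
  exists2 s : seq I, uniq s & usum g - e < \sum_(i <- s) g i.
Proof.
move=> g0 sg e0; rewrite sum_ge0E//.
have : ((nsum g - e)%:E < \esum_(i in [set: I]) (g i)%:E)%E.
  by rewrite esum_nsum// lte_fin ltrBlDr ltrDl.
move=> /ereal_sup_gt[_ [A [fA _] <-]].
rewrite fsbig_finite//= sumEFin lte_fin => h.
by exists (finmap.enum_fset (fset_set A)) => //; exact: finmap.fset_uniq.
Qed.

(* Tannery's theorem. *)
Lemma sum_cvg I (f : nat -> I -> R) (l g : I -> R) (N : nat) :
  (forall i, f n i @[n --> \oo] --> l i) -> smb g ->
  (forall n i, (N <= n)%N -> `|f n i| <= g i) ->
  smb l /\ usum (f n) @[n --> \oo] --> usum l.
Proof.
move=> fl sg fg.
have g0 i : 0 <= g i by apply: le_trans (fg N i (leqnn _)).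
have lg i : `|l i| <= g i.
  have h : `|f n i| @[n --> \oo] --> `|l i| by apply: cvg_norm.
  apply: (cvgr_to_le h).
  by exists N => //= n /= Nn; apply: fg.
have sl := smb_le lg sg; split=> //.
apply/cvgrPdist_lt => e e0.
have e4 : 0 < e / 5 by lra.
have [s us hs] := sum_tail g0 sg e4.
pose h i := (if i \in s then g i else 0).
have [sh Sh] := sum_cond_seq g us.
have cf : \sum_(i <- s) (`|f n i - l i|) @[n --> \oo] --> (0 : R).
  have {2}-> : (0 : R) = \sum_(i <- s) 0 by rewrite big1.
  apply: cvg_big => [|i _]; first exact: add_continuous.
  have : f n i - l i @[n --> \oo] --> l i - l i by apply: cvgB => //; exact: cvg_cst.
  by rewrite subrr => /cvg_norm; rewrite normr0.
move/cvgrPdist_lt : cf => /(_ _ e4) [M _ hM].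
exists (maxn M N) => //= n /=; rewrite geq_max => /andP[Mn Nn].
have sf := smb_le (fg n ^~ Nn) sg.
rewrite -sumN// -sumD//; last exact: smbN.
(* Inside [s] the error is [|f n i - l i|], outside it is at most [2 * g i]; the total stays below
   [3 * e / 5]. *)
pose D i := (if i \in s then `|f n i - l i| else 0).
have [sD SD] := sum_cond_seq (fun i => `|f n i - l i|) us.
have sT : smb (fun i => g i - (if i \in s then g i else 0)) by apply/smbD/smbN.
apply: (@le_lt_trans _ _ (usum (fun i => D i + 2 * (g i - (if i \in s then g i else 0))))).
  apply: sum_norm_le; first by apply: smbD => //; exact: smbZ.
  move=> i; rewrite /D; case: ifPn => si.
    by rewrite subrr mulr0 addr0 distrC.
  rewrite subr0 add0r (le_trans (ler_normB _ _))//.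
  by have := lg i; have := fg n i Nn; lra.
rewrite sumD//; last exact: smbZ.
rewrite sumZ// sumD//; last exact: smbN.
rewrite sumN// Sh SD.
have := hM n Mn; rewrite sub0r normrN ger0_norm ?sumr_ge0//.
lra.
Qed.

End AbsoluteSums.

(** * Discrete Poisson summation for binomial weights *)

Section FiniteFourier.
Variable R : realType.
Implicit Types (x a : R).

Lemma cosD2piz x (z : int) : cos (x + 2 * pi * z%:~R) = cos x.
Proof.
have key (k : nat) (y : R) : cos (y + 2 * pi * k%:R) = cos y.
  rewrite -(periodicn (@cosD2pi R) k y); congr (cos (_ + _)).
  by rewrite -mulr_natr; ring.
case: z => k; first by rewrite -pmulrn key.
rewrite -(key k.+1); congr cos; rewrite NegzE mulrNz -pmulrn; ring.
Qed.

(** Real part of the binomial expansion of [(e^(ix) + e^(-ix))^N e^(ia)]; the induction is Pascal's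
    rule. *)
Lemma cos_expand (N : nat) x a : (2 * cos x) ^+ N * cos a =
  \sum_(j < N.+1) 'C(N, j)%:R * cos (a + (N%:R - 2 * j%:R) * x).
Proof.
elim: N a => [|N IH] a.
  by rewrite big_ord1 bin0 expr0 mul1r mulr0 subr0 mul0r addr0 mul1r.
have -> : (2 * cos x) ^+ N.+1 * cos a =
    (2 * cos x) ^+ N * cos (a + x) + (2 * cos x) ^+ N * cos (a - x).
  rewrite exprSr cosD cosB; ring.
rewrite !IH [RHS]big_ord_recl /= bin0 [X in X + _ = _]big_ord_recl /= bin0.
under [X in _ = _ + X]eq_bigr do rewrite binS natrD mulrDl.
rewrite big_split/= [X in _ = _ + (X + _)]big_ord_recr/= bin_small// mul0r addr0.
rewrite -[in LHS]addrA; congr (_ + (_ + _)).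
- by congr (_ * cos _); rewrite -natr1; ring.
- by apply: eq_bigr => i _; congr (_ * cos _); rewrite /bump/= ?add1n -?natr1; ring.
- apply: eq_bigr => i _; congr (_ * cos _); rewrite /bump/= ?add1n -?natr1; ring.
Qed.

(** Orthogonality of the characters of [Z / l], with a phase. If [l] does not divide [h], then [h]
    is reduced to a residue [0 < r < l] and the sum telescopes after multiplication by
    [2 * sin (pi * r / l)], which is nonzero. *)
Lemma sum_cos_unity (l : nat) (h : int) a : (0 < l)%N ->
  \sum_(i < l) cos (a + 2 * pi * (i%:R * h%:~R / l%:R)) =
  if (l%:Z %| h)%Z then l%:R * cos a else 0.
Proof.
move=> l0; have lR : (l%:R : R) != 0 by rewrite pnatr_eq0 -lt0n.
case: ifPn => [/dvdzP[q ->]|ndv].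
  under eq_bigr => i _.
    rewrite intrM -pmulrn [X in 2 * pi * X](_ : _ = (i%:Z * q)%:~R); last first.
      by rewrite intrM -pmulrn; field.
    rewrite cosD2piz; over.
  by rewrite sumr_const card_ord mulr_natl.
pose r := absz (h %% l%:Z)%Z.
have lZ : l%:Z != 0 by rewrite eqz_nat -lt0n.
have hr : (h %% l%:Z)%Z = r%:Z by rewrite /r gez0_abs// modz_ge0.
have rl : (r < l)%N by rewrite -ltz_nat -hr ltz_pmod.
have r0 : (0 < r)%N.
  by rewrite lt0n -eqz_nat -hr; apply: contra ndv => /eqP/dvdz_mod0P.
have hE : h = (h %/ l%:Z)%Z * l%:Z + r%:Z by rewrite -hr -divz_eq.
pose b := 2 * pi * r%:R / l%:R : R.
have sb : sin (b / 2) != 0.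
  have -> : b / 2 = pi * (r%:R / l%:R) by rewrite /b; field.
  rewrite gt_eqF// sin_gt0_pi//; apply/andP; split.
    by rewrite mulr_gt0 ?pi_gt0// divr_gt0 ?ltr0n.
  by rewrite gtr_pMr ?pi_gt0// ltr_pdivrMr ?ltr0n// mul1r ltr_nat.
have e (i : 'I_l) : cos (a + 2 * pi * (i%:R * h%:~R / l%:R)) =
   (sin (a + (i.+1%:R - 2^-1) * b) - sin (a + (i%:R - 2^-1) * b)) / (2 * sin (b / 2)).
  have -> : 2 * pi * (i%:R * h%:~R / l%:R) =
     i%:R * b + 2 * pi * ((i%:Z * (h %/ l%:Z)%Z)%:~R) :> R.
    rewrite {1}hE /b intrM intrD intrM -!pmulrn; field.
    by [].
  rewrite addrA cosD2piz.
  have -> : a + (i.+1%:R - 2^-1) * b = a + i%:R * b + b / 2 by rewrite -natr1; field.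
  have -> : a + (i%:R - 2^-1) * b = a + i%:R * b - b / 2 by field.
  by rewrite sinD sinB; field; rewrite sb.
under eq_bigr do rewrite e.
rewrite -mulr_suml -(big_mkord xpredT (fun i => sin (a + (i.+1%:R - 2^-1) * b) - sin (a + (i%:R - 2^-1) * b))).
rewrite telescope_sumr// [X in X - _](_ : _ = sin (a + (0%:R - 2^-1) * b)) ?subrr ?mul0r//.
rewrite -!cosBpihalf -[RHS](cosD2piz _ r%:Z); congr cos.
by rewrite /b -pmulrn; field.
Qed.

Definition central_bin (m : nat) (d : int) : R := 'C(m.*2, m + `|d|)%:R.

Lemma central_bin_sub (m j : nat) : (j <= m.*2)%N ->
  'C(m.*2, j)%:R = central_bin m (m%:Z - j%:Z).
Proof.
move=> jm; rewrite /central_bin; congr (_%:R).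
have [jm'|mj] := leqP j m.
  rewrite -bin_sub//; congr 'C(_, _); lia.
by congr 'C(_, _); lia.
Qed.

Lemma usum_finsupp (I : choiceType) (f : I -> R) (s : seq I) : uniq s ->
  (forall i, i \notin s -> f i = 0) -> smb f /\ usum f = \sum_(i <- s) f i.
Proof.
move=> us fs; have [h1 h2] := sum_cond_seq f us.
have e : (fun i => if i \in s then f i else 0) = f.
  by apply/funext => i; case: ifPn => // /fs.
by rewrite e in h1 h2.
Qed.

(* Discrete Poisson summation: sampling a binomial distribution along an
   arithmetic progression of step [l]. *)
Lemma binomial_poisson (l m : nat) (s lam0 : int) (y phi : R) : (0 < l)%N ->
  l%:R * usum (fun z : int => central_bin m (z * l%:Z + s) * cos (2 * pi * (y * z%:~R + phi))) =
  usum (fun k : int => if (lam0 <= k) && (k < lam0 + l%:Z) then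
     (2 * cos (pi * (k%:~R + y) / l%:R)) ^+ m.*2 *
       cos (2 * pi * (phi - (k%:~R + y) * s%:~R / l%:R)) else 0).
Proof.
move=> l0; have lR : (l%:R : R) != 0 by rewrite pnatr_eq0 -lt0n.
have lZ : l%:Z != 0 by rewrite eqz_nat -lt0n.
set G := fun k : int => (2 * cos (pi * (k%:~R + y) / l%:R)) ^+ m.*2 *
       cos (2 * pi * (phi - (k%:~R + y) * s%:~R / l%:R)).
pose t2 := [seq lam0 + i%:Z | i <- index_iota 0 l].
have ut2 : uniq t2 by rewrite map_inj_uniq ?iota_uniq// => i j; lia.
have [|_ ->] := @usum_finsupp _ (fun k => if (lam0 <= k) && (k < lam0 + l%:Z) then G k else 0) t2 ut2.
  move=> k; case: ifPn => // /andP[h1 h2] /negP[]; apply/mapP.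
  by exists (absz (k - lam0)); rewrite ?mem_index_iota; lia.
rewrite big_map big_mkord.
under eq_bigr => i _.
  rewrite ifT; last by have := ltn_ord i; lia.
  rewrite /G cos_expand; over.
rewrite exchange_big/=.
(* Summing over one period of frequencies annihilates every [j] except those with
   [m - j = z * l + s] for an integer [z]; these [z] index the other side. *)
pose F j : R := if (l%:Z %| m%:Z - j%:Z - s)%Z then
   'C(m.*2, j)%:R * (l%:R * cos (2 * pi * (y * (((m%:Z - j%:Z - s) %/ l%:Z)%Z)%:~R + phi))) else 0.
rewrite (eq_bigr (fun j : 'I_m.*2.+1 => F j)); last first.
  move=> j _; rewrite -mulr_sumr.
  set h := m%:Z - j%:Z - s.
  transitivity ('C(m.*2, j)%:R * \sum_(i < l) cos (2 * pi * phi + 2 * pi * (lam0%:~R + y) * h%:~R / l%:R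
       + 2 * pi * (i%:R * h%:~R / l%:R))).
    congr (_ * _); apply: eq_bigr => i _; congr cos.
    have m2 : m.*2%:R = 2 * m%:R :> R by rewrite -mul2n natrM.
    rewrite /h !intrD !mulrNz -!pmulrn m2; field.
    by [].
  rewrite sum_cos_unity// /F -/h; case: ifPn; rewrite ?mulr0// => /dvdzP[q hq].
  rewrite hq mulzK//; congr (_ * (_ * _)).
  rewrite -[LHS](cosD2piz _ (- (lam0 * q))); congr cos.
  rewrite !intrM mulrNz intrM -pmulrn; field.
  by [].
pose P j := (l%:Z %| m%:Z - j%:Z - s)%Z.
pose q j := ((m%:Z - j%:Z - s) %/ l%:Z)%Z.
pose t1 := [seq q j | j <- [seq j <- index_iota 0 m.*2.+1 | P j]].
have qP j : P j -> q j * l%:Z + s = m%:Z - j%:Z.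
  by move=> /dvdzP[r hr]; rewrite /q hr mulzK//; lia.
have ut1 : uniq t1.
  rewrite map_inj_in_uniq ?filter_uniq ?iota_uniq// => i j.
  rewrite !mem_filter => /andP[Pi _] /andP[Pj _] qij.
  by have := qP i Pi; have := qP j Pj; rewrite qij; lia.
have [|_ ->] := @usum_finsupp _ (fun z : int => central_bin m (z * l%:Z + s) * cos (2 * pi * (y * z%:~R + phi))) t1 ut1.
  move=> z zt; rewrite /central_bin bin_small ?mul0r//.
  rewrite ltnNge; apply: contra zt => h; apply/mapP.
  have h1 : (absz (z * l%:Z + s)%R <= m)%N by lia.
  exists (absz (m%:Z - s - z * l%:Z)%R).
    rewrite mem_filter mem_index_iota /P; apply/andP; split; last by lia.
    by apply/dvdzP; exists z; lia.
  rewrite /q (_ : _ - _ - s = z * l%:Z) ?mulzK//; lia.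
rewrite /t1 big_map big_filter big_mkcond mulr_sumr.
rewrite big_mkord.
apply: eq_bigr => j _; rewrite /F -/(P j); case: ifPn => [Pj|]; last by rewrite mulr0.
rewrite qP// -central_bin_sub; last by have := ltn_ord j; lia.
by rewrite mulrCA.
Qed.

End FiniteFourier.

(** * Gaussian sums over the integers and binomial coefficients near the centre *)

Section OneDimension.
Variable R : realType.
Implicit Types (x a c y phi : R).

Lemma ler_sum_uniq (I : eqType) (f : I -> R) (s t : seq I) :
  (forall i, 0 <= f i) -> uniq s -> uniq t -> {subset s <= t} ->
  \sum_(i <- s) f i <= \sum_(i <- t) f i.
Proof.
move=> f0 us ut st.
have p : perm_eq s [seq i <- t | i \in s].
  apply: uniq_perm => //; first exact: filter_uniq.
  by move=> i; rewrite mem_filter; apply/idP/andP => [/[dup] /st ->|[]].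
rewrite (perm_big _ p)/= big_filter big_mkcond/=.
by apply: ler_sum => i _; case: ifP.
Qed.

Lemma usum_exp_abs (r : R) : 0 <= r < 1 ->
  smb (fun z : int => r ^+ absz z) /\ usum (fun z : int => r ^+ absz z) <= 2 / (1 - r).
Proof.
move=> /andP[r0 r1]; apply: sum_le_seq => [z|s us]; first exact: exprn_ge0.
pose N := (\max_(z <- s) absz z).+1.
pose t := [seq k%:Z | k <- index_iota 0 N] ++ [seq - k.+1%:Z | k <- index_iota 0 N].
have ut : uniq t.
  rewrite cat_uniq; apply/and3P; split.
  - by rewrite map_inj_uniq ?iota_uniq// => i j; lia.
  - by apply/hasPn => z /mapP[k _ ->]; apply/mapP => -[j _]; lia.
  - by rewrite map_inj_uniq ?iota_uniq// => i j; lia.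
have g n : \sum_(k < n) r ^+ k <= (1 - r)^-1.
  rewrite -[leRHS]mul1r ler_pdivlMr ?subr_gt0// mulrC.
  have := subrX1 r n; rewrite -[r - 1]opprB mulNr => /(congr1 -%R).
  by rewrite opprK => <-; rewrite opprB gerBl exprn_ge0.
apply: (@le_trans _ _ (\sum_(z <- t) r ^+ absz z)).
  apply: ler_sum_uniq => // [z|z zs]; first exact: exprn_ge0.
  have zN : (absz z < N)%N by rewrite ltnS; apply: leq_bigmax_seq.
  rewrite mem_cat; apply/orP; case: z zN {zs} => k kN.
    by left; apply/mapP; exists k; rewrite ?mem_index_iota.
  by right; apply/mapP; exists k; rewrite ?NegzE// mem_index_iota; lia.
rewrite big_cat !big_map !big_mkord/=.
have -> : 2 / (1 - r) = (1 - r)^-1 + (1 - r)^-1 by ring.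
apply: lerD; first exact: g.
apply: le_trans (g N); apply: ler_sum => k _.
rewrite exprS -[leRHS]mul1r; apply: ler_wpM2r; last exact: ltW.
exact: exprn_ge0.
Qed.

Lemma int_shift_bij (m : int) : bijective (fun z : int => z + m).
Proof. by exists (fun z => z - m) => z; rewrite ?addrK ?subrK. Qed.

Lemma int_opp_bij : bijective (fun z : int => - z).
Proof. by exists (fun z => - z) => z; rewrite opprK. Qed.

(* The bound is uniform in the shift [c]. *)
Lemma usum_gauss1 a : 0 < a -> exists C : R, forall c,
  smb (fun z : int => expR (- (a * (z%:~R + c) ^+ 2))) /\
  usum (fun z : int => expR (- (a * (z%:~R + c) ^+ 2))) <= C.
Proof.
move=> a0; pose r := expR (- a).
have r01 : 0 <= r < 1 by rewrite expR_ge0/= expR_lt1 oppr_lt0.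
have [sr Sr] := usum_exp_abs r01.
exists (expR (5 / 4 * a) * (2 / (1 - r))) => c.
pose m := Num.floor c.
have /andP[mc cm] : m%:~R <= c < (m + 1)%:~R := floor_itv c.
have e (z : int) : expR (- (a * (z%:~R + c) ^+ 2)) =
    (fun z : int => expR (- (a * (z%:~R + (c - m%:~R)) ^+ 2))) (z + m).
  by rewrite /= intrD; congr expR; ring.
under eq_fun do rewrite e.
rewrite (@smb_reindex R _ _ _ (fun z : int => expR (- (a * (z%:~R + (c - m%:~R)) ^+ 2))) (int_shift_bij m)).
rewrite (@sum_reindex R _ _ _ (fun z : int => expR (- (a * (z%:~R + (c - m%:~R)) ^+ 2))) (int_shift_bij m)).
set d := c - m%:~R.
have d0 : 0 <= d by rewrite subr_ge0.
have d1 : d < 1 by rewrite ltrBlDl -(intrD _ m 1).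
(* The constant comes from [T ^ 2 >= T - 1 / 4] with [T = |z + d| >= |z| - 1]. *)
have h (z : int) : expR (- (a * (z%:~R + d) ^+ 2)) <= expR (5 / 4 * a) * r ^+ absz z.
  rewrite -expRM_natl -expRD ler_expR.
  have zn : (absz z)%:R = `|z%:~R| :> R by rewrite pmulrn abszE intr_norm.
  have h1 : (absz z)%:R - 1 <= `|z%:~R + d|.
    have := ler_normB (z%:~R + d) d; rewrite addrK (ger0_norm d0) zn; lra.
  have h2 := sqr_ge0 (`|z%:~R + d| - 2^-1).
  rewrite -real_normK ?num_real//.
  suff : (absz z)%:R - 5 / 4 <= `|z%:~R + d| ^+ 2 by move=> h3; nra.
  by move: h2; nra.
have sg : smb (fun z : int => expR (5 / 4 * a) * r ^+ absz z) by exact: smbZ.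
have sf : smb (fun z : int => expR (- (a * (z%:~R + d) ^+ 2))).
  by apply: smb_le sg => z; rewrite ger0_norm ?expR_ge0.
split=> //; apply: le_trans (sum_le sf sg h) _.
by rewrite sumZ// ler_wpM2l ?expR_ge0.
Qed.

Lemma sin_le_id x : 0 <= x -> sin x <= x.
Proof.
rewrite le_eqVlt => /predU1P[<-|x0]; first by rewrite sin0.
have [|c _] := @MVT R sin cos 0 x x0 (fun y _ => is_derive_sin y).
  by apply: continuous_subspaceT => y; exact: continuous_sin.
by rewrite sin0 !subr0 => ->; rewrite ger_pMl// cos_le1.
Qed.

Lemma sin_ge_cos x : 0 <= x <= pi -> x * cos x <= sin x.
Proof.
move=> /andP[]; rewrite le_eqVlt => /predU1P[<-|x0] xp; first by rewrite sin0 mul0r.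
have [|c cx] := @MVT R sin cos 0 x x0 (fun y _ => is_derive_sin y).
  by apply: continuous_subspaceT => y; exact: continuous_sin.
rewrite sin0 !subr0 => ->; rewrite mulrC ler_pM2r//.
move: cx; rewrite in_itv/= => /andP[c0 cx].
by apply/ltW; rewrite ltr_cos// in_itv/=; apply/andP; split; lra.
Qed.

Lemma oneB_cos x : 1 - cos x = 2 * sin (x / 2) ^+ 2.
Proof.
have -> : cos x = cos (x / 2 + x / 2) by congr cos; field.
by rewrite cosD -!expr2 cos2sin2; ring.
Qed.

Lemma oneB_cos_le x : 1 - cos x <= x ^+ 2 / 2.
Proof.
wlog x0 : x / 0 <= x => [th|].
  have [/th//|x0] := leP 0 x.
  by have := th (- x); rewrite cosN sqrrN oppr_ge0 (ltW x0) => /(_ isT).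
rewrite oneB_cos.
have h : `|sin (x / 2)| <= x / 2.
  have [s0|s0] := leP 0 (sin (x / 2)); first by rewrite ger0_norm// sin_le_id// divr_ge0.
  rewrite ltr0_norm//; have [xp|xp] := leP (x / 2) pi.
    by have := @sin_ge0_pi R (x / 2); rewrite xp divr_ge0// => /(_ isT); lra.
  by have := sin_geN1 (x / 2); have := @pi_ge2 R; lra.
rewrite -[sin _ ^+ 2]real_normK ?num_real//.
by have := normr_ge0 (sin (x / 2)); nra.
Qed.

(** From [x / 2 * cos (x / 2) <= sin (x / 2)] one gets [1 - cos x >= x ^ 2 / 4 * (1 + cos x)]. The
    first bound is sharp at [0] and serves to compute a limit; the second, cruder one serves for
    uniform domination. *)
Lemma oneB_cos_ge x : - pi / 2 <= x <= pi / 2 ->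
  x ^+ 2 / 2 * (1 - x ^+ 2 / 4) <= 1 - cos x /\ x ^+ 2 / 4 <= 1 - cos x.
Proof.
wlog x0 : x / 0 <= x => [th|].
  have [/th//|x0 /andP[h1 h2]] := leP 0 x.
  have := th (- x); rewrite cosN sqrrN; apply; first by rewrite oppr_ge0 ltW.
  by apply/andP; split; lra.
move=> /andP[_ xp].
have pi0 := @pi_gt0 R.
have h : (x / 2) * cos (x / 2) <= sin (x / 2) by apply: sin_ge_cos; apply/andP; split; lra.
have c0 : 0 <= cos (x / 2) by apply: cos_ge0_pihalf; apply/andP; split; lra.
have e1 := oneB_cos x.
have e2 : 1 + cos x = 2 * cos (x / 2) ^+ 2 by rewrite cos2sin2; lra.
have c1 : 0 <= cos x by apply: cos_ge0_pihalf; apply/andP; split; lra.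
have h2 : (x / 2) ^+ 2 * cos (x / 2) ^+ 2 <= sin (x / 2) ^+ 2.
  rewrite -exprMn lerXn2r// nnegrE; first by rewrite mulr_ge0// divr_ge0.
  by apply: le_trans h; rewrite mulr_ge0// divr_ge0.
have h3 := oneB_cos_le x.
by split; nra.
Qed.

Lemma le_expRN x : 1 - x <= expR (- x).
Proof. exact: expR_ge1Dx. Qed.

Lemma ge_expRN x : x < 1 -> expR (- (x / (1 - x))) <= 1 - x.
Proof.
move=> x1; have x1' : 0 < 1 - x by rewrite subr_gt0.
rewrite expRN -[leRHS]invrK lef_pV2 ?posrE ?invr_gt0 ?expR_gt0//.
apply: le_trans (expR_ge1Dx _).
by rewrite le_eqVlt; apply/orP; left; apply/eqP; field; rewrite gt_eqF.
Qed.

Definition bin_ratio (m d : nat) : R := 'C(m.*2, m + d)%:R / 'C(m.*2, m)%:R.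

Lemma bin_ratio0 m : bin_ratio m 0 = 1.
Proof.
rewrite /bin_ratio addn0 divff// pnatr_eq0 -lt0n bin_gt0; lia.
Qed.

Lemma bin_ratioS m d : (d <= m)%N ->
  bin_ratio m d.+1 = bin_ratio m d * (1 - (2 * d + 1)%:R / (m + d + 1)%:R).
Proof.
move=> dm; rewrite /bin_ratio.
have := mul_bin_left m.*2 (m + d) => /(congr1 (fun k => k%:R : R)).
rewrite !natrM -addnS (_ : m.*2 - (m + d) = m - d)%N; last by lia.
move=> h.
have md : (m + d.+1)%:R != 0 :> R by rewrite pnatr_eq0; lia.
have b0 : ('C(m.*2, m))%:R != 0 :> R by rewrite pnatr_eq0 -lt0n bin_gt0; lia.
have -> : ('C(m.*2, m + d.+1))%:R = (m - d)%:R * ('C(m.*2, m + d))%:R / (m + d.+1)%:R :> R.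
  by rewrite -h mulrAC mulfV// mul1r.
rewrite (_ : m + d + 1 = m + d.+1)%N; last by lia.
have -> : 1 - (2 * d + 1)%:R / (m + d.+1)%:R = (m - d)%:R / (m + d.+1)%:R :> R.
  apply: (mulIf md); rewrite mulrBl !divfK// mul1r natrB//.
  rewrite [(2 * d + 1)%:R]natrD natrM addnS -natr1 natrD; ring.
by ring.
Qed.

Lemma bin_ratio_ge0 m d : 0 <= bin_ratio m d.
Proof. by rewrite divr_ge0. Qed.

(** One half of an explicit local de Moivre-Laplace theorem. Each ratio of consecutive binomials is
    at most [expR (- ((2 * d + 1) / (m + D)))], and the odd numbers sum to a square. Fixing the
    denominator through [D] lets the induction on [d] go through. *)
Lemma bin_ratio_le m d D : (0 < m)%N -> (d <= D)%N ->
  bin_ratio m d <= expR (- (d%:R ^+ 2 / (m + D)%:R)).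
Proof.
move=> m0; elim: d => [_|d IH dD].
  by rewrite bin_ratio0 expr2 mul0r mul0r oppr0 expR0.
have [md|dm] := ltnP m d.+1.
  by rewrite /bin_ratio bin_small ?mul0r ?expR_ge0//; lia.
rewrite bin_ratioS; last by lia.
have mD : 0 < (m + D)%:R :> R by rewrite ltr0n; lia.
have -> : - (d.+1%:R ^+ 2 / (m + D)%:R) =
   - (d%:R ^+ 2 / (m + D)%:R) + - ((2 * d + 1)%:R / (m + D)%:R) :> R.
  by rewrite [(2 * d + 1)%:R]natrD natrM -natr1; field; rewrite -natrD gt_eqF.
rewrite expRD; apply: ler_pM.
- exact: bin_ratio_ge0.
- rewrite subr_ge0 ler_pdivrMr ?ltr0n; last by lia.
  by rewrite mul1r ler_nat; lia.
- by apply: IH; lia.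
apply: le_trans (le_expRN _) _; rewrite ler_expR lerN2.
rewrite ler_wpM2l// lef_pV2 ?posrE ?ltr0n ?ler_nat; lia.
Qed.

Lemma bin_ratio_ge m d D : (d <= D)%N -> (D <= m)%N ->
  expR (- (d%:R ^+ 2 / (m - D + 1)%:R)) <= bin_ratio m d.
Proof.
move=> dD Dm; elim: d dD => [_|d IH dD].
  by rewrite bin_ratio0 expr2 mul0r mul0r oppr0 expR0.
rewrite bin_ratioS; last by lia.
have mD : 0 < (m - D + 1)%:R :> R by rewrite ltr0n; lia.
have -> : - (d.+1%:R ^+ 2 / (m - D + 1)%:R) =
   - (d%:R ^+ 2 / (m - D + 1)%:R) + - ((2 * d + 1)%:R / (m - D + 1)%:R) :> R.
  by rewrite [(2 * d + 1)%:R]natrD natrM -natr1; field; rewrite gt_eqF.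
rewrite expRD; apply: ler_pM; rewrite ?expR_ge0//.
  by apply: IH; lia.
have md1 : 0 < (m + d + 1)%:R :> R by rewrite ltr0n; lia.
have md : 0 < (m - d)%:R :> R by rewrite ltr0n; lia.
have u1 : (2 * d + 1)%:R / (m + d + 1)%:R < 1 :> R.
  by rewrite ltr_pdivrMr// mul1r ltr_nat; lia.
apply: le_trans _ (ge_expRN u1); rewrite ler_expR lerN2.
have -> : 1 - (2 * d + 1)%:R / (m + d + 1)%:R = (m - d)%:R / (m + d + 1)%:R :> R.
  apply: (mulIf (lt0r_neq0 md1)); rewrite mulrBl !divfK ?gt_eqF// mul1r natrB; last by lia.
  by rewrite [(2 * d + 1)%:R]natrD natrM !natrD; ring.
rewrite invf_div mulrA divfK ?gt_eqF//.
by rewrite ler_wpM2l// lef_pV2 ?posrE// ler_nat; lia.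
Qed.

Definition central_weight (m : nat) : R := 'C(m.*2, m)%:R / 4 ^+ m.

Lemma central_weightS m :
  central_weight m.+1 = central_weight m * ((2 * m + 1)%:R / (2 * m + 2)%:R).
Proof.
have h1 := mul_bin_diag m.*2.+2 m.
have h2 := mul_bin_down m.*2.+1 m.
have e : (m.+1 * 'C(m.*2.+2, m.+1) = 2 * (m.*2.+1 * 'C(m.*2, m)))%N.
  move: h2; rewrite (_ : m.*2.+1 - m = m.+1)%N/=; last by lia.
  by move: h1 => /= <- ->; rewrite -muln2; nia.
rewrite /central_weight doubleS.
move/(congr1 (fun k => k%:R : R)) : e; rewrite !natrM => e.
have m0 : m.+1%:R != 0 :> R by rewrite pnatr_eq0.
have -> : ('C(m.*2.+2, m.+1))%:R = 2 * (m.*2.+1%:R * 'C(m.*2, m)%:R) / m.+1%:R :> R.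
  by rewrite -e mulrAC mulfV// mul1r.
have p0 : (4 : R) ^+ m != 0 by rewrite expf_neq0.
have -> : m.*2.+1%:R = 2 * m%:R + 1 :> R by rewrite -natr1 -mul2n natrM.
have -> : (2 * m + 1)%:R = 2 * m%:R + 1 :> R by rewrite natrD natrM.
have -> : (2 * m + 2)%:R = 2 * m%:R + 2 :> R by rewrite natrD natrM.
rewrite exprS.
have m1 : (m%:R + 1 : R) != 0 by rewrite natr1.
have m2 : (2 * m%:R + 2 : R) != 0 by rewrite -[X in _ + X]mulr1 -mulrDr mulf_neq0.
rewrite -natr1; field.
by rewrite m2 p0 addrC m1.
Qed.

Lemma central_weight_gt0 m : 0 < central_weight m.
Proof. by rewrite divr_gt0 ?exprn_gt0// ltr0n bin_gt0; lia. Qed.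

(** The asymptotics of Wallis without the value of the limit: [n * central_weight n ^ 2] increases,
    while [(2 * n + 1) * central_weight n ^ 2] decreases from [1]. *)
Lemma central_weight_cvg : exists2 g : R, 0 < g &
  Num.sqrt n.+1%:R * central_weight n.+1 @[n --> \oo] --> g.
Proof.
pose u n : R := Num.sqrt n.+1%:R * central_weight n.+1.
have u0 n : 0 <= u n by rewrite mulr_ge0 ?sqrtr_ge0// ltW// central_weight_gt0.
have u2 n : u n ^+ 2 = n.+1%:R * central_weight n.+1 ^+ 2.
  by rewrite exprMn sqr_sqrtr.
have ui : {homo u : n m / (n <= m)%N >-> n <= m}.
  apply/nondecreasing_seqP => n.
  rewrite -(@ler_pXn2r _ 2)// ?nnegrE// !u2.
  move: (central_weight_gt0 n.+1) (central_weightS n.+1).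
  move: (central_weight n.+1) (central_weight n.+2) => w w' w0 ->.
  rewrite exprMn [w ^+ 2 * _]mulrC [n.+2%:R * _]mulrA ler_pM2r ?exprn_gt0//.
  rewrite expr_div_n mulrA ler_pdivlMr ?exprn_gt0 ?ltr0n//.
  rewrite -!natrX -!natrM ler_nat; nia.
have ub n : u n <= 1.
  have h : forall m, (2 * m + 1)%:R * central_weight m ^+ 2 <= 1.
    elim=> [|m IH]; first by rewrite /central_weight bin0 expr0 divr1 expr1n mulr1.
    apply: le_trans IH; move: (central_weight_gt0 m) (central_weightS m).
    move: (central_weight m) (central_weight m.+1) => w w' w0 ->.
    rewrite exprMn [w ^+ 2 * _]mulrC [(2 * m.+1 + 1)%:R * _]mulrA ler_pM2r ?exprn_gt0//.
    rewrite expr_div_n mulrA ler_pdivrMr ?exprn_gt0 ?ltr0n ?addn2//.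
    rewrite -!natrX -!natrM ler_nat; nia.
  rewrite -(@ler_pXn2r _ 2)// ?nnegrE// u2 expr1n; apply: le_trans (h n.+1).
  by rewrite ler_pM2r ?exprn_gt0 ?central_weight_gt0// ler_nat; lia.
have cu : cvgn u.
  by apply: nondecreasing_is_cvgn => //; exists 1 => _ [n _ <-].
exists (limn u) => //.
apply: (@lt_le_trans _ _ (u 0%N)); first by rewrite mulr_gt0 ?sqrtr_gt0 ?central_weight_gt0.
by apply: limr_ge => //; near=> n; apply: ui.
Unshelve. all: by end_near.
Qed.

End OneDimension.

(** * Poisson summation on the line *)

Section PoissonLine.
Variable R : realType.
Implicit Types (u v : nat -> R).

Lemma cvg_expRn u (x : R) : u n @[n --> \oo] --> x ->
  expR (u n) @[n --> \oo] --> expR x.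
Proof. by move=> h; apply: continuous_cvg h; exact: continuous_expR. Qed.

Lemma cvg_cosn u (x : R) : u n @[n --> \oo] --> x ->
  cos (u n) @[n --> \oo] --> cos x.
Proof. by move=> h; apply: continuous_cvg h; exact: continuous_cos. Qed.

Lemma cvg_sqrn u (x : R) : u n @[n --> \oo] --> x ->
  u n ^+ 2 @[n --> \oo] --> x ^+ 2.
Proof. by move=> h; exact: (cvgM h h). Qed.

Lemma cvg_sqrt_harmonic : (Num.sqrt n.+1%:R)^-1 @[n --> \oo] --> (0 : R).
Proof.
under eq_fun do rewrite -sqrtrV//.
have := continuous_cvg _ (@sqrt_continuous R 0) (@cvg_harmonic R).
by rewrite sqrtr0; apply.
Qed.

Variables (a c y phi : R).
Hypothesis a0 : 0 < a.

(** The step [l] and offset [s] make [(z * l + s) ^ 2 / n.+1] tend to [a * (z + c) ^ 2], so that the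
    central binomial weights of [2 * n.+1] trials, sampled there, become the Gaussian. *)
Let l n := (Num.truncn (Num.sqrt (a * n.+1%:R))).+1.
Let s n := Num.floor (c * (l n)%:R).
Let sm n : R := Num.sqrt n.+1%:R.

Let sm_gt0 n : 0 < sm n. Proof. by rewrite sqrtr_gt0. Qed.
Let sqr_sm n : sm n ^+ 2 = n.+1%:R. Proof. by rewrite sqr_sqrtr. Qed.
Let sa_gt0 : 0 < Num.sqrt a. Proof. by rewrite sqrtr_gt0. Qed.
Let sqr_sa : Num.sqrt a ^+ 2 = a. Proof. by rewrite sqr_sqrtr// ltW. Qed.
Let l_gt0 n : 0 < (l n)%:R :> R. Proof. by rewrite ltr0n. Qed.

Let l_bounds n : Num.sqrt a * sm n < (l n)%:R <= Num.sqrt a * sm n + 1.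
Proof.
have := truncn_itv (sqrtr_ge0 (a * n.+1%:R)).
rewrite /l /sm sqrtrM; last exact: ltW.
move=> /andP[h1 h2].
by rewrite h2/= -natr1 lerD2r.
Qed.

Let l_sm : (l n)%:R / sm n @[n --> \oo] --> Num.sqrt a.
Proof.
apply: (@squeeze_cvgr _ _ _ _ (fun=> Num.sqrt a) (fun n => Num.sqrt a + (sm n)^-1)).
- near=> n; have /andP[h1 h2] := l_bounds n.
  by rewrite ler_pdivlMr// ler_pdivrMr// (ltW h1)/= mulrDl mulVf// gt_eqF.
- exact: cvg_cst.
- by rewrite -[X in _ --> X]addr0; apply: cvgD; [exact: cvg_cst|exact: cvg_sqrt_harmonic].
Unshelve. all: by end_near.
Qed.

Let l_inv : ((l n)%:R : R)^-1 @[n --> \oo] --> (0 : R).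
Proof.
apply: (@squeeze_cvgr _ _ _ _ (fun=> 0) (fun n => (Num.sqrt a)^-1 * (sm n)^-1)).
- near=> n; have /andP[h1 h2] := l_bounds n.
  rewrite invr_ge0 ler0n/= -invfM ?lef_pV2 ?posrE ?mulr_gt0//.
  by rewrite ltW// mulrC.
- exact: cvg_cst.
- by rewrite -[X in _ --> X](mulr0 (Num.sqrt a)^-1); apply: cvgM; [exact: cvg_cst|exact: cvg_sqrt_harmonic].
Unshelve. all: by end_near.
Qed.

Let s_bounds n : c - ((l n)%:R)^-1 <= (s n)%:~R / (l n)%:R <= c.
Proof.
have /andP[h1 h2] := floor_itv (c * (l n)%:R).
rewrite ler_pdivrMr// h1 andbT ler_pdivlMr// mulrBl mulVf ?gt_eqF//.
by move: h2; rewrite intrD => h2; rewrite lerBlDr ltW.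
Qed.

Let s_l : (s n)%:~R / (l n)%:R @[n --> \oo] --> c.
Proof.
apply: (@squeeze_cvgr _ _ _ _ (fun n => c - ((l n)%:R)^-1) (fun=> c)).
- by near=> n; exact: s_bounds.
- by rewrite -[X in _ --> X]subr0; apply: cvgB => //; exact: cvg_cst.
- exact: cvg_cst.
Unshelve. all: by end_near.
Qed.

Let d n (z : int) := absz (z * (l n)%:Z + s n).

Let d_norm n z : (d n z)%:R = `|z%:~R * (l n)%:R + (s n)%:~R| :> R.
Proof. by rewrite /d pmulrn abszE intr_norm intrD intrM. Qed.

Let d_sm z : (d n z)%:R / sm n @[n --> \oo] --> `|z%:~R + c| * Num.sqrt a.
Proof.
have -> : (fun n => (d n z)%:R / sm n) =
   (fun n => `|z%:~R + (s n)%:~R / (l n)%:R| * ((l n)%:R / sm n)).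
  apply/funext => n; rewrite d_norm.
  have -> : z%:~R * (l n)%:R + (s n)%:~R = (z%:~R + (s n)%:~R / (l n)%:R) * (l n)%:R :> R.
    by rewrite mulrDl divfK ?gt_eqF.
  by rewrite normrM [`|(l n)%:R|]ger0_norm ?ler0n// mulrA.
apply: cvgM => //; apply: cvg_norm; apply: cvgD => //; exact: cvg_cst.
Qed.

Let d_m z : (d n z)%:R / n.+1%:R @[n --> \oo] --> (0 : R).
Proof.
have -> : (fun n => (d n z)%:R / n.+1%:R) = (fun n => (d n z)%:R / sm n * (sm n)^-1).
  by apply/funext => n; rewrite -mulrA -invfM -expr2 sqr_sm.
rewrite -[X in _ --> X](mulr0 (`|z%:~R + c| * Num.sqrt a)).
by apply: cvgM; [exact: d_sm|exact: cvg_sqrt_harmonic].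
Qed.

Let ratio_cvg z : bin_ratio R n.+1 (d n z) @[n --> \oo] -->
  expR (- (a * (z%:~R + c) ^+ 2)).
Proof.
have lim_sq : ((d n z)%:R / sm n) ^+ 2 @[n --> \oo] --> a * (z%:~R + c) ^+ 2.
  have -> : a * (z%:~R + c) ^+ 2 = (`|z%:~R + c| * Num.sqrt a) ^+ 2.
    by rewrite exprMn real_normK ?num_real// sqr_sa mulrC.
  exact/cvg_sqrn/d_sm.
have near_le : \forall n \near \oo, (d n z <= n.+1)%N.
  have /cvgr_lt/(_ 1 ltr01) := @d_m z; apply: filterS => n.
  by rewrite ltr_pdivrMr// mul1r ltr_nat => /ltnW.
apply: (@squeeze_cvgr _ _ _ _
   (fun n => expR (- (((d n z)%:R / sm n) ^+ 2 / (1 - (d n z)%:R / n.+1%:R + n.+1%:R^-1))))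
   (fun n => expR (- (((d n z)%:R / sm n) ^+ 2 / (1 + (d n z)%:R / n.+1%:R))))).
- near=> n.
  have dn : (d n z <= n.+1)%N by near: n.
  have n0 : n.+1%:R != 0 :> R by rewrite pnatr_eq0.
  have e1 E : ((d n z)%:R / sm n) ^+ 2 / E = (d n z)%:R ^+ 2 / (n.+1%:R * E).
    by rewrite expr_div_n sqr_sm invfM mulrA.
  apply/andP; split.
    apply: le_trans (bin_ratio_ge _ (leqnn _) dn).
    rewrite ler_expR lerN2 natrD natrB// e1.
    have -> : n.+1%:R * (1 - (d n z)%:R / n.+1%:R + n.+1%:R^-1) =
       n.+1%:R - (d n z)%:R + 1 :> R by field.
    by [].
  apply: le_trans (bin_ratio_le _ _ (leqnn _)) _ => //.
  rewrite ler_expR lerN2 natrD e1.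
  have -> : n.+1%:R * (1 + (d n z)%:R / n.+1%:R) = n.+1%:R + (d n z)%:R :> R by field.
  by [].
- apply: cvg_expRn; apply: cvgN; rewrite -[X in _ --> X]divr1.
  apply: cvgM => //; apply: cvgV; first exact: oner_neq0.
  rewrite -[X in _ --> X]addr0; apply: cvgD; last exact: cvg_harmonic.
  by rewrite -[X in _ --> X]subr0; apply: cvgB => //; exact: cvg_cst.
- apply: cvg_expRn; apply: cvgN; rewrite -[X in _ --> X]divr1.
  apply: cvgM => //; apply: cvgV; first exact: oner_neq0.
  by rewrite -[X in _ --> X]addr0; apply: cvgD => //; exact: cvg_cst.
Unshelve. all: by end_near.
Qed.

(** A majorant uniform in [n]. Nonzero terms have [d n z <= n.+1], so the denominator in
    [bin_ratio_le] is at most [2 * n.+1]; rounding [c] to [s / l] costs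
    [(z + s / l) ^ 2 >= (z + c) ^ 2 / 2 - 1]. *)
Let ratio_dom n z : bin_ratio R n.+1 (d n z) <=
  expR (a / 2) * expR (- (a / 4 * (z%:~R + c) ^+ 2)).
Proof.
have [nd|dn] := ltnP n.+1 (d n z).
  by rewrite /bin_ratio bin_small ?mul0r ?mulr_ge0 ?expR_ge0//; lia.
apply: le_trans (bin_ratio_le _ _ dn) _ => //.
rewrite -expRD ler_expR d_norm real_normK ?num_real//.
have := s_bounds n; set t := (s n)%:~R / (l n)%:R => /andP[t1 t2].
have -> : z%:~R * (l n)%:R + (s n)%:~R = (z%:~R + t) * (l n)%:R :> R.
  by rewrite mulrDl divfK ?gt_eqF.
have l1 : ((l n)%:R : R)^-1 <= 1 by rewrite invf_le1// ler1n.
have h1 : (z%:~R + c) ^+ 2 / 2 - 1 <= (z%:~R + t) ^+ 2.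
  have : 0 <= (z%:~R + t - (c - t)) ^+ 2 by exact: sqr_ge0.
  have : (c - t) ^+ 2 <= 1.
    by rewrite -[leRHS](expr1n _ 2) lerXn2r ?nnegrE//; lra.
  set A := z%:~R; move=> h2 h3; nra.
have h2 : a * n.+1%:R <= (l n)%:R ^+ 2.
  have /andP[h _] := l_bounds n.
  rewrite -sqr_sa -(sqr_sm n) -exprMn lerXn2r ?nnegrE ?ltW//.
  by rewrite mulr_gt0.
rewrite lerNl opprD opprK exprMn natrD ler_pdivlMr; last by rewrite addr_gt0.
have n0 : 0 < n.+1%:R :> R by rewrite ltr0n.
apply: (@le_trans _ _ ((z%:~R + t) ^+ 2 * (a * n.+1%:R))); last by rewrite ler_wpM2l ?sqr_ge0.
rewrite mulrA; set N := n.+1%:R in n0 *.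
have := mulr_gt0 a0 n0; nra.
Qed.

Let A n := usum (fun z : int => bin_ratio R n.+1 (d n z) * cos (2 * pi * (y * z%:~R + phi))).

Let A_cvg :
  smb (fun z : int => expR (- (a * (z%:~R + c) ^+ 2)) * cos (2 * pi * (y * z%:~R + phi))) /\
  A n @[n --> \oo] -->
  usum (fun z : int => expR (- (a * (z%:~R + c) ^+ 2)) * cos (2 * pi * (y * z%:~R + phi))).
Proof.
have a4 : 0 < a / 4 by rewrite divr_gt0.
have [C hC] := usum_gauss1 a4.
apply: (@sum_cvg R _ _ _ (fun z : int => expR (a / 2) * expR (- (a / 4 * (z%:~R + c) ^+ 2))) 0).
- by move=> z; apply: cvgM; [exact: ratio_cvg|exact: cvg_cst].
- by apply: smbZ; case: (hC c).
- move=> n z _; rewrite normrM ger0_norm ?bin_ratio_ge0//.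
  rewrite -[leRHS]mulr1; apply: ler_pM => //; first exact: bin_ratio_ge0.
  exact: cos_max.
Qed.

(** The period of frequencies is centred at [- y]: there [pi * (k + y) / l] stays in
    [[- pi / 2, pi / 2]], where powers of the cosine decay like a Gaussian. *)
Let lam0 n := Num.ceil (- (l n)%:R / 2 - y).

Let range n k := (lam0 n <= k) && (k < lam0 n + (l n)%:Z).

Let range_norm n k : range n k -> - ((l n)%:R / 2) <= k%:~R + y <= (l n)%:R / 2.
Proof.
have /andP[h1 h2] := ceil_itv (- (l n)%:R / 2 - y : R).
move=> /andP[]; rewrite -(ler_int R) => k1; rewrite -lezD1 -(ler_int R) !intrD -pmulrn => k2.
by move: h1; rewrite -/(lam0 n) intrD => h1; apply/andP; split; move: h2; rewrite -/(lam0 n); lra.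
Qed.

Let range_near k : \forall n \near \oo, range n k.
Proof.
pose B := 2 * (`|k%:~R| + `|y|) + 2.
have B0 : 0 < B by rewrite ltr_wpDl// mulr_ge0// addr_ge0.
have Bi : 0 < B^-1 by rewrite invr_gt0.
have /cvgr_lt/(_ _ Bi) := l_inv; apply: filterS => n.
rewrite ltf_pV2 ?posrE// => h.
have k1 := ler_norm (k%:~R : R); have k2 := ler_norm (- k%:~R : R).
have y1 := ler_norm y; have y2 := ler_norm (- y); rewrite normrN in k2; rewrite normrN in y2.
apply/andP; split; first by rewrite ceil_le_int; rewrite /B in h; lra.
have /andP[h1 h2] := ceil_itv (- (l n)%:R / 2 - y : R).
rewrite -(ltr_int R) intrD -pmulrn; move: h2; rewrite -/(lam0 n) /B in h *; lra.
Qed.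

Let F n k := if range n k then cos (pi * (k%:~R + y) / (l n)%:R) ^+ n.+1.*2 *
       cos (2 * pi * (phi - (k%:~R + y) * (s n)%:~R / (l n)%:R)) else 0.

(** Decay rate of the frequency side: [2 * n.+1 * (u ^ 2 / 4)] with [u = pi * (k + y) / l] and
    [l <= (sqrt a + 1) * sqrt n.+1]. *)
Let b : R := pi ^+ 2 / (2 * (Num.sqrt a + 1) ^+ 2).

Let pi2_gt0 : 0 < (pi : R) ^+ 2. Proof. by rewrite exprn_gt0 ?pi_gt0. Qed.

Let b_gt0 : 0 < b.
Proof. by rewrite divr_gt0// mulr_gt0// exprn_gt0// addr_gt0. Qed.

Let F_dom n k : `|F n k| <= expR (- (b * (k%:~R + y) ^+ 2)).
Proof.
rewrite /F; case: ifPn => [rk|_]; last by rewrite normr0 expR_ge0.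
have /andP[k1 k2] := range_norm rk.
set u := pi * (k%:~R + y) / (l n)%:R.
have hu : - pi / 2 <= u <= pi / 2.
  have pi0 := @pi_gt0 R; have ln := l_gt0 n.
  by apply/andP; rewrite /u ler_pdivlMr// ler_pdivrMr//; split; nra.
have c0 : 0 <= cos u by apply: cos_ge0_pihalf; rewrite -mulNr.
rewrite normrM -[leRHS]mulr1; apply: ler_pM => //; last exact: cos_max.
rewrite ger0_norm ?exprn_ge0//.
have h1 : cos u <= expR (- (u ^+ 2 / 4)).
  by apply: le_trans (le_expRN _); have [_] := oneB_cos_ge hu; lra.
apply: (@le_trans _ _ (expR (- (u ^+ 2 / 4)) ^+ n.+1.*2)).
  by rewrite lerXn2r ?nnegrE ?expR_ge0.
rewrite -expRM_natl ler_expR -mul2n natrM mulrN lerN2.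
rewrite /u /b !exprMn exprVn.
have l2 : (l n)%:R ^+ 2 <= (Num.sqrt a + 1) ^+ 2 * n.+1%:R.
  rewrite -(sqr_sm n) -exprMn lerXn2r ?nnegrE ?ler0n ?mulr_ge0 ?addr_ge0 ?(ltW sa_gt0) ?(ltW (sm_gt0 n))//.
  have /andP[_ h] := l_bounds n; apply: le_trans h _.
  rewrite mulrDl mul1r lerD2l -[leLHS](sqrtr1 R) ler_wsqrtr// ler1n//.
have sa1 : 0 < (Num.sqrt a + 1) ^+ 2 by rewrite exprn_gt0// addr_gt0.
have ln2 : 0 < (l n)%:R ^+ 2 :> R by rewrite exprn_gt0.
rewrite [leLHS](_ : _ = pi ^+ 2 * (k%:~R + y) ^+ 2 / 2 * ((Num.sqrt a + 1) ^+ 2)^-1); last first.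
  by field; rewrite gt_eqF// addr_gt0.
rewrite [leRHS](_ : _ = pi ^+ 2 * (k%:~R + y) ^+ 2 / 2 * (n.+1%:R / (l n)%:R ^+ 2)); last first.
  by field; rewrite gt_eqF.
apply: ler_wpM2l; first by rewrite divr_ge0// mulr_ge0 ?sqr_ge0.
by rewrite ler_pdivlMr// mulrC ler_pdivrMr// mulrC.
Qed.

Let F_cvg k : F n k @[n --> \oo] -->
  expR (- (pi ^+ 2 * (k%:~R + y) ^+ 2 / a)) * cos (2 * pi * (phi - (k%:~R + y) * c)).
Proof.
pose G n := cos (pi * (k%:~R + y) / (l n)%:R) ^+ n.+1.*2 *
       cos (2 * pi * (phi - (k%:~R + y) * (s n)%:~R / (l n)%:R)).
suff : G n @[n --> \oo] --> expR (- (pi ^+ 2 * (k%:~R + y) ^+ 2 / a)) * cos (2 * pi * (phi - (k%:~R + y) * c)).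
  apply: cvg_trans; apply: near_eq_cvg.
  by have := range_near k; apply: filterS => n rn; rewrite /F rn.
apply: cvgM; last first.
  apply: cvg_cosn; apply: cvgM; first exact: cvg_cst.
  apply: cvgB; first exact: cvg_cst.
  by under eq_fun do rewrite -mulrA; apply: cvgM => //; exact: cvg_cst.
pose u n := pi * (k%:~R + y) / (l n)%:R.
have cu : u n @[n --> \oo] --> (0 : R).
  rewrite -[X in _ --> X](mulr0 (pi * (k%:~R + y))).
  by apply: cvgM => //; exact: cvg_cst.
pose w n : R := n.+1.*2%:R * (u n ^+ 2 / 2).
have cw : w n @[n --> \oo] --> pi ^+ 2 * (k%:~R + y) ^+ 2 / a.
  have -> : w = (fun n => pi ^+ 2 * (k%:~R + y) ^+ 2 * ((l n)%:R / sm n) ^- 2).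
    apply/funext => n; rewrite /w /u expr_div_n -muln2 natrM -(sqr_sm n).
    by field; rewrite !gt_eqF.
  apply: cvgM; first exact: cvg_cst.
  apply: cvgV; first by rewrite gt_eqF.
  by rewrite -sqr_sa; exact: cvg_sqrn.
have ccos : cos (u n) @[n --> \oo] --> (1 : R) by rewrite -cos0; exact: cvg_cosn.
apply: (@squeeze_cvgr _ _ _ _ (fun n => expR (- (w n / cos (u n))))
   (fun n => expR (- (w n * (1 - u n ^+ 2 / 4))))).
- have n1 : \forall n \near \oo, 0 < cos (u n) by apply: (cvgr_gt 1 ccos); exact: ltr01.
  have n2 := range_near k.
  near=> n.
  have cp : 0 < cos (u n) by near: n.
  have rk : range n k by near: n.
  have /andP[k1 k2] := range_norm rk.
  have hu : - pi / 2 <= u n <= pi / 2.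
    have pi0 := @pi_gt0 R; have ln := l_gt0 n.
    by apply/andP; rewrite /u ler_pdivlMr// ler_pdivrMr//; split; nra.
  have [h1 _] := oneB_cos_ge hu; have h2 := oneB_cos_le (u n).
  have n20 : 0 <= n.+1.*2%:R :> R by rewrite ler0n.
  rewrite -/(u n); apply/andP; split.
    have c1 : 1 - cos (u n) < 1 by lra.
    have := ge_expRN c1; rewrite subKr => h3.
    apply: (@le_trans _ _ (expR (- ((1 - cos (u n)) / cos (u n))) ^+ n.+1.*2)).
      rewrite -expRM_natl ler_expR mulrN lerN2 mulrA ler_pM2r ?invr_gt0//.
      by rewrite /w ler_wpM2l.
    by rewrite lerXn2r ?nnegrE ?expR_ge0// ltW.
  apply: (@le_trans _ _ (expR (- (1 - cos (u n))) ^+ n.+1.*2)).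
    rewrite lerXn2r ?nnegrE ?expR_ge0 ?(ltW cp)//.
    by have := le_expRN (1 - cos (u n)); rewrite subKr.
  rewrite -expRM_natl ler_expR mulrN lerN2 /w -mulrA.
  by rewrite ler_wpM2l.
- apply: cvg_expRn; apply: cvgN; rewrite -[X in _ --> X]divr1.
  by apply: cvgM => //; apply: cvgV => //; exact: oner_neq0.
- apply: cvg_expRn; apply: cvgN; rewrite -[X in _ --> X]mulr1.
  apply: cvgM => //; rewrite -[X in _ --> X]subr0; apply: cvgB; first exact: cvg_cst.
  rewrite -[X in _ --> X](mul0r (4^-1)); apply: cvgM; last exact: cvg_cst.
  by have := cvg_sqrn cu; rewrite expr0n.
Unshelve. all: by end_near.
Qed.

(** The identity [binomial_poisson] divided by [4 ^ n.+1], in the limit: dominated convergence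
    applies to both sides, and the prefactor splits into [sqrt n.+1 * central_weight], tending to
    [g], and [l / sqrt n.+1], tending to [sqrt a]. *)
Lemma poisson1_aux (g : R) :
  Num.sqrt n.+1%:R * central_weight R n.+1 @[n --> \oo] --> g ->
  g * Num.sqrt a *
  usum (fun z : int => expR (- (a * (z%:~R + c) ^+ 2)) * cos (2 * pi * (y * z%:~R + phi))) =
  usum (fun k : int => expR (- (pi ^+ 2 * (k%:~R + y) ^+ 2 / a)) * cos (2 * pi * (phi - (k%:~R + y) * c))).
Proof.
move=> cg; have [_ cA] := A_cvg.
have [C hC] := usum_gauss1 b_gt0.
have [_ cF] := @sum_cvg R _ F _ (fun k : int => expR (- (b * (k%:~R + y) ^+ 2))) 0 F_cvg (hC y).1 (fun n k _ => F_dom n k).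
have e n : Num.sqrt n.+1%:R * central_weight R n.+1 * ((l n)%:R / sm n) * A n = usum (F n).
  have := @binomial_poisson R (l n) n.+1 (s n) (lam0 n) y phi (ltn0Sn _).
  set U := usum _; set V := usum _ => UV.
  have p0 : (4 : R) ^+ n.+1 != 0 by rewrite expf_neq0.
  have c0 : 'C(n.+1.*2, n.+1)%:R != 0 :> R by rewrite pnatr_eq0 -lt0n bin_gt0; lia.
  have sU : smb (fun z : int => bin_ratio R n.+1 (d n z) * cos (2 * pi * (y * z%:~R + phi))).
    have a4 : 0 < a / 4 by rewrite divr_gt0.
    have [C' hC'] := usum_gauss1 a4.
    apply: (@smb_le R _ _ (fun z : int => expR (a / 2) * expR (- (a / 4 * (z%:~R + c) ^+ 2)))).
      move=> z; rewrite normrM ger0_norm ?bin_ratio_ge0//.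
      rewrite -[leRHS]mulr1; apply: ler_pM => //; first exact: bin_ratio_ge0.
      exact: cos_max.
    by apply: smbZ; case: (hC' c).
  have hU : U = 'C(n.+1.*2, n.+1)%:R * A n.
    rewrite -sumZ//; apply: eq_sum => z.
    by rewrite /central_bin mulrA /bin_ratio -/(d n z) mulrCA mulfV// mulr1.
  have sF : smb (F n) by apply: smb_le (hC y).1 => k; exact: F_dom.
  have hV : V = 4 ^+ n.+1 * usum (F n).
    rewrite -sumZ//; apply: eq_sum => k; rewrite /F /range; case: ifP; rewrite ?mulr0//.
    move=> _; rewrite exprMn mulrA; congr (_ * _ * _).
    by rewrite -mul2n exprM; congr (_ ^+ _); ring.
  apply: (mulfI p0); rewrite -hV -UV hU /central_weight -/(sm n). 
  by field; rewrite p0 gt_eqF.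
have : usum (F n) @[n --> \oo] --> g * Num.sqrt a * usum (fun z : int => expR (- (a * (z%:~R + c) ^+ 2)) * cos (2 * pi * (y * z%:~R + phi))).
  under eq_fun do rewrite -e.
  by apply: cvgM => //; apply: cvgM.
by move=> h; rewrite -(cvg_lim (@Rhausdorff R) h) (cvg_lim (@Rhausdorff R) cF).
Qed.

End PoissonLine.

Lemma smb_gauss1 (R : realType) (a c : R) (h : int -> R) : 0 < a ->
  (forall z, `|h z| <= 1) ->
  smb (fun z : int => expR (- (a * (z%:~R + c) ^+ 2)) * h z).
Proof.
move=> a0 h1; have [C hC] := usum_gauss1 a0.
apply: smb_le (hC c).1 => z.
by rewrite normrM ger0_norm ?expR_ge0// ler_piMr ?expR_ge0.
Qed.

(* Poisson summation for Gaussians on the line, up to a universal constant [g]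
   (in fact [g = pi ^ (-1/2)], which is never needed). *)
Lemma poisson1 (R : realType) : exists2 g : R, 0 < g & forall a c y phi : R, 0 < a ->
  g * Num.sqrt a *
  usum (fun z : int => expR (- (a * (z%:~R + c) ^+ 2)) * cos (2 * pi * (y * z%:~R + phi))) =
  usum (fun k : int => expR (- (pi ^+ 2 / a * (k%:~R - y) ^+ 2)) *
     cos (2 * pi * ((k%:~R - y) * c + phi))).
Proof.
have [g g0 cg] := central_weight_cvg R.
exists g => // a c y phi a0; rewrite (poisson1_aux c y phi a0 cg).
rewrite -(sum_reindex _ int_opp_bij); apply: eq_sum => k.
rewrite mulrNz (_ : - k%:~R + y = - (k%:~R - y)); last by ring.
rewrite sqrrN; congr (expR _ * cos _); ring.
Qed.

(** * Quadratic forms and lattice Gaussians *)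

Section QuadraticForms.
Variable R : realType.

Definition qf n (S : 'M[R]_n) (v : 'rV[R]_n) : R := (v *m S *m v^T) 0 0.

Definition posdef n (S : 'M[R]_n) : Prop :=
  S^T = S /\ forall v : 'rV[R]_n, v != 0 -> 0 < qf S v.

Definition zvec n (z : 'rV[int]_n) : 'rV[R]_n := map_mx intr z.

Lemma dotpC n (u v : 'rV[R]_n) : dotp u v = dotp v u.
Proof. by apply: eq_bigr => i _; rewrite mulrC. Qed.

Lemma dotpDl n (u v w : 'rV[R]_n) : dotp (u + v) w = dotp u w + dotp v w.
Proof. by rewrite -big_split; apply: eq_bigr => i _; rewrite mxE mulrDl. Qed.

Lemma dotpZl n (c : R) (u w : 'rV[R]_n) : dotp (c *: u) w = c * dotp u w.
Proof. by rewrite /dotp mulr_sumr; apply: eq_bigr => i _; rewrite mxE mulrA. Qed.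

Lemma dotpNl n (u w : 'rV[R]_n) : dotp (- u) w = - dotp u w.
Proof. by rewrite -scaleN1r dotpZl mulN1r. Qed.

Lemma dotpDr n (u v w : 'rV[R]_n) : dotp w (u + v) = dotp w u + dotp w v.
Proof. by rewrite dotpC dotpDl !(dotpC w). Qed.

Lemma dotpZr n (c : R) (u w : 'rV[R]_n) : dotp w (c *: u) = c * dotp w u.
Proof. by rewrite dotpC dotpZl (dotpC w). Qed.

Lemma dotpNr n (u w : 'rV[R]_n) : dotp w (- u) = - dotp w u.
Proof. by rewrite dotpC dotpNl (dotpC w). Qed.

Lemma dotpE n (u v : 'rV[R]_n) : dotp u v = (u *m v^T) 0 0.
Proof. by rewrite mxE; apply: eq_bigr => i _; rewrite mxE. Qed.

Lemma dotp_row n (u u' : R) (v v' : 'rV[R]_n) :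
  dotp (row_mx u%:M v) (row_mx u'%:M v') = u * u' + dotp v v'.
Proof.
rewrite dotpE tr_row_mx mul_row_col mxE -(dotpE v v') tr_scalar_mx -scalar_mxM.
by rewrite mxE eqxx mulr1n.
Qed.

Lemma row_mx_scalar_ex n (x : 'rV[R]_(1 + n)) :
  exists u (v : 'rV[R]_n), x = row_mx u%:M v.
Proof.
exists (lsubmx x 0 0), (rsubmx x).
by rewrite -mx11_scalar hsubmxK.
Qed.

Lemma zvec_row n (p : int * 'rV[int]_n) :
  zvec (row_mx p.1%:M p.2) = row_mx (p.1%:~R)%:M (zvec p.2).
Proof. by rewrite /zvec map_row_mx map_scalar_mx. Qed.

Lemma int_row_bij n :
  bijective (fun p : int * 'rV[int]_n => row_mx p.1%:M p.2 : 'rV[int]_(1 + n)).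
Proof.
exists (fun z => (lsubmx z 0 0, rsubmx z)) => [[k w]|z] /=.
  by rewrite row_mxKl row_mxKr mxE eqxx mulr1n.
by rewrite -mx11_scalar hsubmxK.
Qed.

Lemma mx11_tr (A : 'M[R]_1) : A^T = A.
Proof. by rewrite [A]mx11_scalar tr_scalar_mx. Qed.

Lemma qf_addZ n (S : 'M[R]_n) (c : R) v w : S^T = S ->
  qf S (v + c *: w) = qf S v + 2 * c * dotp (w *m S) v + c ^+ 2 * dotp (w *m S) w.
Proof.
move=> tS; rewrite /qf linearD/= linearZ/= mulmxDl mulmxDr !mulmxDl -!scalemxAr -!scalemxAl.
rewrite !dotpE; have -> : w *m S *m v^T = v *m S *m w^T.
  by rewrite -[LHS]mx11_tr !trmx_mul trmxK tS mulmxA.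
set A : 'M[R]_1 := _ *m _ *m v^T; set B : 'M[R]_1 := v *m _ *m _.
set C : 'M[R]_1 := w *m _ *m _; rewrite !mxE; ring.
Qed.

Lemma posdef_inv n (S S' : 'M[R]_n) : posdef S -> S *m S' = 1%:M -> posdef S'.
Proof.
move=> [st sp] SS'.
have S'S : S' *m S = 1%:M by exact: mulmx1C.
have tS' : S'^T = S'.
  have : S'^T *m S = 1%:M by rewrite -{1}st -trmx_mul SS' trmx1.
  move=> h; rewrite -[LHS]mulmx1 -SS' mulmxA h mul1mx//.
split=> // v v0.
have -> : qf S' v = qf S (v *m S').
  by rewrite /qf trmx_mul tS' -!mulmxA [S *m (S' *m _)]mulmxA SS' mul1mx.
apply: sp; apply: contra_neq v0 => h.
by rewrite -[v]mulmx1 -S'S mulmxA h mul0mx.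
Qed.

Section Schur.
Variables (n : nat) (S : 'M[R]_(1 + n)).
Hypothesis pS : posdef S.

Definition pivot : R := S 0 0.
Definition pivot_row : 'rV[R]_n := ursubmx S.
Definition schur : 'M[R]_n := drsubmx S - pivot^-1 *: (pivot_row^T *m pivot_row).

Lemma pivot_block :
  S = block_mx pivot%:M pivot_row pivot_row^T (drsubmx S).
Proof.
rewrite -[LHS]submxK; congr block_mx.
- by rewrite [LHS]mx11_scalar /pivot !mxE; congr (S _ _)%:M; apply: val_inj.
- by rewrite /pivot_row -{1}pS.1 trmx_ursub.
Qed.

Lemma pivot_gt0 : 0 < pivot.
Proof.
have -> : pivot = qf S (row_mx 1%:M 0).
  rewrite /qf [in RHS]pivot_block tr_row_mx mul_row_block mul_row_col trmx0 mulmx0.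
  by rewrite !mul0mx !addr0 mul1mx tr_scalar_mx mulmx1 mxE eqxx mulr1n.
apply: pS.2; apply/eqP => /(congr1 (fun m : 'rV[R]_(1 + n) => m 0 (lshift n 0))).
by rewrite row_mxEl !mxE eqxx mulr1n => /eqP; rewrite oner_eq0.
Qed.

(** Completing the square in the first coordinate. A Gaussian in [1 + n] variables becomes a
    one-dimensional Gaussian, whose centre depends on the other variables, times a Gaussian for the
    Schur complement. *)
Lemma qf_schur (u : R) (v : 'rV[R]_n) : qf S (row_mx u%:M v) =
  pivot * (u + dotp pivot_row v / pivot) ^+ 2 + qf schur v.
Proof.
have p0 := lt0r_neq0 pivot_gt0.
have e1 : v *m pivot_row^T = (dotp pivot_row v)%:M by rewrite [LHS]mx11_scalar -dotpE dotpC.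
have e2 : pivot_row *m v^T = (dotp pivot_row v)%:M by rewrite [LHS]mx11_scalar -dotpE.
have -> : qf schur v = qf (drsubmx S) v - pivot^-1 * dotp pivot_row v ^+ 2.
  rewrite /qf /schur mulmxBr mulmxBl -scalemxAr -scalemxAl mulmxA e1.
  rewrite mul_scalar_mx -scalemxAl e2 scale_scalar_mx; set Q : 'M[R]_1 := _ *m _.
  by rewrite !mxE eqxx mulr1n.
rewrite {1}/qf [in LHS]pivot_block tr_row_mx mul_row_block mul_row_col.
rewrite tr_scalar_mx e1 mulmxDl -!scalar_mxM mulmxDl mul_scalar_mx -scalemxAl e2 /qf.
set Q : 'M[R]_1 := _ *m _ *m _; rewrite !mxE !eqxx !mulr1n; field.
by [].
Qed.

Lemma schur_posdef : posdef schur.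
Proof.
split.
  rewrite /schur linearB/= linearZ/= trmx_mul trmxK; congr (_ - _).
  by rewrite -[in RHS]pS.1 trmx_drsub.
move=> v v0.
have := qf_schur (- (dotp pivot_row v / pivot)) v.
rewrite addNr expr0n/= mulr0 add0r => <-; apply: pS.2.
apply: contra_neq v0 => h.
by rewrite -(row_mxKr (- (dotp pivot_row v / pivot))%:M v) h linear0.
Qed.

(** The dual of completing the square: for the inverse form the first coordinate stands alone with
    weight [pivot^-1], and it is the remaining block that gets translated. Forms and inverse forms
    can thus be reduced in parallel. *)
Lemma qf_schur_inv (S' : 'M[R]_(1 + n)) : S *m S' = 1%:M ->
  schur *m drsubmx S' = 1%:M /\
  forall (u : R) (v : 'rV[R]_n), qf S' (row_mx u%:M v) =
    pivot^-1 * u ^+ 2 + qf (drsubmx S') (v - (u / pivot) *: pivot_row).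
Proof.
move=> SS'; have pS' := posdef_inv pS SS'.
have p0 := lt0r_neq0 pivot_gt0.
set E := drsubmx S'; set q := ursubmx S'; set p := S' 0 0.
have S'E : S' = block_mx p%:M q q^T E.
  rewrite -[LHS]submxK; congr block_mx.
  - by rewrite [LHS]mx11_scalar /p !mxE; congr (S' _ _)%:M; apply: val_inj.
  - by rewrite /q -{1}pS'.1 trmx_ursub.
have := SS'; rewrite [in LHS]pivot_block [in LHS]S'E mulmx_block scalar_mx_block.
move=> /eq_block_mx[h1 h2 _ h4].
have qE : q = - (pivot^-1 *: (pivot_row *m E)).
  move: h2; rewrite mul_scalar_mx => /eqP; rewrite addr_eq0 => /eqP h.
  by rewrite -[LHS](scalerK p0) h scalerN.
have tE : E^T = E by rewrite /E trmx_drsub pS'.1.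
set be := dotp (pivot_row *m E).
have beE w : pivot_row *m E *m w^T = (be w)%:M by rewrite [LHS]mx11_scalar -dotpE.
have qv v : q *m v^T = (- (pivot^-1 * be v))%:M.
  by rewrite qE mulNmx -scalemxAl beE scale_scalar_mx raddfN.
have vq v : v *m q^T = (- (pivot^-1 * be v))%:M.
  by rewrite -[LHS]trmxK trmx_mul trmxK qv tr_scalar_mx.
have ppE : p = pivot^-1 + pivot^-1 * (pivot^-1 * be pivot_row).
  move: h1; rewrite vq -scalar_mxM -raddfD/= => /(congr1 (fun m : 'M[R]_1 => m 0 0)).
  rewrite !mxE !eqxx !mulr1n => h; rewrite -[LHS](mulKf p0).
  have -> : pivot * p = 1 + pivot^-1 * be pivot_row by rewrite -h; ring.
  by ring.
split.
  rewrite /schur mulmxBl -[in RHS]h4 qE mulmxN -scalemxAr -scalemxAl mulmxA addrC.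
  by [].
move=> u v; rewrite -scaleNr qf_addZ//.
rewrite -/(be v) -/(be pivot_row).
rewrite {1}/qf S'E tr_row_mx mul_row_block mul_row_col tr_scalar_mx vq.
rewrite mulmxDl -!scalar_mxM mulmxDl mul_scalar_mx -scalemxAl qv /qf.
set Q : 'M[R]_1 := _ *m _ *m _; rewrite !mxE !eqxx !mulr1n ppE; field.
by [].
Qed.

End Schur.

Lemma smb_prod (I J : choiceType) (f : I -> R) (g : J -> R) : smb f -> smb g ->
  smb (fun p : I * J => f p.1 * g p.2).
Proof.
move=> sf sg; apply: smb_pair => /= [i|]; first exact: smbZ.
have e i : usum (fun j => `|f i * g j|) = usum (fun j => `|g j|) * `|f i|.
  under eq_sum do rewrite normrM.
  by rewrite sumZ 1?mulrC//; exact: smb_norm.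
under eq_fun do rewrite e.
exact/smbZ/smb_norm.
Qed.

(** Summing over the first coordinate leaves a factor bounded by a constant, because [usum_gauss1]
    is uniform in the centre and the centre depends on the other coordinates. *)
Lemma smb_gauss n (S : 'M[R]_n) (a : R) (x : 'rV[R]_n) : posdef S -> 0 < a ->
  smb (fun z : 'rV[int]_n => expR (- (a * qf S (zvec z + x)))).
Proof.
move=> + a0; elim: n S x => [|n IH] S x pS.
  have [||//] := @usum_finsupp R _ (fun z : 'rV[int]_0 => expR (- (a * qf S (zvec z + x)))) [:: 0] => //.
  by move=> i; rewrite inE => /eqP[]; rewrite [i]thinmx0.
have al0 : 0 < a * pivot S by rewrite mulr_gt0// pivot_gt0.
have [C hC] := usum_gauss1 al0.
have [x1 [x' xE]] := row_mx_scalar_ex x.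
apply/(smb_reindex _ (int_row_bij n)).
have b : bijective (fun p : 'rV[int]_n * int => (p.2, p.1)).
  by exists (fun p => (p.2, p.1)) => -[].
apply/(smb_reindex _ b).
have e (p : 'rV[int]_n * int) :
    expR (- (a * qf S (zvec (row_mx p.2%:M p.1) + x))) =
    expR (- (a * pivot S * (p.2%:~R + (x1 + dotp (pivot_row S) (zvec p.1 + x') / pivot S)) ^+ 2)) *
    expR (- (a * qf (schur S) (zvec p.1 + x'))).
  rewrite -expRD (zvec_row (p.2, p.1)) xE add_row_mx -raddfD/= qf_schur//.
  by congr expR; ring.
apply: smb_pair => [w|].
  have [h1 _] := hC (x1 + dotp (pivot_row S) (zvec w + x') / pivot S).
  have := smbZ (expR (- (a * qf (schur S) (zvec w + x')))) h1.
  by apply: smb_le => k; rewrite (e (w, k)) mulrC ger0_norm// mulr_ge0 ?expR_ge0.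
apply: (@smb_le R _ _ (fun w => C * expR (- (a * qf (schur S) (zvec w + x'))))); last first.
  by apply/smbZ/IH/schur_posdef.
move=> w; have [h1 h2] := hC (x1 + dotp (pivot_row S) (zvec w + x') / pivot S).
rewrite (eq_sum (g := fun k : int => expR (- (a * qf (schur S) (zvec w + x'))) *
   expR (- (a * pivot S * (k%:~R + (x1 + dotp (pivot_row S) (zvec w + x') / pivot S)) ^+ 2)))); last first.
  by move=> k; rewrite (e (w, k)) mulrC ger0_norm// mulr_ge0 ?expR_ge0.
rewrite sumZ// ger0_norm; last first.
  by rewrite mulr_ge0 ?expR_ge0// sum_ge0// => k; rewrite expR_ge0.
by rewrite mulrC ler_wpM2r ?expR_ge0.
Qed.

End QuadraticForms.

(** * Poisson summation for positive definite forms *)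

Section PoissonLattice.
Variable R : realType.

(** Induction on the dimension: transform the first coordinate by [poisson1], exchange the sums, and
    apply the induction hypothesis to the Schur complement. The character [y] and the phase [phi]
    must be general because the first step creates new ones. *)
Lemma poisson_form n (S S' : 'M[R]_n) : posdef S -> S *m S' = 1%:M ->
  exists2 c : R, 0 < c & forall (a phi : R) (x y : 'rV[R]_n), 0 < a ->
    Num.sqrt a ^+ n *
    usum (fun z : 'rV[int]_n => expR (- (a * qf S (zvec R z + x))) *
       cos (2 * pi * (dotp y (zvec R z) + phi))) =
    c * usum (fun k : 'rV[int]_n => expR (- (pi ^+ 2 / a * qf S' (zvec R k - y))) *
       cos (2 * pi * (dotp (zvec R k - y) x + phi))).
Proof.
elim: n S S' => [|n IH] S S' pS SS'.
  exists 1 => // a phi x y a0; rewrite expr0 !mul1r.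
  have h (f : 'rV[int]_0 -> R) : usum f = f 0.
    have [||_ ->] := @usum_finsupp R _ f [:: 0] => //; last by rewrite big_seq1.
    by move=> i; rewrite inE => /eqP[]; rewrite [i]thinmx0.
  rewrite !h; have d0 (u v : 'rV[R]_0) : dotp u v = 0 by rewrite /dotp big_ord0.
  have q0 (T : 'M[R]_0) v : qf T v = 0 by rewrite /qf [v]thinmx0 !mul0mx mxE.
  by rewrite !d0 !q0 !mulr0.
have [DE qS'] := qf_schur_inv pS SS'.
have pD := schur_posdef pS.
have [c c0 hc] := IH _ _ pD DE.
have [g g0 hg] := poisson1 R.
have al0 := pivot_gt0 pS; set al := pivot S in al0 *.
have sal0 : 0 < Num.sqrt al by rewrite sqrtr_gt0.
exists (c / (g * Num.sqrt al)); first by rewrite divr_gt0// mulr_gt0.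
move=> a phi x y a0.
have [x1 [x' ->]] := row_mx_scalar_ex x.
have [y1 [y' ->]] := row_mx_scalar_ex y.
have pS' := posdef_inv pS SS'.
have pi20 : 0 < pi ^+ 2 / a :> R by rewrite divr_gt0// exprn_gt0// pi_gt0.
have aal0 : 0 < a * al by rewrite mulr_gt0.
set E := @drsubmx R 1 n 1 n S' in DE qS' hc.
set b := pivot_row S in qS' *.
(* [cc w] is the centre of the first coordinate given the others. After the transform it sits inside
   a cosine: its part linear in [w] moves the character to [yy], its constant part moves the phase
   to [pp]. *)
pose cc (w : 'rV[int]_n) := x1 + dotp b (zvec R w + x') / al.
pose yy (k1 : int) := y' + ((k1%:~R - y1) / al) *: b.
pose pp (k1 : int) := phi + (k1%:~R - y1) * (x1 + dotp b x' / al).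
have cos1 t : `|cos t| <= 1 :> R by exact: cos_max.
have swap1 : bijective (fun p : 'rV[int]_n * int => (p.2, p.1)).
  by exists (fun p => (p.2, p.1)) => -[].
pose GL (w : 'rV[int]_n) (k : int) :=
  expR (- (a * qf (schur S) (zvec R w + x'))) *
  (expR (- (a * al * (k%:~R + cc w) ^+ 2)) *
   cos (2 * pi * (y1 * k%:~R + (dotp y' (zvec R w) + phi)))).
have eL : usum (fun z : 'rV[int]_(1 + n) => expR (- (a * qf S (zvec R z + row_mx x1%:M x'))) *
       cos (2 * pi * (dotp (row_mx y1%:M y') (zvec R z) + phi))) =
    usum (fun w => usum (GL w)).
  rewrite -(sum_reindex _ (int_row_bij n)) -(sum_reindex _ swap1).
  have eG : (fun p : 'rV[int]_n * int =>
     expR (- (a * qf S (zvec R (row_mx p.2%:M p.1) + row_mx x1%:M x'))) *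
       cos (2 * pi * (dotp (row_mx y1%:M y') (zvec R (row_mx p.2%:M p.1)) + phi))) =
     (fun p => GL p.1 p.2).
    apply/funext => -[w k]; rewrite /= (zvec_row R (k, w)) add_row_mx -raddfD/= qf_schur//.
    rewrite -/b -/al dotp_row /GL mulrA -expRD; congr (expR _ * cos _); last by ring.
    by rewrite /cc; ring.
  rewrite sum_pair.
    by apply: eq_sum => w; apply: eq_sum => k; have := congr1 (fun f => f (w, k)) eG.
  apply: (@smb_le R _ _ (fun p : 'rV[int]_n * int =>
     expR (- (a * qf S (zvec R (row_mx p.2%:M p.1) + row_mx x1%:M x'))))).
    by move=> p; rewrite normrM (ger0_norm (expR_ge0 _)) ler_piMr ?expR_ge0.
  have := smb_gauss (row_mx x1%:M x') pS a0.
  by move=> /(smb_reindex _ (int_row_bij n)) /(smb_reindex _ swap1).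
pose GM (w : 'rV[int]_n) (k : int) :=
  expR (- (a * qf (schur S) (zvec R w + x'))) *
  (expR (- (pi ^+ 2 / (a * al) * (k%:~R - y1) ^+ 2)) *
   cos (2 * pi * ((k%:~R - y1) * cc w + (dotp y' (zvec R w) + phi)))).
have b0 : 0 < pi ^+ 2 / (a * al) by rewrite divr_gt0// exprn_gt0// pi_gt0.
have s1 w : smb (fun k : int => expR (- (a * al * (k%:~R + cc w) ^+ 2)) *
   cos (2 * pi * (y1 * k%:~R + (dotp y' (zvec R w) + phi)))).
  exact: smb_gauss1.
have s2 w : smb (fun k : int => expR (- (pi ^+ 2 / (a * al) * (k%:~R - y1) ^+ 2)) *
   cos (2 * pi * ((k%:~R - y1) * cc w + (dotp y' (zvec R w) + phi)))).
  exact: smb_gauss1.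
have eM w : g * Num.sqrt (a * al) * usum (GL w) = usum (GM w).
  by rewrite !sumZ// mulrCA hg.
have sGM : smb (fun p : 'rV[int]_n * int => GM p.1 p.2).
  have h1 : smb (fun w : 'rV[int]_n => expR (- (a * qf (schur S) (zvec R w + x')))).
    exact: smb_gauss.
  have h2 : smb (fun k : int => expR (- (pi ^+ 2 / (a * al) * (k%:~R - y1) ^+ 2)) * 1).
    by apply: smb_gauss1 => // _; rewrite normr1.
  apply: smb_le (smb_prod h1 h2) => p.
  rewrite /GM !normrM !(ger0_norm (expR_ge0 _)) mulr1 ler_wpM2l ?expR_ge0//.
  by rewrite ler_piMr ?expR_ge0.
have sGL : smb (fun w => usum (GL w)).
  have gs0 : g * Num.sqrt (a * al) != 0.
    by rewrite gt_eqF// mulr_gt0// sqrtr_gt0.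
  have := smbZ (g * Num.sqrt (a * al))^-1 (smb_sum_slice sGM).
  apply: smb_le => w.
  have -> : usum (GL w) = (g * Num.sqrt (a * al))^-1 * usum (GM w).
    by rewrite -eM mulKf.
  rewrite normrM ger0_norm; last by rewrite invr_ge0 mulr_ge0 ?sqrtr_ge0 ?ltW.
  apply: ler_wpM2l; first by rewrite invr_ge0 mulr_ge0 ?sqrtr_ge0 ?ltW.
  by apply: sum_norm_le => //; exact/smb_norm/(smb_slice w sGM).
have eR : usum (fun k : 'rV[int]_(1 + n) => expR (- (pi ^+ 2 / a * qf S' (zvec R k - row_mx y1%:M y'))) *
       cos (2 * pi * (dotp (zvec R k - row_mx y1%:M y') (row_mx x1%:M x') + phi))) =
   usum (fun k1 : int => expR (- (pi ^+ 2 / (a * al) * (k1%:~R - y1) ^+ 2)) *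
     usum (fun k' : 'rV[int]_n => expR (- (pi ^+ 2 / a * qf E (zvec R k' - yy k1))) *
       cos (2 * pi * (dotp (zvec R k' - yy k1) x' + pp k1)))).
  rewrite -(sum_reindex _ (int_row_bij n)) sum_pair; last first.
    apply: (@smb_le R _ _ (fun p : int * 'rV[int]_n =>
       expR (- (pi ^+ 2 / a * qf S' (zvec R (row_mx p.1%:M p.2) - row_mx y1%:M y'))))).
      by move=> p; rewrite normrM (ger0_norm (expR_ge0 _)) ler_piMr ?expR_ge0.
    have := smb_gauss (- row_mx y1%:M y') pS' pi20.
    by move=> /(smb_reindex _ (int_row_bij n)).
  apply: eq_sum => k1; rewrite -sumZ; last first.
    apply: (@smb_le R _ _ (fun k' : 'rV[int]_n => expR (- (pi ^+ 2 / a * qf E (zvec R k' - yy k1))))).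
      by move=> p; rewrite normrM (ger0_norm (expR_ge0 _)) ler_piMr ?expR_ge0.
    exact: smb_gauss (posdef_inv pD DE) pi20.
  apply: eq_sum => k'; rewrite (zvec_row R (k1, k'))/=.
  rewrite opp_row_mx add_row_mx -raddfB/= qS' dotp_row mulrA -expRD.
  have -> : zvec R k' - y' - ((k1%:~R - y1) / al) *: b = zvec R k' - yy k1.
    by rewrite /yy opprD addrA.
  congr (expR _ * cos _); first by rewrite -/al; field; rewrite !gt_eqF.
  rewrite /yy /pp !dotpDl !dotpNl dotpDl dotpZl; field.
  by rewrite gt_eqF.
rewrite eL eR.
have -> : usum (fun k1 : int => expR (- (pi ^+ 2 / (a * al) * (k1%:~R - y1) ^+ 2)) *
     usum (fun k' : 'rV[int]_n => expR (- (pi ^+ 2 / a * qf E (zvec R k' - yy k1))) *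
       cos (2 * pi * (dotp (zvec R k' - yy k1) x' + pp k1)))) =
   c^-1 * (Num.sqrt a ^+ n * usum (fun w => usum (GM w))).
  rewrite (sum_swap sGM).
  have sq : smb (fun k1 : int => usum (GM ^~ k1)).
    have sGM' : smb (fun p : int * 'rV[int]_n => GM p.2 p.1).
      exact: (smb_reindex (fun p : int * 'rV[int]_n => GM p.2 p.1) swap1).1 sGM.
    apply: smb_le (smb_sum_slice sGM') => k.
    by apply: sum_norm_le => //; exact/smb_norm/(smb_slice k sGM').
  rewrite -!sumZ//; last exact: smbZ.
  apply: eq_sum => k1.
  have := hc a (pp k1) x' (yy k1) a0 => /(congr1 (fun t => c^-1 * t)).
  rewrite mulKf ?gt_eqF// => <-.
  rewrite mulrCA; congr (_ * _); rewrite mulrCA; congr (_ * _).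
  rewrite -sumZ; last first.
    apply: (@smb_le R _ _ (fun w : 'rV[int]_n => expR (- (a * qf (schur S) (zvec R w + x'))))).
      by move=> p; rewrite normrM (ger0_norm (expR_ge0 _)) ler_piMr ?expR_ge0.
    exact: smb_gauss.
  apply: eq_sum => w; rewrite /GM mulrCA; congr (_ * (_ * cos _)).
  rewrite /cc /yy /pp dotpDr dotpDl dotpZl; ring.
have -> : usum (fun w => usum (GM w)) = g * Num.sqrt (a * al) * usum (fun w => usum (GL w)).
  by rewrite -sumZ//; apply: eq_sum => w; rewrite eM.
rewrite sqrtrM ?ltW// exprSr; field.
by rewrite !gt_eqF.
Qed.

End PoissonLattice.

(** * Theta functions and transference *)

Section Theta.
Variable R : realType.

Definition nsq n (v : 'rV[R]_n) : R := dotp v v.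

Lemma nsq_ge0 n (v : 'rV[R]_n) : 0 <= nsq v.
Proof. by apply: sumr_ge0 => i _; rewrite -expr2 sqr_ge0. Qed.

Lemma nsq0 n : nsq (0 : 'rV[R]_n) = 0.
Proof. by rewrite /nsq /dotp big1// => i _; rewrite mxE mul0r. Qed.

Lemma nsq_gt0 n (v : 'rV[R]_n) : v != 0 -> 0 < nsq v.
Proof.
move=> v0; rewrite lt_neqAle nsq_ge0 andbT eq_sym; apply: contra v0.
rewrite /nsq /dotp psumr_eq0; last by move=> i _; rewrite -expr2 sqr_ge0.
move=> /allP h; apply/eqP/rowP => i; rewrite mxE.
by have := h i (mem_index_enum _); rewrite /= mulf_eq0 orbb => /eqP.
Qed.

Lemma nsqN n (v : 'rV[R]_n) : nsq (- v) = nsq v.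
Proof. by rewrite /nsq dotpNl dotpNr opprK. Qed.

Lemma nsqZ n (c : R) (v : 'rV[R]_n) : nsq (c *: v) = c ^+ 2 * nsq v.
Proof. by rewrite /nsq dotpZl dotpZr mulrA. Qed.

Lemma nsqB n (u v : 'rV[R]_n) : nsq (u - v) = nsq u + nsq v - 2 * dotp u v.
Proof. by rewrite /nsq !dotpDl !dotpDr !dotpNl !dotpNr (dotpC v u); ring. Qed.

Lemma dotp_mul n (u v : 'rV[R]_n) (M : 'M[R]_n) : dotp (u *m M) v = dotp u (v *m M^T).
Proof. by rewrite !dotpE trmx_mul trmxK mulmxA. Qed.

Definition gsum n (B : 'M[R]_n) (a : R) (t : 'rV[R]_n) : R :=
  usum (fun z : 'rV[int]_n => expR (- (a * nsq (zvec R z *m B - t)))).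

(* Summing over nonzero lattice vectors only. *)
Definition theta n (B : 'M[R]_n) (a : R) : R := gsum B a 0 - 1.

Definition dual_basis n (B B' : 'M[R]_n) := B *m B'^T = 1%:M.

Lemma dual_basis_sym n (B B' : 'M[R]_n) : dual_basis B B' -> dual_basis B' B.
Proof. by move=> h; rewrite /dual_basis -[LHS]trmxK trmx_mul trmxK h trmx1. Qed.

Lemma dual_basis_mulC n (B B' : 'M[R]_n) : dual_basis B B' -> B'^T *m B = 1%:M.
Proof. exact: mulmx1C. Qed.

Lemma zvec0 n : zvec R (0 : 'rV[int]_n) = 0.
Proof. by apply/rowP => i; rewrite !mxE. Qed.

Section Dual.
Variables (n : nat) (B B' : 'M[R]_n).
Hypothesis BB' : dual_basis B B'.

Lemma dual_basis_inj (v : 'rV[R]_n) : v *m B = 0 -> v = 0.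
Proof. by move=> h; rewrite -[v]mulmx1 -BB' mulmxA h mul0mx. Qed.

Lemma gram_posdef : posdef (B *m B^T).
Proof.
split=> [|v v0]; first by rewrite trmx_mul trmxK.
rewrite /qf mulmxA -mulmxA -trmx_mul -dotpE nsq_gt0//.
by apply: contra_neq v0; exact: dual_basis_inj.
Qed.

Lemma gsumE (a : R) (t : 'rV[R]_n) (z : 'rV[int]_n) :
  nsq (zvec R z *m B - t) = qf (B *m B^T) (zvec R z - t *m B'^T).
Proof.
rewrite /qf mulmxA -[_ *m B *m _ *m _]mulmxA -trmx_mul -dotpE -/(nsq _).
by rewrite mulmxBl -[t *m _ *m B]mulmxA dual_basis_mulC// mulmx1.
Qed.

Lemma smb_gsum (a : R) (t : 'rV[R]_n) : 0 < a ->
  smb (fun z : 'rV[int]_n => expR (- (a * nsq (zvec R z *m B - t)))).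
Proof.
move=> a0; under eq_fun do rewrite (gsumE a).
exact: smb_gauss gram_posdef a0.
Qed.

Lemma gsum_pos_part (a : R) : 0 < a ->
  gsum B a 0 = 1 + usum (fun z : 'rV[int]_n =>
    if z == 0 then 0 else expR (- (a * nsq (zvec R z *m B)))) /\
  smb (fun z : 'rV[int]_n => if z == 0 then 0 else expR (- (a * nsq (zvec R z *m B)))).
Proof.
move=> a0; have s1 := smb_gsum 0 a0.
have s2 : smb (fun z : 'rV[int]_n => if z == 0 then 0 else expR (- (a * nsq (zvec R z *m B)))).
  apply: smb_le s1 => z; rewrite subr0; case: eqP => _.
    by rewrite normr0 expR_ge0.
  by rewrite ger0_norm ?expR_ge0.
have [s3 S3] := @sum_cond_seq R _ (fun _ : 'rV[int]_n => 1) [:: 0] isT.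
split=> //; rewrite big_seq1 in S3.
rewrite -S3 -sumD//; apply: eq_sum => z; rewrite inE subr0.
case: eqP => [->|_]; last by rewrite add0r.
by rewrite zvec0 mul0mx nsq0 mulr0 oppr0 expR0 addr0.
Qed.

Lemma thetaE (a : R) : 0 < a -> theta B a = usum (fun z : 'rV[int]_n =>
    if z == 0 then 0 else expR (- (a * nsq (zvec R z *m B)))).
Proof. by move=> a0; rewrite /theta (gsum_pos_part a0).1 addrC addKr. Qed.

Lemma theta_ge0 (a : R) : 0 < a -> 0 <= theta B a.
Proof.
move=> a0; rewrite thetaE//; apply: sum_ge0; last exact: (gsum_pos_part a0).2.
by move=> z; case: ifP => // _; rewrite expR_ge0.
Qed.

Lemma theta_anti (a a' : R) : 0 < a -> a <= a' -> theta B a' <= theta B a.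
Proof.
move=> a0 aa'; have a'0 := lt_le_trans a0 aa'.
rewrite !thetaE//; apply: sum_le; [exact: (gsum_pos_part a'0).2|exact: (gsum_pos_part a0).2|].
move=> z; case: ifP => // _.
by rewrite ler_expR lerN2 ler_wpM2r ?nsq_ge0.
Qed.

Lemma poisson_lattice : exists2 c : R, 0 < c & forall (a : R) (t : 'rV[R]_n), 0 < a ->
  Num.sqrt a ^+ n * gsum B a t =
  c * usum (fun k : 'rV[int]_n => expR (- (pi ^+ 2 / a * nsq (zvec R k *m B'))) *
     cos (2 * pi * dotp (zvec R k *m B') t)).
Proof.
have SS' : (B *m B^T) *m (B' *m B'^T) = 1%:M.
  rewrite mulmxA -[B *m B^T *m B']mulmxA -[B^T *m B']trmxK trmx_mul trmxK.
  by rewrite dual_basis_mulC// trmx1 mulmx1.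
have [c c0 hc] := poisson_form gram_posdef SS'.
exists c => // a t a0; rewrite /gsum.
have := hc a 0 (- (t *m B'^T)) 0 a0.
under eq_sum => z do rewrite -(gsumE a) dotpC.
have e0 (z : 'rV[int]_n) : dotp (zvec R z) 0 = 0 by rewrite -(scale0r 0) dotpZr mul0r.
under eq_sum => z do rewrite e0 addr0 mulr0 cos0 mulr1.
move=> ->; congr (_ * _); apply: eq_sum => k; rewrite subr0 addr0.
rewrite dotpNr mulrN cosN -dotp_mul; congr (expR (- (_ * _)) * _).
by rewrite /qf mulmxA -mulmxA -trmx_mul -dotpE.
Qed.

End Dual.

Section PoissonBounds.
Variables (n : nat) (B B' : 'M[R]_n).
Hypothesis BB' : dual_basis B B'.

Let B'B := dual_basis_sym BB'.

(** On the dual side the zero vector contributes [1] for every [t], and the cosines of the other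
    terms are bounded by [1], which leaves [theta]. *)
Lemma gsum_near : exists2 c : R, 0 < c & forall (a : R) (t : 'rV[R]_n), 0 < a ->
  `|Num.sqrt a ^+ n * gsum B a t - c| <= c * theta B' (pi ^+ 2 / a).
Proof.
have [c c0 hc] := poisson_lattice BB'; exists c => // a t a0.
have b0 : 0 < pi ^+ 2 / a by rewrite divr_gt0// exprn_gt0// pi_gt0.
rewrite hc// -[X in _ - X]mulr1 -mulrBr normrM (ger0_norm (ltW c0)).
apply: ler_wpM2l; first exact: ltW.
set F := fun k => _ * _.
have sF : smb F.
  apply: smb_le (smb_gsum B'B 0 b0) => k; rewrite subr0 normrM ger0_norm ?expR_ge0//.
  by rewrite ler_piMr ?expR_ge0// cos_max.
have [s3 S3] := @sum_cond_seq R _ (fun _ : 'rV[int]_n => 1) [:: 0] isT.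
rewrite big_seq1 in S3.
have -> : usum F - 1 = usum (fun k => F k - (if k \in [:: 0] then 1 else 0)).
  by rewrite sumD//; [rewrite sumN// S3|exact: smbN].
rewrite (thetaE B'B)//; apply: sum_norm_le; first exact: (gsum_pos_part B'B b0).2.
move=> k; rewrite inE /F; case: eqP => [->|_].
  rewrite zvec0 mul0mx nsq0 mulr0 oppr0 expR0 mul1r.
  by rewrite /dotp big1 ?mulr0 ?cos0 ?subrr ?normr0// => i _; rewrite mxE mul0r.
rewrite subr0 normrM ger0_norm ?expR_ge0//.
by rewrite ler_piMr ?expR_ge0// cos_max.
Qed.

(** At [t = 0] every term of the dual side increases with [a]. *)
Lemma gsum_scale_le (a a' : R) : 0 < a -> a <= a' ->
  Num.sqrt a ^+ n * gsum B a 0 <= Num.sqrt a' ^+ n * gsum B a' 0.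
Proof.
move=> a0 aa'; have a'0 := lt_le_trans a0 aa'.
have [c c0 hc] := poisson_lattice BB'; rewrite !hc// ler_pM2l//.
have e0 (k : 'rV[int]_n) : dotp (zvec R k *m B') 0 = 0.
  by rewrite -(scale0r 0) dotpZr mul0r.
under eq_sum => k do rewrite e0 mulr0 cos0 mulr1.
under [leRHS]eq_sum => k do rewrite e0 mulr0 cos0 mulr1.
have pi2 : 0 < pi ^+ 2 :> R by rewrite exprn_gt0// pi_gt0.
have s (b : R) : 0 < b -> smb (fun k : 'rV[int]_n => expR (- (pi ^+ 2 / b * nsq (zvec R k *m B')))).
  move=> b0; have /(smb_gsum B'B 0) : 0 < pi ^+ 2 / b by rewrite divr_gt0.
  by under eq_fun do rewrite subr0.
apply: sum_le => [||k]; [exact: s|exact: s|].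
rewrite ler_expR lerN2; apply: ler_wpM2r; first exact: nsq_ge0.
by apply: ler_wpM2l; [exact: ltW|rewrite lef_pV2].
Qed.

End PoissonBounds.

Lemma gsum_half n (B B' : 'M[R]_n) (b : R) : dual_basis B B' -> 0 < b ->
  gsum B (b / 2) 0 <= Num.sqrt 2 ^+ n * (1 + theta B b).
Proof.
move=> BB' b0; have b2 : 0 < b / 2 by rewrite divr_gt0.
have h1 : gsum B (b / 2) 0 <= Num.sqrt 2 ^+ n * gsum B b 0.
  have bb : b / 2 <= b by lra.
  have := gsum_scale_le BB' b2 bb.
  have -> : Num.sqrt b ^+ n = Num.sqrt (b / 2) ^+ n * Num.sqrt 2 ^+ n.
    by rewrite -exprMn -sqrtrM ?divfK// ltW.
  by rewrite -mulrA ler_pM2l// exprn_gt0// sqrtr_gt0.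
by rewrite /theta addrCA subrr addr0.
Qed.

(** Half of the exponent is at least [b * lam / 2]; the other half sums to [gsum B (b / 2) 0]. The
    bound is self-referential: once the coefficient of [1 + theta B b] is small, [theta B b] can be
    solved for. *)
Lemma theta_tail n (B B' : 'M[R]_n) (lam b : R) : dual_basis B B' -> 0 < b ->
  (forall z : 'rV[int]_n, z != 0 -> lam <= nsq (zvec R z *m B)) ->
  theta B b <= expR (- (b * lam / 2)) * (Num.sqrt 2 ^+ n * (1 + theta B b)).
Proof.
move=> BB' b0 hlam; have b2 : 0 < b / 2 by rewrite divr_gt0.
apply: (@le_trans _ _ (expR (- (b * lam / 2)) * gsum B (b / 2) 0)); last first.
  by rewrite ler_wpM2l ?expR_ge0// (gsum_half BB').
have s2 := smb_gsum BB' 0 b2.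
rewrite (thetaE BB')// /gsum -sumZ//; apply: sum_le; [exact: (gsum_pos_part BB' b0).2|exact: smbZ|].
move=> z; rewrite subr0; case: eqP => [_|/eqP z0]; first by rewrite mulr_ge0 ?expR_ge0.
rewrite -expRD ler_expR; have := hlam z z0; have := nsq_ge0 (zvec R z *m B).
by set N := nsq _ => N0 hN; nra.
Qed.

Lemma lattice_min_ex n (B B' : 'M[R]_n) : dual_basis B B' ->
  exists2 lam : R, 0 < lam & forall z : 'rV[int]_n, z != 0 -> lam <= nsq (zvec R z *m B).
Proof.
move=> BB'.
(* Each coordinate of [z] is the inner product of [z B] with a row of [B']. *)
pose C : R := 1 + \sum_i nsq (row i B').
have C1 : 1 <= C by rewrite lerDl; apply: sumr_ge0 => i _; exact: nsq_ge0.
have C0 : 0 < C by apply: lt_le_trans C1.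
exists C^-1; first by rewrite invr_gt0.
move=> z z0; have [i zi] : exists i, z 0 i != 0.
  apply/existsP; apply: contraR z0; rewrite negb_exists => /forallP h.
  by apply/eqP/rowP => i; rewrite mxE; have := h i; rewrite negbK => /eqP.
have e : (z 0 i)%:~R = dotp (zvec R z *m B) (row i B').
  have : (zvec R z *m (B *m B'^T)) 0 i = (z 0 i)%:~R by rewrite BB' mulmx1 mxE.
  move=> <-; rewrite mulmxA mxE; apply: eq_bigr => j _.
  by rewrite !mxE.
set v := zvec R z *m B in e *; set w := row i B' in e.
have CS : dotp v w ^+ 2 <= nsq v * nsq w.
  have := nsq_ge0 (nsq w *: v - dotp v w *: w).
  rewrite nsqB !nsqZ dotpZl dotpZr.
  have [w0 _|w0] := eqVneq (nsq w) 0.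
    have -> : dotp v w = 0.
      have : w = 0 by apply/eqP; apply: contraTT isT => /nsq_gt0; rewrite w0 ltxx.
      by move=> ->; rewrite -(scale0r 0) dotpZr mul0r.
    by rewrite w0 mulr0 expr0n/=.
  have w1 : 0 < nsq w by rewrite lt_neqAle eq_sym w0 nsq_ge0.
  by move=> h; nra.
have z1 : 1 <= dotp v w ^+ 2.
  rewrite -e expr2 -intrM -[1]/(1%:~R) ler_int.
  by move: zi; nia.
have wC : nsq w <= C.
  rewrite /C (bigD1 i)//= addrCA lerDl addr_ge0// sumr_ge0// => j _; exact: nsq_ge0.
rewrite -[C^-1]mulr1 ler_pdivrMl//; apply: le_trans z1 (le_trans CS _).
by rewrite mulrC ler_wpM2r ?nsq_ge0.
Qed.

(** If every lattice point were at squared distance above [r] from [t], lowering the parameter from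
    [a] to [a2] would gain a factor [expR ((a - a2) * r)] termwise. But the normalized sums at [a]
    and [a2] both lie between [3 / 4] and [5 / 4] of the same constant, whence the factor
    [5 / 3]. *)
Lemma transference_core n (B B' : 'M[R]_n) (a a2 r : R) : dual_basis B B' ->
  0 < a2 -> a2 < a -> theta B' (pi ^+ 2 / a) <= 1 / 4 ->
  Num.sqrt (a / a2) ^+ n * expR (- ((a - a2) * r)) * (5 / 3) < 1 ->
  forall t, exists z : 'rV[int]_n, nsq (zvec R z *m B - t) <= r.
Proof.
move=> BB' a20 a2a th lt1 t; have a0 := lt_trans a20 a2a.
have B'B := dual_basis_sym BB'.
apply: contrapT => /forallNP far.
have {}far z : r < nsq (zvec R z *m B - t) by rewrite ltNge; apply/negP; exact: far.
have [c c0 hc] := gsum_near BB'.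
have h1 := hc a t a0; have h2 := hc a2 t a20.
have th2 : theta B' (pi ^+ 2 / a2) <= 1 / 4.
  have pi2 : 0 < pi ^+ 2 :> R by rewrite exprn_gt0// pi_gt0.
  apply: le_trans th; apply: (theta_anti B'B); first by rewrite divr_gt0.
  by rewrite ler_pM2l// lef_pV2// ltW.
have gg : gsum B a t <= expR (- ((a - a2) * r)) * gsum B a2 t.
  have s2 := smb_gsum BB' t a20.
  rewrite /gsum -sumZ//; apply: sum_le; [exact: (smb_gsum BB')|exact: smbZ|].
  move=> z; rewrite -expRD ler_expR; have := far z.
  by set N := nsq _ => hN; nra.
have sa : 0 < Num.sqrt a ^+ n by rewrite exprn_gt0// sqrtr_gt0.
have sa2 : 0 < Num.sqrt a2 ^+ n by rewrite exprn_gt0// sqrtr_gt0.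
have e : Num.sqrt a ^+ n = Num.sqrt (a / a2) ^+ n * Num.sqrt a2 ^+ n.
  rewrite -exprMn -sqrtrM ?divfK ?gt_eqF//.
  by rewrite divr_ge0 ?ltW.
move: h1 h2; rewrite !ler_norml => /andP[h1 _] /andP[_ h2].
have h3 : c * (3 / 4) <= Num.sqrt a ^+ n * gsum B a t by nra.
have h4 : Num.sqrt a2 ^+ n * gsum B a2 t <= c * (5 / 4) by nra.
have h5 : Num.sqrt a ^+ n * gsum B a t <=
   Num.sqrt (a / a2) ^+ n * expR (- ((a - a2) * r)) * (Num.sqrt a2 ^+ n * gsum B a2 t).
  rewrite mulrACA -e; apply: ler_wpM2l => //; exact: ltW.
have K0 : 0 <= Num.sqrt (a / a2) ^+ n * expR (- ((a - a2) * r)).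
  by rewrite mulr_ge0 ?expR_ge0// exprn_ge0// sqrtr_ge0.
have h6 := ler_wpM2l K0 h4.
move: lt1 h3 h5 h6; set K := _ * expR _; set X := _ * gsum B a t; set Y := _ * gsum B a2 t.
move=> lt1 h3 h5 h6; nra.
Qed.

End Theta.

(** * Counting lattice vectors in shells by averaging *)

Section Averaging.
Variable R : realType.

Lemma sqrt_expR (x : R) : Num.sqrt (expR x) = expR (x / 2).
Proof.
have -> : expR x = expR (x / 2) ^+ 2 by rewrite -expRM_natl; congr expR; field.
by rewrite sqrtr_sqr ger0_norm ?expR_ge0.
Qed.

Lemma sqrt_expR_exp (x : R) n : Num.sqrt (expR x) ^+ n = expR (n%:R / 2 * x).
Proof. by rewrite sqrt_expR -expRM_natl; congr expR; field. Qed.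

Lemma sqrtM_exp (x y : R) n : 0 <= x ->
  Num.sqrt (x * y) ^+ n = Num.sqrt x ^+ n * Num.sqrt y ^+ n.
Proof. by move=> x0; rewrite sqrtrM// exprMn. Qed.

Lemma ler_sqrt_exp (x y : R) n : x <= y -> Num.sqrt x ^+ n <= Num.sqrt y ^+ n.
Proof. by move=> xy; rewrite lerXn2r ?nnegrE ?sqrtr_ge0// ler_wsqrtr. Qed.

Lemma sqrt_exp_gt0 (x : R) n : 0 < x -> 0 < Num.sqrt x ^+ n.
Proof. by move=> x0; rewrite exprn_gt0// sqrtr_gt0. Qed.

Lemma expRN_le_inv (x : R) : 0 < x -> expR (- x) <= x^-1.
Proof.
move=> x0; rewrite expRN lef_pV2 ?posrE ?expR_gt0//.
by apply: le_trans (expR_ge1Dx x); rewrite lerDr.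
Qed.

(* A lattice so fine that translated Gaussian sums over it behave like
   integrals, uniformly in the translation. *)
Lemma fine_lattice n (del amax : R) : 0 < del -> 0 < amax ->
  exists (G G' : 'M[R]_n) (c : R), [/\ dual_basis G G', 0 < c &
    forall (a : R) (t : 'rV[R]_n), 0 < a -> a <= amax ->
      `|Num.sqrt a ^+ n * gsum G a t - c| <= c * del].
Proof.
move=> d0 am0.
have D1 : dual_basis (1%:M : 'M[R]_n) 1%:M by rewrite /dual_basis trmx1 mulmx1.
have [lam lam0 hlam] := lattice_min_ex D1.
(* With this value, [th <= e * (1 + th)] is equivalent to [th <= del]. *)
pose e := del / (1 + del).
have e0 : 0 < e by rewrite divr_gt0// addr_gt0.
have pi2 : 0 < pi ^+ 2 :> R by rewrite exprn_gt0// pi_gt0.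
pose K := pi ^+ 2 / amax * lam / 2.
have K0 : 0 < K by rewrite !divr_gt0// mulr_gt0// divr_gt0.
have s20 : 0 < Num.sqrt 2 ^+ n :> R by rewrite sqrt_exp_gt0.
(* The lattice is the integer lattice divided by [N = sqrt M2]; by [expR (- x) <= x^-1] this scale
   brings the coefficient in [theta_tail] below [e] for every parameter up to [amax]. *)
pose M2 := Num.sqrt 2 ^+ n / (e * K).
have M20 : 0 < M2 by rewrite divr_gt0// mulr_gt0.
pose N := Num.sqrt M2.
have N0 : 0 < N by rewrite sqrtr_gt0.
have NN : N ^+ 2 = M2 by rewrite sqr_sqrtr// ltW.
have DG : dual_basis (N^-1)%:M (N%:M : 'M[R]_n).
  by rewrite /dual_basis tr_scalar_mx -scalar_mxM mulVf ?gt_eqF.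
have [c c0 hc] := gsum_near DG.
exists (N^-1)%:M, N%:M, c; split=> // a t a0 aam.
apply: le_trans (hc a t a0) _; apply: ler_wpM2l; first exact: ltW.
have b0 : 0 < pi ^+ 2 / a by rewrite divr_gt0.
have DG' := dual_basis_sym DG.
have lamN (z : 'rV[int]_n) : z != 0 -> N ^+ 2 * lam <= nsq (zvec R z *m N%:M).
  by move=> /hlam; rewrite mulmx1 mul_mx_scalar nsqZ ler_pM2l// exprn_gt0.
have := theta_tail DG' b0 lamN; set th := theta _ _.
have h : expR (- (pi ^+ 2 / a * (N ^+ 2 * lam) / 2)) * Num.sqrt 2 ^+ n <= e.
  have hx : M2 * K <= pi ^+ 2 / a * (N ^+ 2 * lam) / 2.
    rewrite NN /K (_ : M2 * _ = pi ^+ 2 / amax * (M2 * lam) / 2); last by ring.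
    rewrite ler_pM2r// ler_pM2r; last by rewrite mulr_gt0.
    by rewrite ler_pM2l// lef_pV2.
  have MK : 0 < M2 * K by rewrite mulr_gt0.
  apply: (@le_trans _ _ ((M2 * K)^-1 * Num.sqrt 2 ^+ n)).
    rewrite ler_pM2r//; apply: le_trans (expRN_le_inv MK).
    by rewrite ler_expR lerN2.
  rewrite /M2 le_eqVlt; apply/orP; left; apply/eqP; field.
  by rewrite !gt_eqF.
rewrite mulrA => h2.
have th0 : 0 <= 1 + th by rewrite addr_ge0// (theta_ge0 DG').
have h3 : th <= e * (1 + th) by apply: le_trans h2 _; exact: ler_wpM2r.
have : th * (1 + del) <= del * (1 + th).
  have -> : del * (1 + th) = e * (1 + th) * (1 + del).
    by rewrite /e; field; rewrite gt_eqF// addr_gt0.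
  by rewrite ler_pM2r// addr_gt0.
by lra.
Qed.

Lemma gauss_product n (a b : R) (z w : 'rV[R]_n) : a + b != 0 ->
  b * nsq z + a * nsq (z - w) =
  a * b / (a + b) * nsq w + (a + b) * nsq (z - (a / (a + b)) *: w).
Proof.
by move=> ab; rewrite !nsqB nsqZ dotpZr; field.
Qed.

(* The indicator of a ball dominates a combination of three Gaussians that is
   nearly as large as its leading term. *)
Lemma indicator_ge (a eta kap v : R) : 0 <= a -> 0 < eta -> 0 <= kap ->
  expR (- (a * kap)) * (expR (- (a * v)) - expR (- ((a - eta) * v)) -
    expR (- (eta * kap)) * expR (- ((a + eta) * v))) <= (v <= 0)%R%:R.
Proof.
move=> a0 e0 k0.
have -> : expR (- (a * v)) - expR (- ((a - eta) * v)) -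
    expR (- (eta * kap)) * expR (- ((a + eta) * v)) =
    expR (- (a * v)) * (1 - expR (eta * v) - expR (- (eta * (kap + v)))).
  by rewrite !mulrBr mulr1 -!expRD; congr (_ - expR _ - expR _); ring.
have e1 := expR_ge0 (eta * v); have e2 := expR_ge0 (- (eta * (kap + v))).
have e3 : 0 <= expR (- (a * kap)) * expR (- (a * v)) by rewrite mulr_ge0 ?expR_ge0.
(* The bracket is nonpositive for [v > 0] because of its second term and for [v < - kap] because of
   its third; in between, the prefactor [expR (- (a * kap))] compensates [expR (- (a * v))]. *)
rewrite mulrA; have [v0|v0] := leP v 0; last first.
  rewrite mulr_ge0_le0//; have : 1 <= expR (eta * v).
    by rewrite -expR0 ler_expR mulr_ge0// ltW.
  by lra.
have [kv|kv] := leP 0 (kap + v).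
  rewrite -[leRHS]mul1r; apply: (@le_trans _ _ (expR (- (a * kap)) * expR (- (a * v)) * 1)).
    by apply: ler_wpM2l => //; lra.
  rewrite !mulr1 -expRD -expR0 ler_expR; nra.
apply: (@le_trans _ _ 0) => //; rewrite mulr_ge0_le0//.
have : 1 <= expR (- (eta * (kap + v))) by rewrite -expR0 ler_expR; nra.
by lra.
Qed.

Lemma frac_le (E1 E2 r r1 th X : R) : 0 < r -> 0 < r1 -> 0 <= E1 ->
  r <= r1 * X -> E1 * X <= th * E2 -> E1 / r1 <= th * (E2 / r).
Proof.
move=> r0 r10 E10 rX EX; rewrite ler_pdivrMr// mulrA mulrAC ler_pdivlMr//.
apply: le_trans (ler_wpM2l E10 rX) _; rewrite mulrCA mulrC.
by apply: ler_wpM2r => //; exact: ltW.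
Qed.

(** The constants fit because [7 / 8 - 2 * (9 / 8) * (1 / 8) >= 1 / 2]. *)
Lemma main_term_ge (c p p1 p2 u u1 u2 th E : R) : 0 <= c -> 0 <= p -> 0 <= E ->
  c * (7 / 8) * p <= u -> u1 <= c * (9 / 8) * p1 -> u2 <= c * (9 / 8) * p2 ->
  p1 <= th * p -> E * p2 <= th * p -> th <= 1 / 8 ->
  c / 2 * p <= u - u1 - E * u2.
Proof.
move=> c0 p0 E0 h1 h2 h3 h4 h5 h6.
have h7 := ler_wpM2l E0 h3; have h8 := ler_wpM2l c0 h4.
have h9 := ler_wpM2l c0 h5; have h10 := ler_wpM2l c0 (ler_wpM2r p0 h6).
have cp : 0 <= c * p by exact: mulr_ge0.
lra.
Qed.

Lemma size_mul_le_sum (T : eqType) (s : seq T) (f : T -> R) (C : R) :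
  (forall w, w \in s -> C <= f w) -> (size s)%:R * C <= \sum_(w <- s) f w.
Proof.
elim: s => [|w s IH] h; first by rewrite big_nil mul0r.
rewrite big_cons -nat1r mulrDl mul1r; apply: lerD; first by rewrite h// mem_head.
by apply: IH => v vs; rewrite h// in_cons vs orbT.
Qed.

(** Weight centres [z] by [expR (- (a2 * nsq z))] and count pairs with [nsq (z - w) <= RA]. Each
    centre sees at most [A] points. For fixed [w], the extra factor [expR (- (a1 * nsq (z - w)))]
    gives a Gaussian of parameter [s = a1 + a2] centred at [(1 - y) * w], where the typical value of
    [nsq (z - w)] is [y ^ 2 * q + n / (2 * s) = x]. The parameters are chosen for this equality.
    Comparing both totals gives [sqrt (s / a2) ^ n = sqrt (q / x) ^ n] up to factors
    [e^(O(e n))]. *)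
Lemma shell_count n (ws : seq 'rV[R]_n) (A x q e : R) : 0 < x -> x < q ->
  0 < e -> e <= 1 / 3 ->
  (forall v, (count (fun w => nsq (w - v) <= x * (1 + 4 * e))%R ws)%:R <= A) ->
  (forall w, w \in ws -> q <= nsq w <= q * (1 + e)) ->
  expR (- (e ^+ 2 * (n%:R / 2))) <= 1 / 8 ->
  (size ws)%:R <= 3 * A * expR (3 * e * n%:R) * Num.sqrt (q / x) ^+ n.
Proof.
move=> x0 xq e0 e3 hA hws th8.
set h : R := n%:R / 2 in th8 *.
have h0 : 0 < h.
  rewrite divr_gt0// ltr0n lt0n; apply/eqP => n0; move: th8.
  by rewrite /h n0 mul0r mulr0 oppr0 expR0; lra.
have q0 : 0 < q by lra.
pose y := x / q.
have y0 : 0 < y by rewrite divr_gt0.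
have y1 : y < 1 by rewrite ltr_pdivrMr// mul1r.
have qE : q = x / y by rewrite /y; field; rewrite !gt_eqF.
pose s := h / (x * (1 - y)).
have xy0 : 0 < x * (1 - y) by rewrite mulr_gt0// subr_gt0.
have s0 : 0 < s by rewrite divr_gt0.
have hE : h = s * x * (1 - y) by rewrite /s -mulrA divfK// gt_eqF.
pose a2 := s * y; pose a1 := s * (1 - y); pose eta := e * s.
have a20 : 0 < a2 by rewrite mulr_gt0.
have a10 : 0 < a1 by rewrite mulr_gt0// subr_gt0.
have eta0 : 0 < eta by rewrite mulr_gt0.
have a12 : a1 + a2 = s by rewrite /a1 /a2; ring.
(* The interval from [RA - kap] to [RA] contains the typical value of [nsq (z - w)] with room
   [e * x] on either side, also when the parameter is changed by [1 - e] or [1 + e] and for the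
   whole shell. *)
pose RA := x * (1 + 4 * e); pose kap := 6 * e * x.
have kap0 : 0 <= kap by rewrite !mulr_ge0// ltW.
pose th := expR (- (e ^+ 2 * h)).
have amax0 : 0 < s * (1 + e) by rewrite mulr_gt0// addr_gt0.
have d8 : 0 < 1 / 8 :> R by lra.
have [G [G' [c [DG c0 hG]]]] := fine_lattice n d8 amax0.
have gb (a : R) t : 0 < a -> a <= s * (1 + e) ->
   c * (7 / 8) <= Num.sqrt a ^+ n * gsum G a t <= c * (9 / 8).
  move=> a0 aa; have := hG a t a0 aa; rewrite ler_norml => /andP[g1 g2].
  by apply/andP; split; lra.
pose pt (k : 'rV[int]_n) := zvec R k *m G.
pose U a w := usum (fun k => expR (- (a2 * nsq (pt k))) * expR (- (a * (nsq (pt k - w) - RA)))).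
have Ufun a w : 0 < a + a2 -> (fun k => expR (- (a2 * nsq (pt k))) * expR (- (a * (nsq (pt k - w) - RA)))) =
   (fun k => expR (a * RA - a * a2 / (a + a2) * nsq w) *
      expR (- ((a + a2) * nsq (pt k - (a / (a + a2)) *: w)))).
  move=> aa; apply/funext => k; rewrite -!expRD; congr expR.
  have := @gauss_product n a a2 (pt k) w (lt0r_neq0 aa); lra.
have sU a w : 0 < a + a2 -> smb (fun k => expR (- (a2 * nsq (pt k))) * expR (- (a * (nsq (pt k - w) - RA)))).
  by move=> aa; rewrite Ufun//; apply: smbZ; exact: (smb_gsum DG).
have UE a w : 0 < a + a2 -> U a w = expR (a * RA - a * a2 / (a + a2) * nsq w) *
   gsum G (a + a2) ((a / (a + a2)) *: w).
  by move=> aa; rewrite /U Ufun// sumZ//; exact: (smb_gsum DG).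
(* The value of [U], up to the constant [c], if the sum over the fine lattice were an integral. *)
pose P a Q := expR (a * RA - a * a2 / (a + a2) * Q) / Num.sqrt (a + a2) ^+ n.
have UP a w : 0 < a + a2 -> a + a2 <= s * (1 + e) ->
   c * (7 / 8) * P a (nsq w) <= U a w <= c * (9 / 8) * P a (nsq w).
  move=> aa as1; have /andP[g1 g2] := gb _ ((a / (a + a2)) *: w) aa as1.
  have sq0 := sqrt_exp_gt0 n aa; rewrite UE// /P.
  set E := expR _; set g := gsum _ _ _ in g1 g2 *; set r := Num.sqrt _ ^+ n in g1 g2 sq0 *.
  have E0 : 0 <= E by rewrite expR_ge0.
  have -> : E * g = (r * g) * (E / r) by field; rewrite gt_eqF.
  have Er : 0 <= E / r by rewrite divr_ge0// ltW.
  by rewrite !ler_wpM2r.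
have e1 : 0 < 1 - e by lra.
have e1' : 0 < 1 + e by lra.
(* the two error terms are exponentially smaller than the main term *)
have P1 Q : q <= Q <= q * (1 + e) -> P (a1 - eta) Q <= th * P a1 Q.
  move=> /andP[Q1 Q2].
  have e_s : a1 - eta + a2 = s * (1 - e) by rewrite -a12 /eta; rewrite -a12; ring.
  have s1 : 0 < s * (1 - e) by rewrite mulr_gt0.
  rewrite /P e_s a12.
  have r1 : Num.sqrt s ^+ n <= Num.sqrt (s * (1 - e)) ^+ n * expR (h * (e / (1 - e))).
    rewrite /h -sqrt_expR_exp -sqrtM_exp; last exact: ltW.
    apply: ler_sqrt_exp; rewrite -mulrA -[leLHS]mulr1 ler_pM2l//.
    rewrite mulrC -ler_pdivrMr// mul1r; apply: le_trans (expR_ge1Dx _).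
    by rewrite le_eqVlt; apply/orP; left; apply/eqP; field; rewrite gt_eqF.
  have sq1 := sqrt_exp_gt0 n s1; have sq0 := sqrt_exp_gt0 n s0.
  apply: frac_le sq0 sq1 (expR_ge0 _) r1 _; rewrite -!expRD ler_expR.
  have y2Q : y ^+ 2 * Q <= y * x * (1 + e).
    rewrite qE in Q2; have := ler_wpM2l (sqr_ge0 y) Q2.
    by rewrite [X in _ <= X -> _](_ : _ = y * x * (1 + e))//; field; rewrite gt_eqF.
  rewrite -subr_ge0 [leRHS](_ : _ = e * s * (RA - (y ^+ 2 * Q + x * (1 - y)) / (1 - e)) - e ^+ 2 * h).
    rewrite subr_ge0.
    have k1 : (y ^+ 2 * Q + x * (1 - y)) / (1 - e) <= x * (1 + 3 * e).
      have k3 : 0 <= x * e * (1 - 3 * e) by rewrite !mulr_ge0 ?(ltW x0) ?(ltW e0)//; lra.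
      have k4 : 0 <= x * e * (1 - y) by rewrite !mulr_ge0 ?(ltW x0) ?(ltW e0)//; lra.
      rewrite ler_pdivrMr//; lra.
    have k2 : e * x <= RA - (y ^+ 2 * Q + x * (1 - y)) / (1 - e) by rewrite /RA; lra.
    apply: (@le_trans _ _ (e * s * (e * x))); last by rewrite ler_pM2l// mulr_gt0.
    rewrite hE (_ : e * s * (e * x) = e ^+ 2 * (s * x)); last by ring.
    have sx0 : 0 < s * x by rewrite mulr_gt0.
    apply: ler_wpM2l; first exact: sqr_ge0.
    rewrite -[leRHS]mulr1; apply: ler_wpM2l; first exact: ltW.
    by lra.
  rewrite [in h * _]hE /a1 /a2 /eta; field.
  by rewrite !gt_eqF.
have P2 Q : q <= Q <= q * (1 + e) -> expR (- (eta * kap)) * P (a1 + eta) Q <= th * P a1 Q.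
  move=> /andP[Q1 Q2].
  have e_s : a1 + eta + a2 = s * (1 + e) by rewrite -a12 /eta; rewrite -a12; ring.
  have s1 : 0 < s * (1 + e) by rewrite mulr_gt0.
  rewrite /P e_s a12.
  have r1 : Num.sqrt s ^+ n <= Num.sqrt (s * (1 + e)) ^+ n * expR (h * (- (e / (1 + e)))).
    rewrite /h -sqrt_expR_exp -sqrtM_exp; last exact: ltW.
    apply: ler_sqrt_exp; rewrite -mulrA -[leLHS]mulr1 ler_pM2l//.
    rewrite mulrC -ler_pdivrMr// mul1r; apply: le_trans (expR_ge1Dx _).
    by rewrite le_eqVlt; apply/orP; left; apply/eqP; field; rewrite gt_eqF.
  have sq1 := sqrt_exp_gt0 n s1; have sq0 := sqrt_exp_gt0 n s0.
  rewrite mulrA -expRD; apply: frac_le sq0 sq1 (expR_ge0 _) r1 _; rewrite -!expRD ler_expR.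
  have y2Q : y * x <= y ^+ 2 * Q.
    rewrite qE in Q1; have := ler_wpM2l (sqr_ge0 y) Q1.
    by rewrite [X in X <= _ -> _](_ : _ = y * x)//; field; rewrite gt_eqF.
  rewrite -subr_ge0 [leRHS](_ : _ = e * s * (kap - RA + (y ^+ 2 * Q + x * (1 - y)) / (1 + e)) - e ^+ 2 * h).
    rewrite subr_ge0.
    have k1 : x * (1 - e) <= (y ^+ 2 * Q + x * (1 - y)) / (1 + e).
      have k3 : 0 <= x * e ^+ 2 by rewrite mulr_ge0 ?(ltW x0) ?sqr_ge0.
      rewrite ler_pdivlMr//; lra.
    have k2 : e * x <= kap - RA + (y ^+ 2 * Q + x * (1 - y)) / (1 + e) by rewrite /RA /kap; lra.
    apply: (@le_trans _ _ (e * s * (e * x))); last by rewrite ler_pM2l// mulr_gt0.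
    rewrite hE (_ : e * s * (e * x) = e ^+ 2 * (s * x)); last by ring.
    have sx0 : 0 < s * x by rewrite mulr_gt0.
    apply: ler_wpM2l; first exact: sqr_ge0.
    rewrite -[leRHS]mulr1; apply: ler_wpM2l; first exact: ltW.
    by lra.
  rewrite [in h * _]hE /a1 /a2 /eta; field.
  by rewrite !gt_eqF.
pose T w := usum (fun k => expR (- (a2 * nsq (pt k))) * (nsq (pt k - w) - RA <= 0)%R%:R).
have s_a2 : smb (fun k => expR (- (a2 * nsq (pt k)))).
  by have := smb_gsum DG 0 a20; under eq_fun do rewrite subr0.
have sT w : smb (fun k => expR (- (a2 * nsq (pt k))) * (nsq (pt k - w) - RA <= 0)%R%:R).
  apply: smb_le s_a2 => k; rewrite ger0_norm ?mulr_ge0 ?expR_ge0//.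
  by rewrite ler_piMr ?expR_ge0// lern1 leq_b1.
have s1e : s <= s * (1 + e) by rewrite ler_peMr ?(ltW s0)//; lra.
have Tge w : w \in ws -> expR (- (a1 * kap)) * (c / 2 * P a1 (nsq w)) <= T w.
  move=> /hws Qw.
  have p1 := P1 _ Qw; have p2 := P2 _ Qw.
  have i1 : 0 < a1 + a2 by rewrite a12.
  have i1' : a1 + a2 <= s * (1 + e) by rewrite a12.
  have i2 : 0 < a1 - eta + a2 by rewrite addrAC a12 /eta -{1}[s]mul1r -mulrBl mulr_gt0.
  have i2' : a1 - eta + a2 <= s * (1 + e) by rewrite addrAC a12; lra.
  have i3 : 0 < a1 + eta + a2 by rewrite addrAC a12 addr_gt0.
  have i3' : a1 + eta + a2 <= s * (1 + e) by rewrite addrAC a12 /eta; lra.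
  have /andP[u1 _] := UP _ w i1 i1'; have /andP[_ u2] := UP _ w i2 i2'.
  have /andP[_ u3] := UP _ w i3 i3'.
  have PP0 : 0 <= P a1 (nsq w) by rewrite divr_ge0 ?expR_ge0// ltW// sqrt_exp_gt0.
  apply: (@le_trans _ _ (expR (- (a1 * kap)) * (U a1 w - U (a1 - eta) w - expR (- (eta * kap)) * U (a1 + eta) w))).
    apply: ler_wpM2l; first exact: expR_ge0.
    exact: main_term_ge (ltW c0) PP0 (expR_ge0 _) u1 u2 u3 p1 p2 th8.
  rewrite /T /U -sumZ; last exact: sU.
  rewrite -sumN; last exact: sU.
  rewrite -sumD; [|exact: sU|exact/smbN/sU].
  rewrite -sumN; last exact/smbZ/sU.
  rewrite -sumD; [|exact: smbD (sU _ _ _) (smbN (sU _ _ _))|exact/smbN/smbZ/sU].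
  rewrite -sumZ; last exact: smbD (smbD (sU _ _ _) (smbN (sU _ _ _))) (smbN (smbZ _ (sU _ _ _))).
  apply: sum_le => //.
    by apply: smbZ; exact: smbD (smbD (sU _ _ _) (smbN (sU _ _ _))) (smbN (smbZ _ (sU _ _ _))).
  move=> k; have := indicator_ge (nsq (pt k - w) - RA) (ltW a10) eta0 kap0.
  move=> /(ler_wpM2l (expR_ge0 (- (a2 * nsq (pt k))))); apply: le_trans.
  by rewrite le_eqVlt; apply/orP; left; apply/eqP; ring.
have Tsum : \sum_(w <- ws) T w <= A * gsum G a2 0.
  have [b1 b2] := sum_bigr ws sT; rewrite -b2 /gsum -sumZ; last exact: (smb_gsum DG 0 a20).
  apply: sum_le => //; first by apply: smbZ; exact: (smb_gsum DG 0 a20).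
  move=> k; rewrite -mulr_sumr mulrC subr0; apply: ler_wpM2r; first exact: expR_ge0.
  apply: le_trans (hA (pt k)); rewrite -natr_sum ler_nat -sum1_count [leqRHS]big_mkcond/=.
  by apply: leq_sum => w _; rewrite subr_le0 -nsqN opprB -/RA; case: (_ <= _).
have /andP[_ ga2] : c * (7 / 8) <= Num.sqrt a2 ^+ n * gsum G a2 0 <= c * (9 / 8).
  by apply: gb => //; rewrite -a12; nra.
have sq2 := sqrt_exp_gt0 n a20; have sqs := sqrt_exp_gt0 n s0.
have A0 : 0 <= A by apply: le_trans (hA 0).
have Plow w : w \in ws -> (Num.sqrt s ^+ n)^-1 <= P a1 (nsq w).
  move=> /hws /andP[_ Q2]; rewrite /P a12 -[leLHS]mul1r ler_pM2r ?invr_gt0//.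
  rewrite -expR0 ler_expR.
  have e2 : a1 * a2 / s * nsq w <= h * (1 + e).
    have -> : a1 * a2 / s = h / q by rewrite /a1 /a2 hE /y; field; rewrite !gt_eqF.
    rewrite mulrAC ler_pdivrMr// (_ : h * (1 + e) * q = h * (q * (1 + e))); last by ring.
    by apply: ler_wpM2l => //; exact: ltW.
  have -> : a1 * RA = h * (1 + 4 * e) by rewrite /a1 /RA hE; ring.
  nra.
have low : (size ws)%:R * (expR (- (a1 * kap)) * (c / 2 * (Num.sqrt s ^+ n)^-1)) <= \sum_(w <- ws) T w.
  apply: size_mul_le_sum => w ww.
  apply: le_trans (Tge w ww); apply: ler_wpM2l; first exact: expR_ge0.
  by apply: ler_wpM2l (Plow w ww); rewrite divr_ge0// ltW.
have a1k : a1 * kap = 3 * e * n%:R.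
  have -> : a1 * kap = 6 * e * h by rewrite /a1 /kap hE; ring.
  by rewrite /h; field.
have sa2 : Num.sqrt (q / x) ^+ n = Num.sqrt s ^+ n / Num.sqrt a2 ^+ n.
  apply: (mulIf (lt0r_neq0 sq2)); rewrite divfK ?gt_eqF// -sqrtM_exp; last by rewrite divr_ge0 ?ltW.
  by congr (Num.sqrt _ ^+ n); rewrite /a2 /y; field; rewrite !gt_eqF.
rewrite a1k in low; rewrite sa2.
have ga : gsum G a2 0 <= c * (9 / 8) / Num.sqrt a2 ^+ n by rewrite ler_pdivlMr// mulrC.
have := le_trans low (le_trans Tsum (ler_wpM2l A0 ga)).
rewrite expRN; set E := expR _; have E0 : 0 < E by rewrite expR_gt0.
set r := Num.sqrt s ^+ n in sqs *; set r2 := Num.sqrt a2 ^+ n in sq2 *.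
rewrite [leLHS](_ : _ = (size ws)%:R * (c / (2 * E * r))); last by field; rewrite !gt_eqF.
rewrite -ler_pdivlMr; last by rewrite divr_gt0// !mulr_gt0.
move=> H; apply: le_trans H _.
rewrite [leLHS](_ : _ = 9 / 4 * (A * E * (r / r2))); last by field; rewrite !gt_eqF.
rewrite [leRHS](_ : _ = 3 * (A * E * (r / r2))); last by ring.
by apply: ler_wpM2r; [rewrite !mulr_ge0// ?invr_ge0 ltW|lra].
Qed.

End Averaging.

(** * Hermite kernels *)

Section SequenceAlgebra.
Variable R : realType.
Implicit Types f g : nat -> R.

(* Sequences are treated as formal power series: [conv] is the product,
   [shift] multiplication by the variable, [weight] the Euler derivation. *)
Definition conv f g (j : nat) : R := \sum_(k < j.+1) f k * g (j - k)%N.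
Definition shift f (j : nat) : R := if j is j'.+1 then f j' else 0.
Definition weight f (j : nat) : R := j%:R * f j.

Lemma conv_shiftl f g j : conv (shift f) g j = shift (conv f g) j.
Proof.
case: j => [|j]; first by rewrite /conv big_ord1 mul0r.
rewrite /conv big_ord_recl /= mul0r add0r; apply: eq_bigr => k _.
by rewrite /bump/= add1n subSS.
Qed.

Lemma conv_shiftr f g j : conv f (shift g) j = shift (conv f g) j.
Proof.
case: j => [|j]; first by rewrite /conv big_ord1 mulr0.
rewrite /conv big_ord_recr /= subnn mulr0 addr0; apply: eq_bigr => k _.
by rewrite subSn// -ltnS.
Qed.

Lemma conv_weight f g j :
  weight (conv f g) j = conv (weight f) g j + conv f (weight g) j.
Proof.
rewrite /weight /conv mulr_sumr -big_split; apply: eq_bigr => k _ /=.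
have : j%:R = k%:R + (j - k)%:R :> R by rewrite -natrD subnKC// -ltnS.
by move=> ->; ring.
Qed.

Lemma convDl f f' g j : conv (fun k => f k + f' k) g j = conv f g j + conv f' g j.
Proof. by rewrite /conv -big_split; apply: eq_bigr => k _; rewrite mulrDl. Qed.

Lemma convDr f g g' j : conv f (fun k => g k + g' k) j = conv f g j + conv f g' j.
Proof. by rewrite /conv -big_split; apply: eq_bigr => k _; rewrite mulrDr. Qed.

Lemma convZl f g c j : conv (fun k => c * f k) g j = c * conv f g j.
Proof. by rewrite /conv mulr_sumr; apply: eq_bigr => k _; rewrite mulrA. Qed.

Lemma convZr f g c j : conv f (fun k => c * g k) j = c * conv f g j.
Proof. by rewrite /conv mulr_sumr; apply: eq_bigr => k _; rewrite mulrCA. Qed.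

Lemma conv_shift2l f g j : conv (shift (shift f)) g j = shift (shift (conv f g)) j.
Proof. rewrite conv_shiftl; case: j => //= j; exact: conv_shiftl. Qed.

Lemma conv_shift2r f g j : conv f (shift (shift g)) j = shift (shift (conv f g)) j.
Proof. rewrite conv_shiftr; case: j => //= j; exact: conv_shiftr. Qed.

Lemma shift2D f g j :
  shift (shift (fun k => f k + g k)) j = shift (shift f) j + shift (shift g) j.
Proof. by case: j => [|[|j]] //=; rewrite addr0. Qed.

End SequenceAlgebra.

Section HermiteKernels.
Variable R : realType.
Implicit Types (x y : nat -> R).

(* Probabilists' Hermite polynomials. *)
Fixpoint hermite2 (k : nat) (x : R) : R * R :=
  if k is k'.+1 then
    let p := hermite2 k' x in (p.2, x * p.2 - k'.+1%:R * p.1)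
  else (1, x).

Definition hermite k (x : R) : R := (hermite2 k x).1.

Lemma hermiteSS k (x : R) :
  hermite k.+2 x = x * hermite k.+1 x - k.+1%:R * hermite k x.
Proof. by []. Qed.

Definition kernel1 (x y : R) k : R := hermite k x * hermite k y / k`!%:R.
Definition cross1 (x y : R) k : R :=
  (hermite k x * hermite k.+2 y + hermite k.+2 x * hermite k y) / k`!%:R.

Fixpoint kernel n x y : nat -> R :=
  if n is n'.+1 then conv (kernel1 (x n') (y n')) (kernel n' x y)
  else fun j => (j == 0)%:R.

Fixpoint cross n x y : nat -> R :=
  if n is n'.+1 then
    fun j => conv (cross1 (x n') (y n')) (kernel n' x y) j +
             conv (kernel1 (x n') (y n')) (cross n' x y) j
  else fun=> 0.

Definition inner n x y : R := \sum_(l < n) x l * y l.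

Lemma inner0 x y : inner 0 x y = 0.
Proof. by rewrite /inner big_ord0. Qed.

Lemma innerS n x y : inner n.+1 x y = inner n x y + x n * y n.
Proof. by rewrite /inner big_ord_recr. Qed.

Lemma fact_natrS k : k.+1`!%:R = k.+1%:R * k`!%:R :> R.
Proof. by rewrite factS natrM. Qed.

Lemma fact_neq0 k : k`!%:R != 0 :> R.
Proof. by rewrite pnatr_eq0 -lt0n fact_gt0. Qed.

(** Expand [x H_k(x) = H_(k+1)(x) + k H_(k-1)(x)] in both variables. The equal-degree products give
    kernels of the two neighbouring degrees, the mixed products give [cross1]. *)
Lemma kernel1_mul (x y : R) j : x * y * shift (kernel1 x y) j =
  weight (kernel1 x y) j +
  shift (shift (fun k => weight (kernel1 x y) k + kernel1 x y k)) j +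
  shift (shift (cross1 x y)) j.
Proof.
case: j => [|[|j]] /=; rewrite /weight /kernel1 /cross1.
- by rewrite mulr0 mul0r !addr0.
- by rewrite /hermite/= !fact0 (_ : 1`! = 1)%N//; ring.
rewrite !hermiteSS (fact_natrS j.+1) (fact_natrS j).
have f0 := fact_neq0 j.
have e2 : j.+2%:R = j%:R + 1 + 1 :> R by rewrite !natr1.
have e1 : j.+1%:R = j%:R + 1 :> R by rewrite natr1.
have j1 : j%:R + 1 != 0 :> R by rewrite natr1 pnatr_eq0.
have j2 : j%:R + 1 + 1 != 0 :> R by rewrite !natr1 pnatr_eq0.
rewrite e2 e1; field.
by rewrite f0 j1 j2.
Qed.

(** This is the expansion of [(x ^ 2 + y ^ 2) H_k(x) H_k(y)]. Mixed terms, which are not positive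
    semidefinite by themselves, become multiples of the kernel when paired two degrees apart, since
    [x ^ 2 + y ^ 2] turns into a constant on a sphere. *)
Lemma cross1_rec (x y : R) j : cross1 x y j + shift (shift (cross1 x y)) j =
  (x ^+ 2 + y ^+ 2 - 2) * kernel1 x y j - 4 * weight (kernel1 x y) j.
Proof.
case: j => [|[|j]] /=; rewrite /weight /kernel1 /cross1.
- by rewrite /hermite/= !fact0; field.
- by rewrite /hermite/= (_ : 1`! = 1)%N//; field.
rewrite !hermiteSS (fact_natrS j.+1) (fact_natrS j).
have f0 := fact_neq0 j.
have e2 : j.+2%:R = j%:R + 1 + 1 :> R by rewrite !natr1.
have e1 : j.+1%:R = j%:R + 1 :> R by rewrite natr1.
have j1 : j%:R + 1 != 0 :> R by rewrite natr1 pnatr_eq0.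
have j2 : j%:R + 1 + 1 != 0 :> R by rewrite !natr1 pnatr_eq0.
rewrite e2 e1; field.
by rewrite f0 j1 j2.
Qed.

Lemma eq_conv (f f' g g' : nat -> R) j : f =1 f' -> g =1 g' -> conv f g j = conv f' g' j.
Proof. by move=> ff gg; apply: eq_bigr => k _; rewrite ff gg. Qed.

Lemma kernel_mul n x y j : inner n x y * shift (kernel n x y) j =
  weight (kernel n x y) j +
  shift (shift (fun k => weight (kernel n x y) k + n%:R * kernel n x y k)) j +
  shift (shift (cross n x y)) j.
Proof.
elim: n j => [|n IH] j.
  rewrite inner0 mul0r; case: j => [|[|j]] /=; rewrite /weight/=.
  - by rewrite mul0r !addr0.
  - by rewrite mulr0 !addr0.
  - by case: j => [|j] /=; rewrite !(mul0r, mulr0, addr0).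
set f := kernel1 (x n) (y n); set g := kernel n x y.
have sE (h : nat -> R) : shift (shift h) = fun j => shift (fun k => shift h k) j by [].
have e1 : (inner n x y + x n * y n) * shift (conv f g) j =
   conv f (fun k => inner n x y * shift g k) j + conv (fun k => x n * y n * shift f k) g j.
  by rewrite convZl convZr conv_shiftl conv_shiftr mulrDl.
rewrite innerS /= -/f -/g e1.
rewrite (eq_conv _ (f' := f) (g' := fun k => weight g k +
  shift (shift (fun k => weight g k + n%:R * g k)) k + shift (shift (cross n x y)) k))//.
rewrite (eq_conv _ (f := fun k => x n * y n * shift f k) (f' := fun k => weight f k +
  shift (shift (fun k => weight f k + f k)) k + shift (shift (cross1 (x n) (y n))) k) (g' := g))//; last first.
  by move=> k; rewrite kernel1_mul.
rewrite !convDl !convDr conv_weight.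
rewrite !conv_shift2l !conv_shift2r.
have sh2 (a b : nat -> R) : a =1 b -> shift (shift a) j = shift (shift b) j by move=> /funext ->.
rewrite shift2D.
rewrite (sh2 _ _ (convDr f (weight g) (fun k => n%:R * g k))) shift2D.
rewrite (sh2 _ _ (convDl (weight f) f g)) shift2D.
rewrite (sh2 _ (fun k => n%:R * conv f g k) (fun k => convZr f g n%:R k)).
rewrite [in RHS]shift2D (sh2 _ _ (fun k => conv_weight f g k)) shift2D.
have -> : shift (shift (fun k => n.+1%:R * conv f g k)) j =
    shift (shift (fun k => n%:R * conv f g k)) j + shift (shift (conv f g)) j.
  by rewrite -shift2D; apply: sh2 => k; rewrite -natr1 mulrDl mul1r.
ring.
Qed.

Lemma cross_rec n x y j : cross n x y j + shift (shift (cross n x y)) j =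
  (inner n x x + inner n y y - 2 * n%:R) * kernel n x y j - 4 * weight (kernel n x y) j.
Proof.
elim: n j => [|n IH] j.
  rewrite !inner0 /weight/= mulr0 addr0 subr0 mul0r.
  by case: j => [|[|j]] /=; rewrite ?mul0r ?mulr0 ?addr0 ?subr0.
set f := kernel1 (x n) (y n); set g := kernel n x y.
rewrite /= -/f -/g shift2D -conv_shift2l -conv_shift2r !innerS conv_weight.
have h1 : conv (cross1 (x n) (y n)) g j + conv (shift (shift (cross1 (x n) (y n)))) g j =
   ((x n) ^+ 2 + (y n) ^+ 2 - 2) * conv f g j - 4 * conv (weight f) g j.
  rewrite -mulNr -!convZl -!convDl.
  by apply: eq_conv => // k; rewrite cross1_rec mulNr.
have h2 : conv f (cross n x y) j + conv f (shift (shift (cross n x y))) j =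
   (inner n x x + inner n y y - 2 * n%:R) * conv f g j - 4 * conv f (weight g) j.
  rewrite -convDr.
  transitivity (conv f (fun k => (inner n x x + inner n y y - 2 * n%:R) * g k + - 4 * weight g k) j).
    by apply: eq_bigr => k _; rewrite IH mulNr.
  by rewrite convDr !convZr mulNr.
rewrite addrACA h1 h2 -natr1; ring.
Qed.

Lemma kernel0 n x y : kernel n x y 0 = 1.
Proof.
elim: n => [|n IH]//=.
by rewrite /conv big_ord1 IH /kernel1 /hermite/= fact0 divr1 !mulr1.
Qed.

(* Four consecutive zeros would propagate down to [kernel n x x 0 = 1]. *)
Lemma kernel_diag_neq0 n x j : (0 < n)%N ->
  kernel n x x j = 0 -> kernel n x x j.+1 = 0 ->
  kernel n x x j.+2 = 0 -> kernel n x x j.+3 = 0 -> False.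
Proof.
move=> n0; elim: j => [|j IH] k0 k1 k2 k3.
  by move: k0; rewrite kernel0 => /eqP; rewrite oner_eq0.
have c2 : cross n x x j.+2 = 0.
  have := kernel_mul n x x j.+4; rewrite /= /weight k3 k2 k1.
  by rewrite !mulr0 !addr0 add0r => ->.
have c0 : cross n x x j = 0.
  by have := cross_rec n x x j.+2; rewrite /= c2 /weight k1 !mulr0 subr0 add0r.
apply: IH => //.
have := kernel_mul n x x j.+2; rewrite /= /weight c0 k0 k1 !mulr0 add0r addr0.
rewrite -mulrDl -natrD => /esym/eqP; rewrite mulf_eq0 pnatr_eq0 => /orP[|/eqP//].
by rewrite addn_eq0 (gtn_eqF n0) andbF.
Qed.

Fixpoint features n (j : nat) : seq ((nat -> R) -> R) :=
  if n is n'.+1 then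
    flatten [seq [seq (fun v => hermite k (v n') / Num.sqrt (k`!%:R) * f v) |
       f <- features n' (j - k)] | k <- index_iota 0 j.+1]
  else if j is 0%N then [:: fun=> 1] else [::].

Lemma kernelS n x y : kernel n.+1 x y = conv (kernel1 (x n) (y n)) (kernel n x y).
Proof. by []. Qed.

Lemma featuresS n j : features n.+1 j =
  flatten [seq [seq (fun v => hermite k (v n) / Num.sqrt (k`!%:R) * f v) |
       f <- features n (j - k)] | k <- index_iota 0 j.+1].
Proof. by []. Qed.

Lemma kernel_features n x y j : kernel n x y j = \sum_(f <- features n j) f x * f y.
Proof.
elim: n j => [|n IH] j.
  by case: j => [|j] /=; rewrite ?big_seq1 ?mulr1// big_nil.
rewrite featuresS kernelS /conv.
rewrite big_flatten big_map big_mkord; apply: eq_bigr => k _.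
rewrite big_map IH mulr_sumr; apply: eq_bigr => f _.
have e : (k`!%:R : R)^-1 = (Num.sqrt k`!%:R)^-1 * (Num.sqrt k`!%:R)^-1.
  by rewrite -invfM -expr2 sqr_sqrtr.
by rewrite /kernel1 e; ring.
Qed.

(** The numbers of features of degree [j] have generating series [(1 - X)^(-n)], and a single term
    is at most the whole series. *)
Lemma size_features (X : R) n j : 0 < X -> X < 1 ->
  (size (features n j))%:R * X ^+ j * (1 - X) ^+ n <= 1.
Proof.
move=> X0 X1; elim: n j => [|n IH] j.
  by case: j => [|j] /=; rewrite ?expr0 ?mulr1// !mul0r.
rewrite featuresS size_flatten /shape -map_comp sumnE big_map big_mkord natr_sum.
rewrite -mulrA mulr_suml.
apply: (@le_trans _ _ (\sum_(k < j.+1) X ^+ k * (1 - X))); last first.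
  rewrite -mulr_suml; have := subrX1 X j.+1.
  rewrite -[X - 1]opprB mulNr mulrC => /(congr1 -%R); rewrite opprK => <-.
  by rewrite opprB gerBl exprn_ge0// ltW.
apply: ler_sum => k _ /=; rewrite size_map.
have kj : (k <= j)%N by rewrite -ltnS.
have -> : X ^+ j = X ^+ (j - k) * X ^+ k by rewrite -exprD subnK.
rewrite exprSr.
set s := (size _)%:R; set A := X ^+ (j - k); set B := X ^+ k; set C := (1 - X) ^+ n.
rewrite (_ : s * (A * B * (C * (1 - X))) = s * A * C * (B * (1 - X))); last by ring.
have BX : 0 <= B * (1 - X) by rewrite mulr_ge0 ?exprn_ge0 ?subr_ge0 ?(ltW X0) ?(ltW X1).
by rewrite ler_piMl// IH.
Qed.

End HermiteKernels.

(** * The spherical code bound *)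

Section SphericalCode.
Variable R : realType.

(** The Schur product theorem made explicit: the entrywise product of two Gram matrices gives a sum
    of squares. *)
Lemma gram_hadamard (N : nat) (T : Type) (F G : seq (T -> R)) (c : 'I_N -> R) (X : 'I_N -> T) :
  \sum_a \sum_b c a * c b * ((\sum_(f <- F) f (X a) * f (X b)) * (\sum_(g <- G) g (X a) * g (X b))) =
  \sum_(f <- F) \sum_(g <- G) (\sum_a c a * f (X a) * g (X a)) ^+ 2.
Proof.
under eq_bigr => a _ do under eq_bigr => b _ do
  (rewrite big_distrlr/= mulr_sumr; under eq_bigr => f _ do rewrite mulr_sumr).
under eq_bigr => a _ do rewrite exchange_big/=.
rewrite exchange_big/=; apply: eq_bigr => f _.
under eq_bigr => a _ do rewrite exchange_big/=.
rewrite exchange_big/=; apply: eq_bigr => g _.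
rewrite expr2 big_distrlr/=; apply: eq_bigr => a _; apply: eq_bigr => b _.
ring.
Qed.

Lemma cauchy_schwarz_seq (T : Type) (s : seq T) (x : T -> R) :
  (\sum_(i <- s) x i) ^+ 2 <= (size s)%:R * \sum_(i <- s) x i ^+ 2.
Proof.
elim: s => [|i s IH]; first by rewrite !big_nil expr0n mul0r.
rewrite !big_cons /= -nat1r.
set A := \sum_(j <- s) x j in IH *; set B := \sum_(j <- s) _ in IH *.
set d := (size s)%:R in IH *.
have d0 : 0 <= d by rewrite ler0n.
have [d1|d1] := eqVneq d 0.
  have A0 : A = 0 by move: IH; rewrite d1 mul0r => h; apply/eqP; rewrite -sqrf_eq0 eq_le h sqr_ge0.
  have B0 : 0 <= B by apply: sumr_ge0 => j _; exact: sqr_ge0.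
  by rewrite d1 A0; nra.
have d2 : 0 < d by rewrite lt_neqAle eq_sym d1.
have h := sqr_ge0 (A - d * x i).
have : 2 * A * x i <= B + d * x i ^+ 2.
  rewrite -(ler_pM2l d2); nra.
nra.
Qed.

Lemma sum_shift (J : nat) (a h : nat -> R) : (forall j, (J <= j)%N -> a j = 0) ->
  \sum_(j < J) a j * shift h j = \sum_(j < J) a j.+1 * h j.
Proof.
case: J => [|J] aJ; first by rewrite !big_ord0.
rewrite big_ord_recl /= mulr0 add0r big_ord_recr/= aJ// mul0r addr0.
by apply: eq_bigr => j _; rewrite /bump/= add1n.
Qed.

(** The second difference of the parabola [l * (m + 1 - l)] is [-2]. *)
Lemma parabola_rec (m l : nat) : (0 < l)%N -> (l <= m)%N ->
  (l.-1 * (m.+1 - l.-1) + l.+1 * (m.+1 - l.+1) + 2 = 2 * (l * (m.+1 - l)))%N.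
Proof.
case: l => // l _ lm; have [r ->] : exists r, m = (l.+1 + r)%N by exists (m - l.+1)%N; lia.
have -> : ((l.+1 + r).+1 - l.+1.-1 = r.+2)%N by rewrite /=; lia.
have -> : ((l.+1 + r).+1 - l.+2 = r)%N by lia.
have -> : ((l.+1 + r).+1 - l.+1 = r.+1)%N by lia.
by rewrite /=; lia.
Qed.

Lemma diag_le_double_sum (T : Type) (s : seq T) (G : T -> T -> R) :
  (forall x y, 0 <= G x y) ->
  \sum_(x <- s) G x x <= \sum_(x <- s) \sum_(y <- s) G x y.
Proof.
move=> G0; rewrite big_tnth [leRHS]big_tnth; apply: ler_sum => k _.
rewrite big_tnth (bigD1 k)//= lerDl; apply: sumr_ge0 => l _; exact: G0.
Qed.

Variables (n i m : nat).
Hypotheses (n0 : (0 < n)%N) (i2 : (2 <= i)%N) (m2 : (2 <= m)%N).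

(** Near degree [i] the recurrence for multiplication by the inner product has coefficients about
    [i] and [n + i]. Their geometric mean is [g]; [2 * g] is the top of the spectrum of the
    symmetrized recurrence, and a window of length [m] reaches it up to the relative loss
    [1 / m]. *)
Let g : R := Num.sqrt (i%:R * (n%:R + i%:R)).
Let q : R := Num.sqrt (i%:R / (n%:R + i%:R)).
Let lam : R := g * (2 - 2 / m%:R).
Let p (l : nat) : nat := (l * (m.+1 - l))%N.

(* Coefficients supported on a window above [i]: a geometric sequence that
   symmetrizes the recurrence, damped by a parabola. *)
Let b (k : nat) : R := if (k < i)%N then 0 else q ^+ (k - i) * (p (k - i))%:R.
(** Coefficients of the final kernel. The sum of two neighbours of [b] makes mixed terms appear only
    as [b j] times [cross] in degrees [j] and [j - 2] together, the combination that [cross_rec]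
    evaluates. *)
Let w (j : nat) : R := shift b j + b j.+1.

Let iR : 0 < i%:R :> R. Proof. by rewrite ltr0n; lia. Qed.
Let niR : 0 < n%:R + i%:R :> R. Proof. by rewrite addr_gt0 ?ltr0n//; lia. Qed.
Let q_gt0 : 0 < q. Proof. by rewrite sqrtr_gt0 divr_gt0. Qed.
Let g_gt0 : 0 < g. Proof. by rewrite sqrtr_gt0 mulr_gt0. Qed.

Let niq : (n%:R + i%:R) * q = g.
Proof.
apply/eqP; rewrite -(@eqrXn2 _ 2)//; [|by apply: mulr_ge0; exact: ltW|exact: ltW].
rewrite exprMn sqr_sqrtr; last by rewrite divr_ge0// ltW.
rewrite sqr_sqrtr; last by apply: mulr_ge0; exact: ltW.
by apply/eqP; field; rewrite gt_eqF.
Qed.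

Let gq : g * q = i%:R.
Proof.
rewrite -niq -mulrA -expr2 sqr_sqrtr; last by rewrite divr_ge0// ltW.
by rewrite mulrC divfK// gt_eqF.
Qed.

Let b_ge0 k : 0 <= b k.
Proof. by rewrite /b; case: ifP => // _; rewrite mulr_ge0// exprn_ge0// ltW. Qed.

Let w_ge0 j : 0 <= w j.
Proof. by rewrite addr_ge0//; case: j. Qed.

Let b_eq0 k : (i + m < k)%N -> b k = 0.
Proof.
move=> h; rewrite /b ifF; last by lia.
rewrite /p (_ : m.+1 - (k - i) = 0)%N ?muln0 ?mulr0//; lia.
Qed.

Let b_gt0 k : (i < k)%N -> (k <= i + m)%N -> 0 < b k.
Proof.
move=> h1 h2; rewrite /b ifF; last by lia.
by rewrite mulr_gt0 ?exprn_gt0// ltr0n /p muln_gt0; apply/andP; split; lia.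
Qed.

Let w_eq0 j : (j < i)%N || (i + m.+1 < j)%N -> w j = 0.
Proof.
move=> h; rewrite /w; suff [-> ->] : shift b j = 0 /\ b j.+1 = 0 by rewrite addr0.
case/orP: h => h.
  split; last first.
    rewrite /b; case: ifP => // h'; have -> : (j.+1 - i = 0)%N by lia.
    by rewrite /p mul0n mulr0.
  by case: j h => //= j h; rewrite /b ifT//; lia.
by split; [case: j h => //= j h|]; rewrite b_eq0//; lia.
Qed.

(** Four consecutive positive coefficients, as many as [kernel_diag_neq0] requires for a positive
    diagonal. *)
Let w_gt0 j : (i <= j)%N -> (j <= i + 3)%N -> 0 < w j.
Proof.
move=> h1 h2; rewrite /w; have [h|h] := leqP j i.+1.
  by apply: ltr_wpDl; [case: j {h h1 h2} => //|apply: b_gt0; lia].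
by case: j h h1 h2 => // j h h1 h2 /=; apply: ltr_wpDr => //; apply: b_gt0; lia.
Qed.

(** On the window [j] may be lowered to [i]. The geometric factor then makes both neighbours enter
    with the same weight [g * q], and the parabola loses [2] out of [2 * p l], where [p l >= m]. *)
Let b_rec j k : (k <= j.+1)%N ->
  lam * b k <= j%:R * shift b k + (n%:R + j%:R) * b k.+1.
Proof.
move=> kj; have rhs0 : 0 <= j%:R * shift b k + (n%:R + j%:R) * b k.+1.
  by rewrite addr_ge0 ?mulr_ge0 ?addr_ge0//; case: (k).
have [bk|bk] := eqVneq (b k) 0; first by rewrite bk mulr0.
have ik : (i < k)%N.
  rewrite ltn_neqAle andbC leqNgt; apply/andP; split.
    by apply: contra bk => h; rewrite /b h.
  by apply: contra bk => /eqP <-; rewrite /b ltnn subnn /p mul0n mulr0.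
have km : (k <= i + m)%N by rewrite leqNgt; apply: contra bk => /b_eq0 ->.
pose l := (k - i)%N.
have l1 : (0 < l)%N by rewrite /l; lia.
have lm : (l <= m)%N by rewrite /l; lia.
have kE : k = (i + l.-1).+1 by rewrite /l; lia.
have bk' : b k = q ^+ l.-1 * q * (p l)%:R.
  rewrite /b ifF; last by lia.
  by rewrite -/l -exprSr prednK.
have bkm : shift b k = q ^+ l.-1 * (p l.-1)%:R.
  by rewrite {1}kE /= /b ifF; [congr (q ^+ _ * (p _)%:R)|]; lia.
have bkp : b k.+1 = q ^+ l.-1 * q ^+ 2 * (p l.+1)%:R.
  rewrite /b ifF; last by lia.
  by rewrite -exprD; congr (q ^+ _ * (p _)%:R); rewrite /l; lia.
rewrite bk' bkm bkp.
have ij : i%:R <= j%:R :> R by rewrite ler_nat; lia.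
have Q0 : 0 < q ^+ l.-1 by rewrite exprn_gt0.
apply: (@le_trans _ _ (i%:R * (q ^+ l.-1 * (p l.-1)%:R) + (n%:R + i%:R) * (q ^+ l.-1 * q ^+ 2 * (p l.+1)%:R))); last first.
  apply: lerD; apply: ler_wpM2r.
  - by rewrite mulr_ge0// ltW.
  - exact: ij.
  - by rewrite !mulr_ge0// ?sqr_ge0// ltW.
  - by rewrite lerD2l.
have -> : i%:R * (q ^+ l.-1 * (p l.-1)%:R) + (n%:R + i%:R) * (q ^+ l.-1 * q ^+ 2 * (p l.+1)%:R) =
   g * q * q ^+ l.-1 * ((p l.-1)%:R + (p l.+1)%:R).
  rewrite -[in i%:R * _]gq -[in RHS]niq -[in LHS]niq; ring.
have -> : lam * (q ^+ l.-1 * q * (p l)%:R) = g * q * q ^+ l.-1 * ((2 - 2 / m%:R) * (p l)%:R).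
  by rewrite /lam; ring.
apply: ler_wpM2l; first by rewrite !mulr_ge0// ltW.
have mR : 0 < m%:R :> R by rewrite ltr0n; lia.
have pm : m%:R <= (p l)%:R :> R by rewrite ler_nat /p; nia.
have pp : (p l.-1)%:R + (p l.+1)%:R = 2 * (p l)%:R - 2 :> R.
  apply/eqP; rewrite -(inj_eq (addIr 2)) subrK -!natrD -natrM eqr_nat /p; apply/eqP.
  exact: parabola_rec.
rewrite pp mulrBl; have : 1 <= (p l)%:R / m%:R :> R by rewrite ler_pdivlMr// mul1r.
lra.
Qed.

Variables (N : nat) (X : 'I_N -> nat -> R) (rho sigma z : R).
Hypotheses (hrho : n%:R + 2 * (i + m)%:R <= rho).
Hypotheses (Xrho : forall a, inner n (X a) (X a) = rho).
Hypotheses (Xsig : forall a a', a != a' -> inner n (X a) (X a') <= sigma).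
Hypotheses (siglam : sigma < lam) (z0 : 0 < z) (z1 : z < 1).

Let J := (i + m + 5)%N.
Let kk a a' := kernel n (X a) (X a').
Let K a a' := \sum_(j < J) w j * kk a a' j.
(** Coefficients of the inner product times [K] on the sphere of squared radius [rho], mixed terms
    eliminated. The last summand is nonnegative by [hrho]; the first two dominate [lam * w j] by
    [b_rec] at [j - 1] and [j + 1]. *)
Let C (j : nat) : R := j%:R * shift w j + (n%:R + j%:R) * w j.+1 + b j * (2 * rho - 2 * n%:R - 4 * j%:R).

Let bJ j : (J <= j)%N -> b j = 0.
Proof. by rewrite /J => h; apply: b_eq0; lia. Qed.

Let wJ j : (i + m + 2 <= j)%N -> w j = 0.
Proof. by move=> h; apply: w_eq0; apply/orP; right; lia. Qed.

Let inner_K a a' : inner n (X a) (X a') * K a a' = \sum_(j < J) C j * kk a a' j.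
Proof.
set t := inner _ _ _; pose u j := shift w j.
have uJ j : (J <= j)%N -> u j = 0.
  by case: j => [|j] // h; rewrite /u /= wJ//; move: h; rewrite /J; lia.
have uJ1 j : (J <= j)%N -> u j.+1 = 0.
  by move=> h; rewrite /u /= wJ//; move: h; rewrite /J; lia.
have -> : t * K a a' = \sum_(j < J) u j * (t * shift (kk a a') j).
  under [RHS]eq_bigr => j _ do rewrite mulrCA.
  by rewrite -mulr_sumr sum_shift.
under eq_bigr => j _ do rewrite kernel_mul !mulrDr.
rewrite !big_split/= !sum_shift//.
have e1 : \sum_(j < J) u j.+2 * cross n (X a) (X a') j =
   \sum_(j < J) b j * ((2 * rho - 2 * n%:R) * kk a a' j - 4 * weight (kk a a') j).
  under eq_bigr => j _ do rewrite /u /= /w /= mulrDl.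
  have bJ1 j : (J <= j)%N -> b j.+1 = 0 by move=> h; apply: bJ; lia.
  rewrite big_split/= -(sum_shift (a := fun j => b j.+1))// -sum_shift// -big_split/=.
  apply: eq_bigr => j _; rewrite -mulrDr cross_rec !Xrho; congr (_ * _).
  by rewrite /kk; ring.
rewrite e1 -!big_split/=; apply: eq_bigr => j _.
by rewrite /C /u /= /weight -/(kk a a'); ring.
Qed.

Let C_ge j : lam * w j <= C j.
Proof.
have e0 : 0 <= b j * (2 * rho - 2 * n%:R - 4 * j%:R).
  have [bj|bj] := eqVneq (b j) 0; first by rewrite bj mul0r.
  apply: mulr_ge0 => //.
  have jm : (j <= i + m)%N by rewrite leqNgt; apply: contra bj => /b_eq0 ->.
  have : j%:R <= (i + m)%:R :> R by rewrite ler_nat.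
  by move: hrho; lra.
rewrite /C; case: j e0 => [|j] e0.
  rewrite /= mulr0 add0r {1}/w /= add0r.
  have -> : b 1 = 0 by rewrite /b ifT.
  by rewrite mulr0 addr_ge0// mulr_ge0// addr_ge0.
have h1 := @b_rec j.+1 j (leq_trans (leqnSn _) (leqnSn _)).
have h2 := @b_rec j.+1 j.+2 (leqnn _).
apply: ler_wpDr; first exact: e0.
rewrite /= /w /=; rewrite /= in h1 h2.
by rewrite (addrC (shift b j)); lra.
Qed.

Let feat : seq ((nat -> R) -> R) :=
  flatten [seq [seq (fun v => Num.sqrt (w j) * f v) | f <- features R n j] | j <- index_iota i (i + m.+2)].

Let K_feat a a' : K a a' = \sum_(f <- feat) f (X a) * f (X a').
Proof.
rewrite big_flatten big_map.
have -> : K a a' = \sum_(i <= j < i + m.+2) w j * kk a a' j.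
  rewrite /K -(big_mkord xpredT (fun j => w j * kk a a' j)) (big_cat_nat (n := i))//=; last by rewrite /J; lia.
  rewrite [X in X + _]big1_seq ?add0r; last first.
    by move=> j /andP[_]; rewrite mem_index_iota => /andP[_ h]; rewrite w_eq0 ?h// mul0r.
  rewrite (big_cat_nat (n := (i + m.+2)%N))//=; [|by lia|by rewrite /J; lia].
  rewrite [X in _ + X]big1_seq ?addr0// => j /andP[_]; rewrite mem_index_iota => /andP[h _].
  by rewrite wJ ?mul0r//; lia.
apply: eq_bigr => j _; rewrite big_map /kk kernel_features mulr_sumr.
apply: eq_bigr => f _; rewrite -{1}[w j]sqr_sqrtr//; ring.
Qed.

Let size_feat : (size feat)%:R * z ^+ (i + m.+1) * (1 - z) ^+ n <= m.+2%:R.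
Proof.
rewrite size_flatten /shape -map_comp sumnE big_map natr_sum !mulr_suml.
apply: (@le_trans _ _ (\sum_(i <= j < i + m.+2) 1)); last first.
  by rewrite sumr_const_nat addKn.
apply: ler_sum_nat => j /andP[ij jm] /=; rewrite size_map.
apply: le_trans (size_features n j z0 z1).
apply: ler_wpM2r; first by rewrite exprn_ge0// subr_ge0 ltW.
apply: ler_wpM2l => //; apply: ler_wiXn2l; [exact: ltW|exact: ltW|lia].
Qed.

Let K_diag_gt0 a : 0 < K a a.
Proof.
have k0 j : 0 <= kk a a j.
  by rewrite /kk kernel_features; apply: sumr_ge0 => f _; rewrite -expr2 sqr_ge0.
have wk0 j : 0 <= w j * kk a a j by rewrite mulr_ge0.
rewrite lt_neqAle eq_sym sumr_ge0// andbT; apply/negP.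
rewrite psumr_eq0// => /allP h.
have hz j : (i <= j)%N -> (j <= i + 3)%N -> kk a a j = 0.
  move=> h1 h2; have jJ : (j < J)%N by rewrite /J; lia.
  have := h (Ordinal jJ) (mem_index_enum _); rewrite /= mulf_eq0 gt_eqF ?w_gt0//=.
  by move=> /eqP.
have e k : (k <= 3)%N -> kk a a (k + i)%N = 0.
  by move=> k3; apply: hz; rewrite ?leq_addl// addnC leq_add2l.
exact: (@kernel_diag_neq0 R n (X a) i n0 (e 0%N isT) (e 1%N isT) (e 2%N isT) (e 3%N isT)).
Qed.

(** Let [S2] be the squared Hilbert-Schmidt norm of [K] normalized to unit diagonal. The rank bound
    gives [N ^ 2 <= D * S2]. The kernel [(inner - lam) * K] has nonnegative coefficients, so its
    entrywise product with [K] is positive; as off-diagonal inner products are at most [sigma], this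
    gives [(lam - sigma) * S2 <= N * (rho - sigma)]. Eliminating [S2] leaves a bound in terms of the
    number [D] of features. *)
Lemma spherical_code_bound :
  N%:R * (lam - sigma) * (z ^+ (i + m.+1) * (1 - z) ^+ n) <= m.+2%:R * (rho - sigma).
Proof.
pose c a := (K a a)^-1.
have c0 a : 0 < c a by rewrite invr_gt0.
have ls : 0 < lam - sigma by rewrite subr_gt0.
pose D := (size feat)%:R : R.
have zz0 : 0 < z ^+ (i + m.+1) * (1 - z) ^+ n by rewrite mulr_gt0 ?exprn_gt0 ?subr_gt0.
pose S2 := \sum_a \sum_a' c a * c a' * (K a a' * K a a').
(* trace versus Hilbert-Schmidt norm of a matrix of rank at most [size feat] *)
have low : N%:R ^+ 2 <= D * S2.
  have -> : N%:R = \sum_(f <- feat) \sum_a c a * f (X a) * f (X a).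
    rewrite exchange_big/= -[LHS](_ : \sum_(a < N) 1 = _); last by rewrite sumr_const card_ord.
    apply: eq_bigr => a _; under eq_bigr do rewrite -mulrA.
    by rewrite -mulr_sumr -K_feat mulVf// gt_eqF.
  apply: le_trans (cauchy_schwarz_seq _ _) _; apply: ler_wpM2l => //.
  rewrite /S2; under [leRHS]eq_bigr => a _ do under eq_bigr => a' _ do rewrite K_feat.
  rewrite gram_hadamard.
  by apply: (diag_le_double_sum feat (G := fun f f' => (\sum_a c a * f (X a) * f' (X a)) ^+ 2)) => f f'; exact: sqr_ge0.
have pos : 0 <= \sum_a \sum_a' c a * c a' * ((inner n (X a) (X a') - lam) * K a a' * K a a').
  have -> : \sum_a \sum_a' c a * c a' * ((inner n (X a) (X a') - lam) * K a a' * K a a') =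
     \sum_(j < J) (C j - lam * w j) * \sum_a \sum_a' c a * c a' * (kk a a' j * K a a').
    under [RHS]eq_bigr => j _ do
      (rewrite mulr_sumr; under eq_bigr => a _ do rewrite mulr_sumr).
    rewrite [RHS]exchange_big/=; apply: eq_bigr => a _; rewrite [RHS]exchange_big/=; apply: eq_bigr => a' _.
    have eK : lam * K a a' = \sum_(j < J) lam * (w j * kk a a' j) by rewrite /K mulr_sumr.
    rewrite mulrBl inner_K eK -sumrB mulr_suml mulr_sumr.
    by apply: eq_bigr => j _; ring.
  apply: sumr_ge0 => j _; apply: mulr_ge0; first by rewrite subr_ge0.
  under eq_bigr => a _ do under eq_bigr => a' _ do rewrite K_feat /kk kernel_features.
  rewrite gram_hadamard; apply: sumr_ge0 => f _; apply: sumr_ge0 => f' _; exact: sqr_ge0.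
have up : (lam - sigma) * S2 <= N%:R * (rho - sigma).
  apply: (@le_trans _ _ (\sum_a \sum_a' c a * c a' * ((inner n (X a) (X a') - sigma) * (K a a' * K a a')))).
    rewrite -subr_ge0; apply: le_trans pos _; rewrite /S2 mulr_sumr -sumrB.
    rewrite le_eqVlt; apply/orP; left; apply/eqP; apply: eq_bigr => a _.
    by rewrite mulr_sumr -sumrB; apply: eq_bigr => a' _; ring.
  apply: (@le_trans _ _ (\sum_(a < N) (rho - sigma))); last first.
    by rewrite sumr_const card_ord mulr_natl.
  apply: ler_sum => a _; rewrite (bigD1 a)//= Xrho.
  have -> : c a * c a * ((rho - sigma) * (K a a * K a a)) = rho - sigma.
    by rewrite /c; field; rewrite gt_eqF.
  rewrite gerDl; apply: sumr_le0 => a' aa'.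
  apply: mulr_ge0_le0; first by rewrite mulr_ge0// ltW.
  apply: mulr_le0_ge0; first by rewrite subr_le0 Xsig// eq_sym.
  by rewrite -expr2 sqr_ge0.
have rs : 0 <= rho - sigma.
  suff : lam <= rho by move: siglam; lra.
  apply: (@le_trans _ _ (2 * g)).
    rewrite /lam mulrC ler_pM2r// gerBl divr_ge0//.
  apply: le_trans hrho; apply: (@le_trans _ _ (n%:R + 2 * i%:R)); last first.
    by rewrite lerD2l ler_pM2l// ler_nat leq_addr.
  have g2 : g ^+ 2 = i%:R * (n%:R + i%:R) by rewrite sqr_sqrtr// ltW// mulr_gt0.
  have m0 : 0 <= m%:R :> R by [].
  have n0' : 0 <= n%:R :> R by [].
  rewrite -(@ler_pXn2r _ 2)// ?nnegrE; last 2 first.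
  - by rewrite mulr_ge0// ltW.
  - by rewrite addr_ge0// mulr_ge0.
  rewrite exprMn g2 -subr_ge0 [leRHS](_ : _ = n%:R ^+ 2) ?sqr_ge0//.
  by ring.
have h1 : N%:R * (lam - sigma) <= D * (rho - sigma).
  have [->|N0] := eqVneq N 0%N; first by rewrite mul0r mulr_ge0.
  have NR : 0 < N%:R :> R by rewrite ltr0n lt0n.
  rewrite -(ler_pM2l NR); apply: (@le_trans _ _ ((lam - sigma) * (D * S2))).
    rewrite [leLHS](_ : _ = (lam - sigma) * N%:R ^+ 2); last by ring.
    by rewrite ler_pM2l.
  rewrite mulrCA [leRHS]mulrCA; apply: ler_wpM2l => //; exact: ler0n.
apply: (@le_trans _ _ (D * (rho - sigma) * (z ^+ (i + m.+1) * (1 - z) ^+ n))).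
  by rewrite ler_pM2r.
rewrite mulrAC; apply: ler_wpM2r => //.
by rewrite mulrA size_feat.
Qed.

End SphericalCode.

(** * Numerical estimates *)

Section Numerics.
Variable R : realType.

Lemma expR_ge_partial (x : R) (N : nat) : 0 <= x ->
  \sum_(k < N) x ^+ k / k`!%:R <= expR x.
Proof.
move=> x0; rewrite -(big_mkord xpredT (fun k => x ^+ k / k`!%:R)).
have -> : \sum_(0 <= k < N) x ^+ k / k`!%:R = series (exp_coeff x) N by [].
apply: nondecreasing_cvgn_le; last exact: is_cvg_series_exp_coeff.
apply/nondecreasing_seqP => k; rewrite /series/= big_nat_recr//= lerDl.
by rewrite /exp_coeff/= divr_ge0// exprn_ge0.
Qed.

Lemma cos_coeff_pair_gt0 (x : R) (N : nat) : (0 < N)%N -> ~~ odd N -> 0 < x < 2 ->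
  0 < cos_coeff' x N + cos_coeff' x N.+1.
Proof.
move=> N0 oN /andP[x0 x2]; rewrite /cos_coeff' -!exprnP exprS -signr_odd (negbTE oN) expr0.
rewrite doubleS (factS N.*2.+1) (factS N.*2) !natrM !exprSr.
set X := x ^+ N.*2; set F := N.*2`!%:R.
have X0 : 0 < X by rewrite exprn_gt0.
have F0 : 0 < F by rewrite ltr0n fact_gt0.
set A := N.*2.+2%:R; set B := N.*2.+1%:R.
have A0 : 2 < A by rewrite /A -[2]/(2%:R) ltr_nat; lia.
have B0 : 2 < B by rewrite /B -[2]/(2%:R) ltr_nat; lia.
have A0' : A != 0 by rewrite gt_eqF//; apply: lt_trans A0.
have B0' : B != 0 by rewrite gt_eqF//; apply: lt_trans B0.
clearbody A B X F.
have -> : 1 * X / F + -1 * 1 * (X * x * x) / (A * (B * F)) = X / F * ((A * B - x * x) / (A * B)).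
  by field; rewrite A0' B0' gt_eqF.
have AB : 4 < A * B by nra.
rewrite mulr_gt0 ?divr_gt0//; [by nra|by lra].
Qed.

(** Here [u] stands for the square of a number just below [pi / 2]. In nested form the bounds on the
    successive remainders alternate in direction, so each needs only the previous one. *)
Lemma cos_taylor_horner (u : R) :
  2467/1000 + 25/1000/100 <= u <= 2467/1000 + 26/1000/100 ->
  0 < 1 - u / 2 * (1 - u / 12 * (1 - u / 30 * (1 - u / 56 * (1 - u / 90)))).
Proof.
move=> /andP[ul uh].
set a5 := 1 - u / 90; have h5 : 972/1000 + 5/1000/10 <= a5 by rewrite /a5; lra.
set a4 := 1 - u / 56 * a5; have h4 : a4 <= 957/1000 + 16/1000/100.
  by rewrite /a4; clearbody a5; nra.
set a3 := 1 - u / 30 * a4; have h3 : 921/1000 + 28/1000/100 <= a3.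
  by rewrite /a3; clearbody a4; nra.
set a2 := 1 - u / 12 * a3; have h2 : a2 <= 810/1000 + 59/1000/100.
  by rewrite /a2; clearbody a3; nra.
by clearbody a2; nra.
Qed.

(* [cos x] exceeds its Taylor sum of degree 10 for [0 < x < 2]. *)
Lemma pi_gt : 3 + 14 / 100 + 15 / 100 / 100 < pi :> R.
Proof.
pose x : R := 157 / 100 + 75 / 1000 / 100.
have hx : x = 157 / 100 + 75 / 1000 / 100 by [].
have hpi : 3 + 14 / 100 + 15 / 100 / 100 = x * 2 by rewrite hx; lra.
rewrite hpi; clear hpi.
have x1 : 1 < x by rewrite hx; lra.
have x2 : x < 2 by rewrite hx; lra.
have xu : 2467/1000 + 25/1000/100 <= x ^+ 2 <= 2467/1000 + 26/1000/100.
  by rewrite hx expr2; apply/andP; split; lra.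
clear hx; clearbody x.
suff : 0 < cos x.
  move=> cx; rewrite ltNge; apply/negP => h; move: cx; apply/negP; rewrite -leNgt.
  have pi2 := @pi_ge2 R.
  have hx : pi / 2 <= x by lra.
  move: hx; rewrite le_eqVlt => /predU1P[<-|hx]; first by rewrite cos_pihalf.
  rewrite ltW// -(cos_pihalf R) ltr_cos// in_itv/=; clear -pi2 hx x1 x2; apply/andP; split; lra.
have := @lt_sum_lim_series R (cos_coeff' x) 6.
have -> : lim (series (cos_coeff' x) @ \oo) = cos x.
  exact: (cvg_lim (@Rhausdorff R) (@cvg_cos_coeff' R x)).
move=> h.
have h2 d : 0 < cos_coeff' x (6 + d.*2)%N + cos_coeff' x (6 + d.*2.+1)%N.
  rewrite addnS; apply: cos_coeff_pair_gt0 => //; last by apply/andP; split; lra.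
  by rewrite oddD odd_double.
apply: (lt_trans _ (h (@cvg_cos_coeff' R x) h2)).
rewrite big_mkord !big_ord_recr big_ord0/= /cos_coeff' /= -!exprnP /=.
have f2 : 2`!%:R = 2 :> R by [].
have f4 : 4`!%:R = 2 * 12 :> R by rewrite -natrM.
have f6 : 6`!%:R = 2 * 12 * 30 :> R by rewrite -!natrM.
have f8 : 8`!%:R = 2 * 12 * 30 * 56 :> R by rewrite (factS 7) natrM (factS 6) natrM f6; ring.
have f10 : 10`!%:R = 2 * 12 * 30 * 56 * 90 :> R by rewrite (factS 9) natrM (factS 8) natrM f8; ring.
rewrite -[0.*2]/0%N -[1.*2]/2%N -[2.*2]/4%N -[3.*2]/6%N -[4.*2]/8%N -[5.*2]/10%N.
rewrite f2 f4 f6 f8 f10 fact0 {f2 f4 f6 f8 f10 h h2}.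
rewrite -[4%N]/(2 * 2)%N -[6%N]/(2 * 3)%N -[8%N]/(2 * 4)%N -[10%N]/(2 * 5)%N !exprM.
have := cos_taylor_horner xu; move: (x ^+ 2) => u.
by congr (0 < _); field.
Qed.

End Numerics.

(** * From codes in a ball to codes on a sphere *)

Section BallCode.
Variable R : realType.

(* Points of a ball of squared radius [r] are lifted to the upper half of a sphere in one
   more dimension, after scaling by [Num.sqrt (rho / r)]. *)
Lemma lift_code n (v : 'rV[R]_n) (ws : seq 'rV[R]_n) (r rho : R) : 0 < r -> 0 < rho -> uniq ws ->
  {in ws &, forall w w', w != w' -> 1 <= nsq (w - w')} ->
  (forall w, w \in ws -> nsq (w - v) <= r) ->
  exists X : 'I_(size ws) -> nat -> R,
    (forall a, inner n.+1 (X a) (X a) = rho) /\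
    (forall a b, a != b -> inner n.+1 (X a) (X b) <= rho * (1 - (2 * r)^-1)).
Proof.
move=> r0 rho0 uws sep ball.
pose k := Num.sqrt (rho / r).
have k2 : k ^+ 2 = rho / r by rewrite sqr_sqrtr// divr_ge0// ltW.
pose u (a : 'I_(size ws)) := nth 0 ws a - v.
pose h a := rho - k ^+ 2 * nsq (u a).
pose X a (l : nat) := if (insub l : option 'I_n) is Some i then k * u a 0 i else Num.sqrt (h a).
have h0 a : 0 <= h a.
  rewrite subr_ge0 k2 -mulrA ger_pMr// ler_pdivrMl// mulr1.
  by apply: ball; rewrite mem_nth.
have XE a b : inner n.+1 (X a) (X b) = k ^+ 2 * dotp (u a) (u b) + Num.sqrt (h a) * Num.sqrt (h b).
  rewrite innerS /X insubF ?ltnn//; congr (_ + _).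
  rewrite /inner /dotp mulr_sumr; apply: eq_bigr => i _.
  by rewrite !valK; ring.
exists X; split=> [a|a b ab]; rewrite XE.
  by rewrite -expr2 sqr_sqrtr// /h /nsq; ring.
have s : 1 <= nsq (u a - u b).
  have -> : u a - u b = nth 0 ws a - nth 0 ws b by rewrite /u opprB addrA subrK.
  by apply: sep; rewrite ?mem_nth// nth_uniq.
move: s; rewrite nsqB => s.
(* The extra coordinates are estimated by the arithmetic-geometric mean, which turns the inner
   product into at most [rho - k ^ 2 / 2 * nsq (u a - u b)]. *)
have amgm : Num.sqrt (h a) * Num.sqrt (h b) <= (h a + h b) / 2.
  have := sqr_ge0 (Num.sqrt (h a) - Num.sqrt (h b)).
  have := sqr_sqrtr (h0 a); have := sqr_sqrtr (h0 b).
  move: (Num.sqrt _) (Num.sqrt _) => x y; move: (h a) (h b) => p q; nra.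
apply: le_trans (lerD (lexx _) amgm) _; rewrite /h.
have -> : rho * (1 - (2 * r)^-1) = rho - k ^+ 2 / 2.
  by rewrite k2; field; rewrite gt_eqF.
have := sqr_ge0 k; move: (k ^+ 2) (nsq _) (nsq _) (dotp _ _) s => K p q d s K0.
nra.
Qed.

End BallCode.

Section BallCodeBound.
Variable R : realType.

Lemma nat_above (x : R) : exists m : nat, x <= m%:R.
Proof.
exists (Num.bound `|x|); apply: (le_trans (ler_norm x)); apply: ltW.
by apply: archi_boundP.
Qed.

(* Vectors at mutual distance [1] on a sphere of squared radius [17 / 18] subtend an angle with
   cosine [8 / 17] and sine [15 / 17], for which the Kabatiansky-Levenshtein degree rate
   [(1 - sin) / (2 * sin)] is [1 / 15]; [degree_rate] leaves room for the factor [1 + 4 e]. *)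
Definition ball_sqradius : R := 17 / 18 * (1 + 4 * (1 / 1000 / 100)).
Definition degree_rate : R := 66 / 1000 + 705 / 1000 / 1000.

(** At [i = N / 15] the ratio [2 * sqrt (i * (N + i)) / (N + 2 * i)] equals [8 / 17]. The small
    excess of [degree_rate] over [1 / 15] pays for the enlarged radius, the finite window [M] and
    the gap [2 / 1000 / 100], which keeps the denominator of the code bound away from zero. *)
Lemma degree_choice (N M : R) (i : nat) : 1000 * 100 <= M -> 1000 * 1000 * M <= N ->
  i%:R <= degree_rate * N -> degree_rate * N < i.+1%:R ->
  (2 <= i)%N /\ (1 - (2 * ball_sqradius)^-1 + 2 / 1000 / 100) * (N + 2 * (i%:R + M)) <=
     Num.sqrt (i%:R * (N + i%:R)) * (2 - 2 / M).
Proof.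
move=> hM hN h1 h2.
rewrite -[i.+1]addn1 natrD in h2.
have h3 : (66 / 1000 + 702 / 1000 / 1000) * N <= i%:R.
  by move: h1 h2; rewrite /degree_rate; move: i%:R => I h1 h2; lra.
split; first by rewrite -(ler_nat R); move: h3; move: i%:R => I h3; lra.
move: i%:R h1 h3 => I h1 h3; clear h2 i.
(* A lower estimate of [sqrt (I / (N + I))], which would be [1 / 4] at [I = N / 15]. *)
set x : R := 25 / 100 + 6 / 1000 / 100.
have x0 : 0 <= x by rewrite /x; lra.
have xI : x ^+ 2 * (N + I) <= I by rewrite /x expr2; lra.
have NI0 : 0 <= N + I by lra.
have sq : x * (N + I) <= Num.sqrt (I * (N + I)).
  have I0 : 0 <= I by lra.
  rewrite -(ler_sqr _ _) ?nnegrE ?sqrtr_ge0 ?mulr_ge0// sqr_sqrtr ?mulr_ge0//.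
  by rewrite exprMn (expr2 (N + I)) mulrA; apply: ler_wpM2r.
have iM : 2 / M <= 2 / 1000 / 100.
  by rewrite ler_pdivrMr; lra.
have s : 1 - (2 * ball_sqradius)^-1 <= 470 / 1000 + 61 / 1000 / 100.
  rewrite lerBlDr -lerBlDl.
  have b0 : 0 < 2 * ball_sqradius by rewrite /ball_sqradius; lra.
  have b1 : (1 - (470 / 1000 + 61 / 1000 / 100)) * (2 * ball_sqradius) <= 1.
    by rewrite /ball_sqradius; lra.
  by rewrite -[leRHS]div1r ler_pdivlMr.
have NM0 : 0 <= N + 2 * (I + M) by clear -hM hN h3; lra.
apply: (@le_trans _ _ ((470 / 1000 + 61 / 1000 / 100 + 2 / 1000 / 100) * (N + 2 * (I + M)))).
  by apply: ler_wpM2r; [exact: NM0|exact: lerD].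
apply: (@le_trans _ _ (x * (N + I) * (2 - 2 / 1000 / 100))).
  by rewrite /x; move: h1; rewrite /degree_rate; clear -hM hN NI0 h3 => h1; lra.
have x2 : 0 <= 2 - 2 / 1000 / 100 :> R by clear; lra.
by apply: ler_pM; [rewrite mulr_ge0|exact: x2|exact: sq|rewrite lerD2l lerN2].
Qed.

End BallCodeBound.

(** * Exponential estimates and the rate of the code bound *)

Section ExpNumerics.
Variable R : realType.

Lemma expR_horner7 (x : R) : 0 <= x ->
  1 + x * (1 + x / 2 * (1 + x / 3 * (1 + x / 4 * (1 + x / 5 * (1 + x / 6 * (1 + x / 7))))))
    <= expR x.
Proof.
move=> x0; apply: le_trans (expR_ge_partial 8 x0).
have f7 : 7`!%:R = 720 * 7 :> R by rewrite (factS 6) natrM mulrC.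
rewrite !big_ord_recr big_ord0 /= f7 fact0.
have -> : 1`!%:R = 1 :> R by [].
have -> : 2`!%:R = 2 :> R by [].
have -> : 3`!%:R = 6 :> R by [].
have -> : 4`!%:R = 24 :> R by [].
have -> : 5`!%:R = 120 :> R by [].
have -> : 6`!%:R = 720 :> R by [].
by rewrite le_eqVlt; apply/orP; left; apply/eqP; field.
Qed.

Lemma expR_ge2 : 2 <= expR (693 / 1000 + 3 / 1000 / 10 : R).
Proof.
set x : R := 693 / 1000 + 3 / 1000 / 10.
have x0 : 0 <= x by rewrite /x; lra.
apply: le_trans (expR_horner7 x0).
set a6 := 1 + x / 7; have h6 : 1 + 99/1000 <= a6 by rewrite /a6 /x; lra.
set a5 := 1 + x / 6 * a6; have h5 : 1 + 126/1000 + 9/1000/10 <= a5.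
  by rewrite /a5 /x; clearbody a6; clear -h6; lra.
set a4 := 1 + x / 5 * a5; have h4 : 1 + 156/1000 + 2/1000/10 <= a4.
  by rewrite /a4 /x; clearbody a5; clear -h5; lra.
set a3 := 1 + x / 4 * a4; have h3 : 1 + 200/1000 + 3/1000/10 <= a3.
  by rewrite /a3 /x; clearbody a4; clear -h4; lra.
set a2 := 1 + x / 3 * a3; have h2 : 1 + 277/1000 + 3/1000/10 <= a2.
  by rewrite /a2 /x; clearbody a3; clear -h3; lra.
set a1 := 1 + x / 2 * a2; have h1 : 1 + 442/1000 + 7/1000/10 <= a1.
  by rewrite /a1 /x; clearbody a2; clear -h2; lra.
by rewrite /x; clearbody a1; clear -h1; lra.
Qed.

Lemma expR_ge_187745 : 1 + 877/1000 + 45/1000/100 <= expR (629 / 1000 + 96 / 1000 / 100 : R).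
Proof.
set x : R := 629 / 1000 + 96 / 1000 / 100.
have x0 : 0 <= x by rewrite /x; lra.
apply: le_trans (expR_horner7 x0).
set a6 := 1 + x / 7; have h6 : 1 + 89/1000 + 9/1000/10 <= a6 by rewrite /a6 /x; lra.
set a5 := 1 + x / 6 * a6; have h5 : 1 + 114/1000 + 4/1000/10 <= a5.
  by rewrite /a5 /x; clearbody a6; clear -h6; lra.
set a4 := 1 + x / 5 * a5; have h4 : 1 + 140/1000 + 4/1000/10 <= a4.
  by rewrite /a4 /x; clearbody a5; clear -h5; lra.
set a3 := 1 + x / 4 * a4; have h3 : 1 + 179/1000 + 6/1000/10 <= a3.
  by rewrite /a3 /x; clearbody a4; clear -h4; lra.
set a2 := 1 + x / 3 * a3; have h2 : 1 + 247/1000 + 7/1000/10 <= a2.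
  by rewrite /a2 /x; clearbody a3; clear -h3; lra.
set a1 := 1 + x / 2 * a2; have h1 : 1 + 393/1000 <= a1.
  by rewrite /a1 /x; clearbody a2; clear -h2; lra.
by rewrite /x; clearbody a1; clear -h1; lra.
Qed.

(* [log16] is an upper approximation of [ln 16]. *)
Definition log16 : R := 4 * (693 / 1000 + 3 / 1000 / 10).

Lemma expR_log16 : 16 <= expR log16.
Proof.
have -> : expR log16 = expR (693 / 1000 + 3 / 1000 / 10) ^+ 4 by rewrite -expRM_natl.
have -> : (16 : R) = 2 ^+ 4 by ring.
apply: lerXn2r; rewrite ?nnegrE ?expR_ge0//; exact: expR_ge2.
Qed.

(** An upper estimate of [z^(-kap) / (1 - z)] at [z = 1 / 16], the growth rate of the number of
    features for degree rate [kap]. The optimal point is [z = kap / (1 + kap)], which is [1 / 16]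
    for [kap = 1 / 15]. *)
Definition code_rate : R := expR (degree_rate R * log16) * (16 / 15).

Lemma code_rate_gt0 : 0 < code_rate.
Proof. by rewrite mulr_gt0 ?expR_gt0//; lra. Qed.

Lemma code_rate_lt (beta : R) : beta = 641 / 1000 + 7 / 1000 / 10 ->
  (code_rate * expR (3 * (1 / 1000 / 100))) ^+ 2 < expR 1 * beta * (17 / 18).
Proof.
move=> hb.
(* An upper estimate of the total exponent [2 * degree_rate * log16] plus the slack. Since
   [expR 1 = expR y * expR (1 - y)], only [expR (1 - y)] has to be evaluated, and it must exceed
   [256 / 225] divided by [beta * 17 / 18]. *)
pose y : R := 37 / 100 + 4 / 1000 / 100.
have e1 : (code_rate * expR (3 * (1 / 1000 / 100))) ^+ 2 <= expR y * (256 / 225).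
  rewrite /code_rate !exprMn -!expRM_natl [leLHS](_ : _ =
     expR (2%:R * (degree_rate R * log16)) * expR (2%:R * (3 * (1 / 1000 / 100))) * (256 / 225)).
    rewrite -expRD; apply: ler_wpM2r; first by lra.
    by rewrite ler_expR /y /degree_rate /log16; lra.
  by move: (expR _) (expR _) => u v; field.
apply: le_lt_trans e1 _.
have -> : expR 1 = expR y * expR (629 / 1000 + 96 / 1000 / 100) :> R.
  by rewrite -expRD /y; congr expR; lra.
have := expR_ge_187745; move: (expR (629 / 1000 + _)) => u hu.
rewrite -!mulrA ltr_pM2l ?expR_gt0// hb.
by clear -hu; lra.
Qed.

End ExpNumerics.

(** * Codes in balls *)

Section BallCodeThm.
Variable R : realType.
Let rA := ball_sqradius R.
Let kap := degree_rate R.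
Let del : R := 2 / 1000 / 100.

Let rA_gt : 1 / 2 < rA. Proof. by rewrite /rA /ball_sqradius; lra. Qed.
Let del_gt0 : 0 < del. Proof. by rewrite /del; lra. Qed.

Lemma code_bound_step (N i m s : nat) (X : 'I_s -> nat -> R) (rho : R) :
  (0 < N)%N -> (2 <= i)%N -> (2 <= m)%N -> i%:R <= kap * N%:R -> rho = N%:R + 2 * (i%:R + m%:R) ->
  (1 - (2 * rA)^-1 + del) * rho <= Num.sqrt (i%:R * (N%:R + i%:R)) * (2 - 2 / m%:R) ->
  (forall a, inner N (X a) (X a) = rho) ->
  (forall a b, a != b -> inner N (X a) (X b) <= rho * (1 - (2 * rA)^-1)) ->
  s%:R <= m.+2%:R / del * 16 ^+ m.+1 * code_rate R ^+ N.
Proof.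
move=> N0 i2 m2 ik hrho hlam Xr Xs.
have rho0 : 0 < rho by rewrite hrho ltr_wpDr// ?ltr0n// mulr_ge0.
set lam := Num.sqrt _ * _ in hlam.
pose sigma := rho * (1 - (2 * rA)^-1).
have ds : del * rho <= lam - sigma.
  by rewrite lerBrDl /sigma (mulrC rho); apply: le_trans hlam; rewrite [leRHS]mulrDl lerD2r.
have sl : sigma < lam by rewrite -subr_gt0; apply: lt_le_trans ds; rewrite mulr_gt0.
have z0 : 0 < (16 : R)^-1 by rewrite invr_gt0.
have z1 : (16 : R)^-1 < 1 by rewrite invf_lt1// ltr1n.
have hr : N%:R + 2 * (i + m)%:R <= rho by rewrite natrD hrho.
have := spherical_code_bound N0 i2 m2 hr Xr Xs sl z0 z1.
rewrite -/lam -/sigma => main.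
have {}main : s%:R * (del * rho) * (16^-1 ^+ (i + m.+1) * (1 - 16^-1) ^+ N) <= m.+2%:R * rho.
  apply: le_trans (le_trans main _).
    apply: ler_wpM2r; first by rewrite mulr_ge0// exprn_ge0// ?subr_ge0; exact: ltW.
    by apply: ler_wpM2l.
  apply: ler_wpM2l; first exact: ler0n.
  rewrite /sigma lerBlDr lerDl mulr_ge0// ?subr_ge0; first exact: ltW.
  by have h := rA_gt; rewrite invf_le1; lra.
have P0 : 0 < 16^-1 ^+ (i + m.+1) * (1 - 16^-1) ^+ N :> R.
  by rewrite mulr_gt0// exprn_gt0// subr_gt0.
have {}main : s%:R <= m.+2%:R / del * (16^-1 ^+ (i + m.+1) * (1 - 16^-1) ^+ N)^-1.
  rewrite ler_pdivlMr// ler_pdivlMr//.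
  rewrite -(ler_pM2r rho0); apply: le_trans main.
  by rewrite le_eqVlt; apply/orP; left; apply/eqP; ring.
apply: (le_trans main); rewrite -!mulrA; apply: ler_wpM2l; first exact: ler0n.
apply: ler_wpM2l; first by rewrite invr_ge0 ltW.
rewrite invfM exprVn invrK exprD.
have -> : (1 - 16^-1 : R) = (16 / 15)^-1 by field.
rewrite exprVn invrK (mulrC (16 ^+ i)) -mulrA.
apply: ler_wpM2l; first by rewrite exprn_ge0.
rewrite /code_rate [leRHS]exprMn; apply: ler_wpM2r; first by rewrite exprn_ge0//; lra.
rewrite -expRM_natl; apply: (@le_trans _ _ (expR (log16 R) ^+ i)).
  by apply: lerXn2r; rewrite ?nnegrE ?expR_ge0//; exact: expR_log16.
rewrite -expRM_natl ler_expR [leRHS]mulrA [N%:R * _]mulrC; apply: ler_wpM2r => //.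
by rewrite /log16; lra.
Qed.

(** The window length [m] does not depend on [n], so all subexponential factors are constants. The
    lifted code lives in dimension [n.+1]; the resulting additional factor [code_rate] also goes
    into [C]. *)
Lemma ball_code : exists (C : R) (n0 : nat), 0 < C /\
  forall n, (n0 <= n)%N -> forall (v : 'rV[R]_n) (ws : seq 'rV[R]_n), uniq ws ->
  {in ws &, forall w w', w != w' -> 1 <= nsq (w - w')} ->
  (forall w, w \in ws -> nsq (w - v) <= rA) ->
  (size ws)%:R <= C * code_rate R ^+ n.
Proof.
have [m hm] := nat_above (1000 * 100 : R).
have [n0 hn0] := nat_above (1000 * 1000 * m%:R : R).
exists (m.+2%:R / del * 16 ^+ m.+1 * code_rate R), n0; split.
  apply: mulr_gt0; last exact: code_rate_gt0.
  apply: mulr_gt0; last by rewrite exprn_gt0.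
  by apply: divr_gt0; [rewrite ltr0n|exact: del_gt0].
move=> n nn0 v ws uws sep ball.
have hN : 1000 * 1000 * m%:R <= n.+1%:R :> R.
  by apply: (le_trans hn0); rewrite ler_nat; apply: leq_trans nn0 _.
have kN : 0 <= kap * n.+1%:R by rewrite mulr_ge0// /kap /degree_rate; lra.
have /andP[h1 h2] := truncn_itv kN.
have [i2 hlam] := degree_choice hm hN h1 h2.
move: (Num.truncn _) h1 h2 i2 hlam => i h1 h2 i2 hlam.
have m2 : (2 <= m)%N by rewrite -(ler_nat R); apply: le_trans hm; lra.
pose rho : R := n.+1%:R + 2 * (i%:R + m%:R).
have rho0 : 0 < rho by rewrite /rho ltr_wpDr// mulr_ge0.
have rA0 : 0 < rA by have h := rA_gt; lra.
have [X [X1 X2]] := lift_code rA0 rho0 uws sep ball.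
have := code_bound_step (ltn0Sn n) i2 m2 h1 (erefl rho) hlam X1 X2.
by rewrite [code_rate R ^+ _]exprS mulrA.
Qed.

End BallCodeThm.

(** * Smallness of the dual theta function *)

Section ThetaSmall.
Variable R : realType.

Lemma geometric_small (K r d : R) : 0 <= r < 1 -> 0 < d ->
  exists n0, forall n, (n0 <= n)%N -> K * r ^+ n <= d.
Proof.
move=> /andP[r0 r1] d0.
have cv : (fun n : nat => K * r ^+ n) @ \oo --> K * 0.
  by apply: cvgMr; apply: cvg_expr; rewrite ger0_norm.
rewrite mulr0 in cv.
have [n0 _ h] := cvgr_le (0 : R) cv d d0.
by exists n0 => n /h.
Qed.

Lemma bernoulli_above (e M : R) : 0 < e -> exists J : nat, M <= (1 + e) ^+ J.
Proof.
move=> e0; have [J hJ] := nat_above (M / e); exists J.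
have h : 1 + J%:R * e <= (1 + e) ^+ J.
  elim: J {hJ} => [|J IH]; first by rewrite mul0r addr0 expr0.
  rewrite exprS -natr1; have J0 : 0 <= J%:R :> R by [].
  move: (J%:R) ((1 + e) ^+ J) J0 IH => j p j0 IH; nra.
apply: le_trans h; rewrite ler_pdivrMr// in hJ; lra.
Qed.

Lemma mul_expRN_le (x : R) : x * expR (- x) <= (expR 1)^-1.
Proof.
rewrite -(ler_pM2r (expR_gt0 1)) mulVf ?gt_eqF ?expR_gt0// -mulrA -expRD.
have := expR_ge1Dx (x - 1); rewrite addrC subrK => h.
have -> : - x + 1 = - (x - 1) by ring.
apply: (@le_trans _ _ (expR (x - 1) * expR (- (x - 1)))); last by rewrite -expRD subrr expR0.
by apply: ler_wpM2r; rewrite ?expR_ge0.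
Qed.

Variables (e x beta C F : R) (n0 : nat).
Hypotheses (e0 : 0 < e) (e1 : e <= 1 / 3) (x0 : 0 < x) (x1 : x < 1) (beta0 : 0 < beta).
Hypotheses (C0 : 0 < C) (F0 : 0 < F).
Hypothesis code : forall n, (n0 <= n)%N -> forall (v : 'rV[R]_n) (ws : seq 'rV[R]_n), uniq ws ->
  {in ws &, forall w w', w != w' -> 1 <= nsq (w - w')} ->
  (forall w, w \in ws -> nsq (w - v) <= x * (1 + 4 * e)) -> (size ws)%:R <= C * F ^+ n.
Hypothesis rate : (F * expR (3 * e)) ^+ 2 < expR 1 * beta * x.
Hypothesis tail : 2 < expR beta ^+ 2.

(** Exponential rates of the two contributions to [theta]: [r1] for a single shell, below [1] by
    [rate], and [r2] for the vectors of squared length at least [4], below [1] by [tail]. *)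
Let r1 : R := F * expR (3 * e) * Num.sqrt (expR 1 * beta * x)^-1.
Let r2 : R := expR (- beta) * Num.sqrt 2.
Let ebx0 : 0 < expR 1 * beta * x. Proof. by rewrite !mulr_gt0 ?expR_gt0. Qed.

Let r1_lt1 : 0 <= r1 < 1.
Proof.
have p0 : 0 <= F * expR (3 * e) by rewrite mulr_ge0 ?expR_ge0// ltW.
rewrite mulr_ge0 ?sqrtr_ge0//= /r1 sqrtrV ?ltW// ltr_pdivrMr ?sqrtr_gt0// mul1r.
by rewrite -[ltLHS]ger0_norm// -sqrtr_sqr ltr_sqrt.
Qed.

Let r2_lt1 : 0 <= r2 < 1.
Proof.
rewrite mulr_ge0 ?sqrtr_ge0 ?expR_ge0//= /r2 expRN mulrC ltr_pdivrMr ?expR_gt0// mul1r.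
rewrite -[ltRHS]ger0_norm ?expR_ge0// -sqrtr_sqr ltr_sqrt//.
by rewrite exprn_gt0 ?expR_gt0.
Qed.

Section Lattice.
Variables (n : nat) (B B' : 'M[R]_n).
Hypotheses (nn0 : (n0 <= n)%N) (nbig : expR (- (e ^+ 2 * (n%:R / 2))) <= 1 / 8).
Hypotheses (BB' : dual_basis B B').
Hypothesis min1 : forall z : 'rV[int]_n, z != 0 -> 1 <= nsq (zvec R z *m B).

Let N (z : 'rV[int]_n) := nsq (zvec R z *m B).
Let b : R := n%:R / 2 * beta.

Lemma zvec_mul_sub (z z' : 'rV[int]_n) : zvec R z *m B - zvec R z' *m B = zvec R (z - z') *m B.
Proof. by rewrite /zvec -mulmxBl -map_mxB. Qed.

Lemma shell_term (q : R) (s : seq 'rV[int]_n) : 1 <= q -> uniq s ->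
  (forall z, z \in s -> q <= N z <= q * (1 + e)) ->
  \sum_(z <- s) expR (- (b * N z)) <= 3 * C * r1 ^+ n.
Proof.
move=> q1 us hs.
have q0 : 0 < q by apply: lt_le_trans q1.
have injB : injective (fun z => zvec R z *m B).
  move=> z z' h; apply/eqP; rewrite -subr_eq0; apply/negPn/negP => /min1.
  by rewrite -zvec_mul_sub h subrr nsq0 ler10.
set ws := map (fun z => zvec R z *m B) s.
have uws : uniq ws by rewrite map_inj_uniq.
have sep : {in ws &, forall w w', w != w' -> 1 <= nsq (w - w')}.
  move=> _ _ /mapP[z zs ->] /mapP[z' zs' ->] ww; rewrite zvec_mul_sub min1// subr_eq0.
  by apply: contra ww => /eqP->.
have cnt v : (count (fun w => nsq (w - v) <= x * (1 + 4 * e))%R ws)%:R <= C * F ^+ n.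
  rewrite -size_filter; apply: (code nn0 (v := v)); first exact: filter_uniq.
    by move=> w w'; rewrite !mem_filter => /andP[_ h] /andP[_ h']; exact: sep.
  by move=> w; rewrite mem_filter => /andP[].
have hq w : w \in ws -> q <= nsq w <= q * (1 + e) by move=> /mapP[z /hs h ->].
have := shell_count x0 (lt_le_trans x1 q1) e0 e1 cnt hq nbig.
rewrite size_map => sz.
have b0 : 0 <= b by rewrite mulr_ge0 ?divr_ge0// ltW.
apply: (@le_trans _ _ ((size s)%:R * expR (- (b * q)))).
  rewrite -lerN2 -sumrN -mulrN; apply: size_mul_le_sum => z /hs /andP[qz _].
  by rewrite lerN2 ler_expR lerN2; apply: ler_wpM2l.
apply: (le_trans (ler_wpM2r (expR_ge0 _) sz)).
have -> : expR (- (b * q)) = Num.sqrt (expR (- (beta * q))) ^+ n.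
  by rewrite sqrt_expR_exp /b mulrN mulrA.
rewrite -[leLHS]mulrA -(sqrtM_exp _ _ (divr_ge0 (ltW q0) (ltW x0))).
have -> : expR (3 * e * n%:R) = expR (3 * e) ^+ n by rewrite -expRM_natr.
have -> : 3 * C * r1 ^+ n = 3 * (C * F ^+ n) * expR (3 * e) ^+ n * Num.sqrt (expR 1 * beta * x)^-1 ^+ n.
  by rewrite /r1 !exprMn; ring.
apply: ler_wpM2l.
  by rewrite !mulr_ge0 ?exprn_ge0 ?expR_ge0// ltW.
apply: ler_sqrt_exp.
rewrite invfM mulrAC; apply: ler_wpM2r; first by rewrite invr_ge0 ltW.
rewrite invfM; apply: (@le_trans _ _ (beta * q * expR (- (beta * q)) / beta)).
  by rewrite le_eqVlt; apply/orP; left; apply/eqP; field; rewrite gt_eqF.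
by apply: ler_wpM2r; [rewrite invr_ge0 ltW|exact: mul_expRN_le].
Qed.

Lemma shell_index (y : R) J : 1 <= y -> y < (1 + e) ^+ J ->
  exists2 j : 'I_J, (1 + e) ^+ j <= y & y <= (1 + e) ^+ j * (1 + e).
Proof.
move=> y1; elim: J => [|J IH]; first by rewrite expr0 ltNge y1.
rewrite exprSr => h; have [/IH[j h1 h2]|h'] := ltP y ((1 + e) ^+ J).
  by exists (widen_ord (leqnSn J) j).
by exists ord_max => //; exact: ltW.
Qed.

Lemma theta_shells J : (0 < n)%N -> 4 <= (1 + e) ^+ J ->
  theta B b <= J%:R * (3 * C * r1 ^+ n) + r2 ^+ n * (1 + theta B b).
Proof.
move=> n_gt0 hJ.
have b0 : 0 < b by rewrite /b mulr_gt0// divr_gt0// ltr0n.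
have b2 : 0 < b / 2 by rewrite divr_gt0.
have e1' : 1 <= 1 + e by rewrite lerDl ltW.
pose f z : R := if z == 0 then 0 else expR (- (b * N z)).
pose P (j : nat) z := (1 + e) ^+ j <= N z <= (1 + e) ^+ j * (1 + e).
have f0 z : 0 <= f z by rewrite /f; case: ifP => // _; exact: expR_ge0.
rewrite {1}(thetaE BB' b0); apply: (sum_le_seq f0 _).2 => s us.
(* Squared lengths in [[1, 4)] are covered by [J] geometric shells, with [J] independent of [n]. For
   [N z >= 4] one has [b * N z >= 2 * b + b / 2 * N z], and the last term sums to the Gaussian at
   half the parameter. *)
have fle z : f z <= \sum_(j < J) (if P j z then f z else 0) + expR (- (2 * b)) * expR (- (b / 2 * N z)).
  have S0 : 0 <= \sum_(j < J) (if P j z then f z else 0) by apply: sumr_ge0 => j _; case: ifP.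
  have T0 : 0 <= expR (- (2 * b)) * expR (- (b / 2 * N z)) by rewrite mulr_ge0 ?expR_ge0.
  have [z0|z0] := eqVneq z 0; first by rewrite {1}/f z0 eqxx -z0 addr_ge0.
  have [N4|N4] := ltP (N z) 4.
    have [j h1 h2] := shell_index (min1 z0) (lt_le_trans N4 hJ).
    have Pj : P j z by apply/andP; split.
    apply: ler_wpDr => //; rewrite (bigD1 j)//= Pj lerDl.
    by apply: sumr_ge0 => i _; case: ifP.
  apply: ler_wpDl => //; rewrite /f (negbTE z0) -expRD ler_expR.
  by move: N4 b0; move: (N z) b => y c y4 c0; nra.
apply: le_trans (ler_sum _ (fun z _ => fle z)) _; rewrite big_split exchange_big/=; apply: lerD.
  have -> : J%:R * (3 * C * r1 ^+ n) = \sum_(j < J) 3 * C * r1 ^+ n.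
    by rewrite sumr_const card_ord mulr_natl.
  apply: ler_sum => j _.
  have -> : \sum_(z <- s) (if P j z then f z else 0) = 
      \sum_(z <- [seq z <- s | P j z && (z != 0)]) expR (- (b * N z)).
    rewrite big_filter [RHS]big_mkcond; apply: eq_bigr => z _; rewrite /f.
    by case: (P j z) => //=; case: (z == 0).
  apply: (@shell_term ((1 + e) ^+ j)); rewrite ?filter_uniq//.
    by rewrite exprn_ege1.
  by move=> z; rewrite mem_filter => /andP[/andP[]].
rewrite -mulr_sumr; have -> : r2 ^+ n = expR (- (2 * b)) * Num.sqrt 2 ^+ n.
  by rewrite /r2 exprMn -expRM_natl /b; congr (expR _ * _); field.
rewrite -mulrA; apply: ler_wpM2l; first exact: expR_ge0.
apply: le_trans (gsum_half BB' b0).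
apply: le_trans (le_seq_sum _ (smb_gsum BB' 0 b2) us); last by move=> z; exact: expR_ge0.
by apply: ler_sum => z _; rewrite subr0.
Qed.

End Lattice.

Lemma theta_small : exists n1, forall n, (n1 <= n)%N -> forall B B' : 'M[R]_n, dual_basis B B' ->
  (forall z : 'rV[int]_n, z != 0 -> 1 <= nsq (zvec R z *m B)) ->
  theta B (n%:R / 2 * beta) <= 1 / 4.
Proof.
have [J hJ] := bernoulli_above 4 e0.
(* With both coefficients at most [1 / 16], the inequality [theta <= 1 / 16 + (1 + theta) / 16]
   gives [theta <= 2 / 15]. *)
have s0 : 0 < 1 / 16 :> R by rewrite divr_gt0.
have [k1 h1] := geometric_small (J%:R * (3 * C)) r1_lt1 s0.
have [k2 h2] := geometric_small 1 r2_lt1 s0.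
have [k3 h3] := nat_above (16 / e ^+ 2).
exists (maxn n0 (maxn k1 (maxn k2 (maxn k3 1)))) => n.
rewrite !geq_max => /and5P[nn0 /h1 {}h1 /h2 {}h2 nk3 n_gt0] B B' BB' min1.
have nbig : expR (- (e ^+ 2 * (n%:R / 2))) <= 1 / 8.
  have e2 : 0 < e ^+ 2 by rewrite exprn_gt0.
  have n16 : 16 <= n%:R * e ^+ 2.
    by rewrite -ler_pdivrMr//; apply: (le_trans h3); rewrite ler_nat.
  have n8 : 8 <= e ^+ 2 * (n%:R / 2) by lra.
  apply: le_trans (expRN_le_inv _) _; first by apply: lt_le_trans n8.
  by rewrite div1r lef_pV2 ?posrE//; apply: lt_le_trans n8.
have := theta_shells nn0 nbig BB' min1 n_gt0 hJ.
have t0 : 0 <= theta B (n%:R / 2 * beta).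
  by apply: (theta_ge0 BB'); rewrite mulr_gt0// divr_gt0// ltr0n.
have := ler_wpM2r (addr_ge0 ler01 t0) h2; rewrite mul1r.
rewrite -mulrA -[3 * C * _]mulrA in h1 *.
move: h1; move: (theta _ _) t0 => t t0; move: (J%:R * _) (r2 ^+ n * _) => p q.
lra.
Qed.

End ThetaSmall.

(** * Covering bounds *)

Section Covering.
Variable R : realType.

Lemma expR1_ge2 : 2 <= expR 1 :> R.
Proof. by apply: le_trans (expR_ge1Dx 1). Qed.

Lemma sqrt2_exp_le n : Num.sqrt 2 ^+ n <= expR (n%:R / 2) :> R.
Proof.
by rewrite -[n%:R / 2]mulr1 -sqrt_expR_exp; apply: ler_sqrt_exp; exact: expR1_ge2.
Qed.

(** Valid in every dimension, from [theta_tail] alone: with parameter [b = n + 6] the decay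
    [expR (- (b / 2))] beats [sqrt 2 ^ n <= expR (n / 2)] by [expR (- 3) <= 1 / 8]. *)
Lemma covering_crude n (B B' : 'M[R]_n) : dual_basis B B' ->
  (forall z : 'rV[int]_n, z != 0 -> 1 <= nsq (zvec R z *m B')) ->
  forall t, exists z, nsq (zvec R z *m B - t) <= (n%:R + 6) ^+ 2.
Proof.
move=> BB' min1; pose b : R := n%:R + 6.
have hb : b = n%:R + 6 by [].
have b0 : 0 < b by rewrite hb ltr_wpDl.
have pi2 : 4 <= pi ^+ 2 :> R by have := @pi_ge2 R; move: pi => p p2; nra.
have pi20 : 0 < pi ^+ 2 :> R by apply: lt_le_trans pi2.
have th : theta B' b <= 1 / 4.
  have := theta_tail (dual_basis_sym BB') b0 min1; rewrite mulr1.
  have t0 := theta_ge0 (dual_basis_sym BB') b0.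
  have h : expR (- (b / 2)) * Num.sqrt 2 ^+ n <= 1 / 8 :> R.
    apply: (le_trans (ler_wpM2l (expR_ge0 _) (sqrt2_exp_le n))).
    rewrite -expRD hb; have -> : - ((n%:R + 6) / 2) + n%:R / 2 = - (3%:R * 1) :> R by field.
    rewrite expRN expRM_natl div1r lef_pV2 ?posrE ?exprn_gt0 ?expR_gt0//.
    by have := expR1_ge2; move: (expR 1) => u u2; rewrite !exprS expr0; nra.
  have := ler_wpM2r (addr_ge0 ler01 t0) h; rewrite -mulrA.
  by move: (_ * (_ * _)) => q; move: (theta _ _) t0 => t t0; lra.
have a0 : 0 < pi ^+ 2 / b :> R by rewrite divr_gt0.
apply: (@transference_core _ _ B B' (pi ^+ 2 / b) (pi ^+ 2 / b / 2)) => //.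
- by rewrite divr_gt0.
- by rewrite ltr_pdivrMr// ltr_pMr// ltr1n.
- by rewrite invf_div mulrCA mulfV ?gt_eqF// mulr1.
have -> : pi ^+ 2 / b / (pi ^+ 2 / b / 2) = 2 :> R.
  by move: (pi ^+ 2) pi20 => p p0; field; rewrite !gt_eqF.
have h : Num.sqrt 2 ^+ n * expR (- ((pi ^+ 2 / b - pi ^+ 2 / b / 2) * (n%:R + 6) ^+ 2)) <= 1 / 2 :> R.
  apply: (@le_trans _ _ (expR (n%:R / 2) * expR (- ((2%:R * b) * 1)))).
    apply: ler_pM; rewrite ?exprn_ge0 ?sqrtr_ge0 ?expR_ge0 ?sqrt2_exp_le//.
    rewrite ler_expR lerN2 -hb mulr1.
    have -> : (pi ^+ 2 / b - pi ^+ 2 / b / 2) * b ^+ 2 = pi ^+ 2 * b / 2 :> R.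
      by field; rewrite gt_eqF.
    by move: (pi ^+ 2) pi2 b0 => p p4; clear -p4; move: b => c c0; nra.
  rewrite -expRD; apply: (@le_trans _ _ (expR (- 1))).
    by rewrite ler_expR; rewrite hb; have := ler0n R n; clear; move: (n%:R) => N N0; lra.
  by rewrite expRN div1r lef_pV2 ?posrE ?expR_gt0//; exact: expR1_ge2.
by move: h; move: (_ * expR _) => u; lra.
Qed.

(* [beta] just exceeds [code_rate ^ 2 / (expR 1 * 17 / 18)], and [covering_rate] just exceeds
   [sqrt beta / (2 * pi)]. *)
Definition beta : R := 641 / 1000 + 7 / 1000 / 10.
Definition covering_rate : R := 127 / 1000 + 499 / 1000 / 1000.

Lemma theta_small_beta : exists n1, forall n, (n1 <= n)%N -> forall B B' : 'M[R]_n, dual_basis B B' ->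
  (forall z : 'rV[int]_n, z != 0 -> 1 <= nsq (zvec R z *m B)) ->
  theta B (n%:R / 2 * beta) <= 1 / 4.
Proof.
have [C [n0 [C0 hC]]] := ball_code R.
have rate := code_rate_lt (erefl beta).
have e0 : 0 < 1 / 1000 / 100 :> R by lra.
have e1 : 1 / 1000 / 100 <= 1 / 3 :> R by lra.
have x0 : 0 < 17 / 18 :> R by lra.
have x1 : 17 / 18 < 1 :> R by lra.
have b0 : 0 < beta by rewrite /beta; lra.
have tail : 2 < expR beta ^+ 2.
  have := expR_ge1Dx beta; rewrite {1}/beta; move: (expR beta) => u u1; nra.
exact: (theta_small e0 e1 x0 x1 b0 C0 (code_rate_gt0 R) hC rate tail).
Qed.

Lemma covering_rate_pi : beta * (1 + 3 / 1000 / 100) <= (2 * pi * covering_rate) ^+ 2.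
Proof.
have hpi := pi_gt R.
apply: (@le_trans _ _ ((2 * (3 + 14 / 100 + 15 / 100 / 100) * covering_rate) ^+ 2)).
  by rewrite /beta /covering_rate expr2; lra.
have c0 : 0 <= covering_rate by rewrite /covering_rate; lra.
apply: lerXn2r; rewrite ?nnegrE.
- by rewrite mulr_ge0//; lra.
- by rewrite mulr_ge0//; lra.
by apply: ler_wpM2r => //; lra.
Qed.

(** The two Gaussian parameters differ by the factor [1 + e]. Changing them costs
    [(1 + e) ^ (n / 2) <= expR (n / 2 * e)] and gains [expR (n / 2 * (G * e / (1 + e)))]; as
    [G >= 1 + 3 * e], the net gain is at least [expR (n / 2 * e ^ 2)], which reaches [expR 1] once
    [n >= 2 / e ^ 2]. *)
Lemma covering_asym : exists n1, forall n, (n1 <= n)%N -> forall B B' : 'M[R]_n, dual_basis B B' ->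
  (forall z : 'rV[int]_n, z != 0 -> 1 <= nsq (zvec R z *m B')) ->
  forall t, exists z, nsq (zvec R z *m B - t) <= (covering_rate * n%:R) ^+ 2.
Proof.
have [n1 hth] := theta_small_beta.
pose e : R := 1 / 1000 / 100.
have e0 : 0 < e by rewrite /e; lra.
have [n2 hn2] := nat_above (2 / e ^+ 2).
exists (maxn n1 (maxn n2 1)) => n; rewrite !geq_max => /and3P[nn1 nn2 n_gt0] B B' BB' min1.
have th := hth n nn1 _ _ (dual_basis_sym BB') min1.
have nR : 0 < n%:R :> R by rewrite ltr0n.
have n2R : 2 <= n%:R * e ^+ 2.
  by rewrite -ler_pdivrMr ?exprn_gt0//; apply: (le_trans hn2); rewrite ler_nat.
have bt0 : 0 < beta by rewrite /beta; lra.
have pi0 : 0 < pi ^+ 2 :> R by rewrite exprn_gt0// pi_gt0.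
set b := n%:R / 2 * beta in th.
have b0 : 0 < b by rewrite /b mulr_gt0// divr_gt0.
have a0 : 0 < pi ^+ 2 / b :> R by rewrite divr_gt0.
have e1 : 0 < 1 + e by rewrite addr_gt0.
apply: (@transference_core _ _ B B' (pi ^+ 2 / b) (pi ^+ 2 / b / (1 + e))) => //.
- by rewrite divr_gt0.
- by rewrite ltr_pdivrMr// ltr_pMr// ltrDl.
- by rewrite invf_div mulrCA mulfV ?gt_eqF// mulr1.
have -> : pi ^+ 2 / b / (pi ^+ 2 / b / (1 + e)) = 1 + e :> R.
  by move: (pi ^+ 2) pi0 => p p0; field; rewrite !gt_eqF.
set G := (2 * pi * covering_rate) ^+ 2 / beta.
have G1 : 1 + 3 * e <= G.
  have -> : 1 + 3 * e = 1 + 3 / 1000 / 100 by rewrite /e; lra.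
  by rewrite /G ler_pdivlMr// mulrC; exact: covering_rate_pi.
have -> : (pi ^+ 2 / b - pi ^+ 2 / b / (1 + e)) * (covering_rate * n%:R) ^+ 2 =
   n%:R / 2 * (G * e / (1 + e)).
  by rewrite /G /b; move: pi covering_rate beta bt0 => p c bt bt0; field; rewrite !gt_eqF.
have h : Num.sqrt (1 + e) ^+ n * expR (- (n%:R / 2 * (G * e / (1 + e)))) <= 1 / 2.
  apply: (@le_trans _ _ (expR (n%:R / 2 * e) * expR (- (n%:R / 2 * (G * e / (1 + e)))))).
    apply: ler_wpM2r; first exact: expR_ge0.
    by rewrite -sqrt_expR_exp; apply: ler_sqrt_exp; exact: expR_ge1Dx.
  rewrite -expRD; apply: (@le_trans _ _ (expR (- 1))); last first.
    by rewrite expRN div1r lef_pV2 ?posrE ?expR_gt0//; exact: expR1_ge2.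
  rewrite ler_expR.
  have hG : e + e ^+ 2 <= G * e / (1 + e).
    rewrite ler_pdivlMr//; have e13 : e <= 1 / 3 by rewrite /e; lra.
    by move: G1 e0 e13; clear; move: G e => G e; rewrite expr2; nra.
  have := ler_wpM2l (ltW (divr_gt0 nR (ltr0n R 2))) hG.
  move: (G * e / _) => u hu; move: n2R hu; clear; move: (e ^+ 2) => f; nra.
by move: h; move: (_ * expR _) => u; lra.
Qed.

End Covering.

(** * Dual lattices and the covering radius *)

Section Lattices.
Variable R : realType.

Lemma lattice_zvec n (L : set 'rV[R]_n) : is_lattice L -> exists B B' : 'M[R]_n,
  dual_basis B B' /\ L = [set zvec R z *m B | z in [set: 'rV[int]_n]].
Proof.
move=> [B [fB ->]]; exists B, (invmx B)^T; split.
  by rewrite /dual_basis trmxK mulmxV// -row_free_unit.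
have E (z : 'I_n -> int) : \sum_(i < n) (z i)%:~R *: row i B = zvec R (\row_i z i) *m B.
  by rewrite mulmx_sum_row; apply: eq_bigr => i _; rewrite !mxE.
apply/seteqP; split=> y /=.
  by move=> [z ->]; exists (\row_i z i) => //; rewrite E.
move=> [z _ <-]; exists (fun i => z 0 i); rewrite E.
by congr (zvec R _ *m B); apply/rowP => i; rewrite mxE.
Qed.

Lemma dual_zvec n (B B' : 'M[R]_n) : dual_basis B B' ->
  dual_lattice [set zvec R z *m B | z in [set: 'rV[int]_n]] =
  [set zvec R z *m B' | z in [set: 'rV[int]_n]].
Proof.
move=> BB'; have B'B := dual_basis_sym BB'.
apply/seteqP; split=> w /=.
  move=> hw; pose c := w *m B^T.
  have hc i : exists m : int, c 0 i = m%:~R.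
    apply/intrP; have := hw _ (ex_intro2 _ _ (delta_mx 0 i : 'rV[int]_n) I erefl).
    rewrite dotpC dotp_mul /c /dotp (bigD1 i)//= big1 ?addr0; last first.
      by move=> j ji; rewrite !mxE eqxx/= (negbTE ji) mul0r.
    by rewrite !mxE !eqxx mul1r.
  exists (\row_i projT1 (cid (hc i))) => //.
  have -> : zvec R (\row_i projT1 (cid (hc i))) = c.
    by apply/rowP => i; rewrite !mxE; case: (cid _) => m /= ->.
  by rewrite /c -mulmxA (dual_basis_mulC B'B) mulmx1.
move=> [z _ <-] _ [z' _ <-].
rewrite dotp_mul -mulmxA BB' mulmx1 /dotp; apply: rpred_sum => i _.
by rewrite !mxE rpredM ?intr_int.
Qed.

Lemma cauchy_schwarz n (u v : 'rV[R]_n) : dotp u v ^+ 2 <= nsq u * nsq v.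
Proof.
have [->|v0] := eqVneq v 0.
  by rewrite nsq0 mulr0 /dotp big1 ?expr0n// => i _; rewrite mxE mulr0.
have hv := nsq_gt0 v0.
have := nsq_ge0 (nsq v *: u - dotp u v *: v).
rewrite nsqB !nsqZ dotpZl dotpZr.
move: (nsq u) (nsq v) (dotp u v) hv => a b d b0 h.
have : 0 <= b * (a * b - d ^+ 2) by apply: le_trans h _; rewrite le_eqVlt; apply/orP; left; apply/eqP; ring.
by rewrite pmulr_rge0// subr_ge0.
Qed.


Section FixedLattice.
Variables (n : nat) (B B' : 'M[R]_n).
Hypotheses (n_gt0 : (0 < n)%N) (BB' : dual_basis B B').
Let L := [set zvec R z *m B | z in [set: 'rV[int]_n]].
Let L' := [set zvec R z *m B' | z in [set: 'rV[int]_n]].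
Let B'B : dual_basis B' B. Proof. exact: dual_basis_sym. Qed.

Let zvecB'_neq0 (z : 'rV[int]_n) : z != 0 -> zvec R z *m B' != 0.
Proof.
apply: contra => /eqP /(dual_basis_inj B'B) h; apply/eqP/rowP => i; rewrite mxE.
have := congr1 (fun v : 'rV[R]_n => v 0 i) h; rewrite !mxE => /eqP.
by rewrite intr_eq0 => /eqP.
Qed.

Lemma lambda1_le (z : 'rV[int]_n) : z != 0 -> lambda1 L' <= enorm (zvec R z *m B').
Proof.
move=> z0; apply: ge_inf; first by exists 0 => _ [y _ <-]; exact: sqrtr_ge0.
by exists (zvec R z *m B') => //; split; [exists z|apply/eqP; exact: zvecB'_neq0].
Qed.

Lemma le_lambda1 (c : R) :
  (forall z : 'rV[int]_n, z != 0 -> c <= enorm (zvec R z *m B')) -> c <= lambda1 L'.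
Proof.
move=> h; apply: lb_le_inf.
  have z0 : (const_mx 1 : 'rV[int]_n) != 0.
    apply/eqP => /rowP /(_ (Ordinal n_gt0)); rewrite !mxE => /eqP; by [].
  exists (enorm (zvec R (const_mx 1) *m B')), (zvec R (const_mx 1) *m B') => //.
  by split; [exists (const_mx 1)|apply/eqP; exact: zvecB'_neq0].
move=> _ [_ [[z _ <-] /eqP z0] <-]; apply: h; apply: contraNneq z0 => ->.
by rewrite zvec0 mul0mx.
Qed.

Lemma lambda1_gt0 : 0 < lambda1 L'.
Proof.
have [lam lam0 h] := lattice_min_ex B'B.
apply: (@lt_le_trans _ _ (Num.sqrt lam)); first by rewrite sqrtr_gt0.
by apply: le_lambda1 => z /h; rewrite /enorm; apply: ler_wsqrtr.
Qed.

Lemma lattice_dist_le (t : 'rV[R]_n) (z : 'rV[int]_n) (r : R) : 0 <= r ->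
  nsq (zvec R z *m B - t) <= r ^+ 2 -> lattice_dist L t <= r.
Proof.
move=> r0 h; apply: (@le_trans _ _ (enorm (zvec R z *m B - t))).
  apply: ge_inf; first by exists 0 => _ [y _ <-]; exact: sqrtr_ge0.
  by exists (zvec R z *m B) => //; exists z.
by rewrite /enorm -[leRHS]ger0_norm// -sqrtr_sqr; exact: ler_wsqrtr.
Qed.

Lemma lattice_dist_scaled (r : R) : 0 <= r ->
  (forall C C' : 'M[R]_n, dual_basis C C' ->
    (forall z : 'rV[int]_n, z != 0 -> 1 <= nsq (zvec R z *m C')) ->
    forall t, exists z, nsq (zvec R z *m C - t) <= r ^+ 2) ->
  forall t, lattice_dist L t <= r / lambda1 L'.
Proof.
move=> r0 H t; have l0 := lambda1_gt0; move El : (lambda1 L') (l0) => l {}l0.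
have lu : l != 0 by rewrite gt_eqF.
have CC : dual_basis (l *: B) (l^-1 *: B').
  by rewrite /dual_basis linearZ/= -scalemxAl -scalemxAr scalerA mulfV// scale1r.
have [|z hz] := H _ _ CC _ (l *: t).
  move=> z z0; rewrite -scalemxAr nsqZ exprVn ler_pdivlMl ?exprn_gt0// mulr1.
  rewrite -[leRHS]sqr_sqrtr ?nsq_ge0//; apply: lerXn2r; [exact: ltW|exact: sqrtr_ge0|].
  by rewrite -El; exact: lambda1_le.
apply: (@lattice_dist_le _ z); first by rewrite divr_ge0// ltW.
move: hz; rewrite -scalemxAr -scalerBr nsqZ exprMn exprVn.
by rewrite ler_pdivlMr ?exprn_gt0// mulrC.
Qed.

Lemma covering_radius_le (r : R) : 0 <= r ->
  (forall C C' : 'M[R]_n, dual_basis C C' ->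
    (forall z : 'rV[int]_n, z != 0 -> 1 <= nsq (zvec R z *m C')) ->
    forall t, exists z, nsq (zvec R z *m C - t) <= r ^+ 2) ->
  covering_radius L * lambda1 L' <= r.
Proof.
move=> r0 H; rewrite -ler_pdivlMr ?lambda1_gt0//; apply: ge_sup.
  by exists (lattice_dist L 0), 0.
by move=> _ [t _ <-]; exact: lattice_dist_scaled.
Qed.

(* [t = w / (2 |w|^2)] has [dotp w t = 1 / 2], at distance at least [1 / 2] from every integer. *)
Lemma covering_radius_ge (w : 'rV[R]_n) : dual_lattice L w -> w != 0 ->
  1 / 2 <= covering_radius L * enorm w.
Proof.
move=> dw w0; have nw := nsq_gt0 w0.
have ew : 0 < enorm w by rewrite sqrtr_gt0.
rewrite -ler_pdivrMr//; pose t := (2 * nsq w)^-1 *: w.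
apply: (@le_trans _ _ (lattice_dist L t)); last first.
  apply: ub_le_sup; last by exists t.
  (* An upper bound on all distances is required for the supremum to dominate its elements. *)
  exists ((n%:R + 6) / lambda1 L') => _ [u _ <-].
  apply: lattice_dist_scaled; first by rewrite addr_ge0.
  by move=> C C'; exact: covering_crude.
apply: lb_le_inf.
  by exists (enorm (zvec R 0 *m B - t)), (zvec R 0 *m B) => //; exists 0.
move=> _ [y Ly <-]; rewrite ler_pdivrMr//.
have := cauchy_schwarz w (y - t).
rewrite dotpDr dotpNr dotpZr -/(nsq w).
have -> : (2 * nsq w)^-1 * nsq w = 1 / 2 by field; rewrite gt_eqF.
have /intrP[m ->] := dw y Ly => cs.
have m2 : (1 / 2) ^+ 2 <= (m%:~R - 1 / 2) ^+ 2 :> R.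
  have [m1|m0] := leP 1 m.
    have : 1 <= m%:~R :> R by rewrite ler1z.
    by move: (m%:~R) => M; nra.
  have : m%:~R <= 0 :> R by rewrite lerz0; lia.
  by move: (m%:~R) => M; nra.
rewrite -(ler_sqr _ _) ?nnegrE ?mulr_ge0 ?sqrtr_ge0//.
by rewrite [leRHS]exprMn /enorm !sqr_sqrtr ?nsq_ge0// [leRHS]mulrC; exact: le_trans m2 cs.
Qed.

Lemma covering_radius_lambda1_ge : 1 / 2 <= covering_radius L * lambda1 (dual_lattice L).
Proof.
have dL : dual_lattice L = L' by exact: dual_zvec.
have low z : z != 0 -> 1 / 2 <= covering_radius L * enorm (zvec R z *m B').
  by move=> z0; apply: covering_radius_ge; [rewrite dL; exists z|exact: zvecB'_neq0].
(* Positivity, itself a consequence of [low], allows division, which carries the bound from single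
   dual vectors to their infimum. *)
have c0 : 0 < covering_radius L.
  rewrite ltNge; apply/negP => c0.
  have z0 : (const_mx 1 : 'rV[int]_n) != 0.
    apply/eqP => /rowP /(_ (Ordinal n_gt0)); rewrite !mxE => /eqP; by [].
  have := low _ z0; have := mulr_le0_ge0 c0 (sqrtr_ge0 (nsq (zvec R (const_mx 1) *m B'))).
  by rewrite /enorm; move: (_ * _) => u; lra.
rewrite dL -ler_pdivrMl//; apply: le_lambda1 => z /low h.
by rewrite ler_pdivrMl.
Qed.

End FixedLattice.

Lemma transference_bound n (r : R) : (0 < n)%N -> 0 <= r ->
  (forall C C' : 'M[R]_n, dual_basis C C' ->
    (forall z : 'rV[int]_n, z != 0 -> 1 <= nsq (zvec R z *m C')) ->
    forall t, exists z, nsq (zvec R z *m C - t) <= r ^+ 2) ->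
  forall L : set 'rV[R]_n, is_lattice L ->
  1 / 2 <= covering_radius L * lambda1 (dual_lattice L) <= r.
Proof.
move=> n0 r0 H L /lattice_zvec[B [B' [BB' ->]]].
rewrite (covering_radius_lambda1_ge n0 BB')/= (dual_zvec BB').
exact: covering_radius_le.
Qed.

(** Below the threshold [n1] the crude bound gives [n + 6 <= 7 * n], hence the value [7] of [eps].
    The constant [c] depends on [n] only, so the strict inequality survives the supremum over
    lattices. *)
Lemma uniform_bound : exists eps : nat -> R, (eps @ \oo --> (0 : R)) /\
  forall n, (0 < n)%N -> exists2 c, c < 1275 / 10000 + eps n &
   forall L : set 'rV[R]_n, is_lattice L ->
   1 / 2 <= covering_radius L * lambda1 (dual_lattice L) <= c * n%:R.
Proof.
have [n1 H] := covering_asym R.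
exists (fun n => if (n1 <= n)%N then 0 else 7); split.
  apply: (@cvg_trans _ ((fun=> 0 : R) @ \oo)); last exact: cvg_cst.
  apply: near_eq_cvg; exists n1 => // n /= hn; by rewrite hn.
have rate0 : 0 <= covering_rate R by rewrite /covering_rate; lra.
move=> n n_gt0; case: ifP => hn.
  exists (covering_rate R); first by rewrite /covering_rate; lra.
  apply: transference_bound => //; first by rewrite mulr_ge0.
  exact: H.
exists 7; first by lra.
have n1R : 1 <= n%:R :> R by rewrite ler1n.
apply: transference_bound => // C C' CC' min1 t.
have [z hz] := covering_crude CC' min1 t; exists z; apply: le_trans hz _.
by apply: lerXn2r; rewrite ?nnegrE; move: n1R; move: (n%:R) => N; lra.
Qed.

End Lattices.

Theorem theorem1p2 (R : realType) :
  (exists eps : nat -> R,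
     (eps @ \oo --> (0 : R)) /\
     (forall (n : nat) (L : set 'rV[R]_n), (1 <= n)%N -> is_lattice L ->
        1 / 2 <= covering_radius L * lambda1 (dual_lattice L) /\
        covering_radius L * lambda1 (dual_lattice L)
          < (1275 / 10000 + eps n) * n%:R)) /\
  (exists eps : nat -> R,
     (eps @ \oo --> (0 : R)) /\
     (forall n : nat, (1 <= n)%N ->
        (transference R n < (1275 / 10000 + eps n)%:E)%E)).
Proof.
have [eps [eps0 H]] := uniform_bound R.
split; exists eps; split=> // n.
  move=> L n1 hL; have [c hc /(_ L hL)/andP[h1 h2]] := H n n1.
  by split=> //; apply: (le_lt_trans h2); rewrite ltr_pM2r// ltr0n.
move=> n1; have [c hc HL] := H n n1.
apply: (@le_lt_trans _ _ c%:E); last by rewrite lte_fin.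
have -> : (c%:E = (n%:R^-1)%:E * (c * n%:R)%:E :> \bar R)%E.
  by rewrite -EFinM mulrCA mulVf ?mulr1// pnatr_eq0 -lt0n.
apply: lee_wpmul2l; first by rewrite lee_fin invr_ge0.
apply: ge_ereal_sup => _ [L hL <-]; rewrite lee_fin.
by have /andP[] := HL L hL.
Qed.
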